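(* Let $B$ be a real separable Banach space with dual $B^*$, let $X$ be a centered Gaussian random vector with values in $B$, let $\mu=\mathcal{L}(X)$, and let $\Phi$ be the distribution function of a mean zero, variance one Gaussian random variable. Then $$HD_{B^*}(a,\mu)=1-\Phi(\|a\|_\mu),\quad a\in H_\mu,$$ and $$HD_{B^*}(a,\mu)=0,\quad a\in B\setminus H_\mu.$$ Furthermore, $\mu(a\in B: HD_{B^*}(a,\mu)=0)$ equals $0$ or $1$ according as $H_\mu$ is a finite dimensional Hilbert space or an infinite dimensional Hilbert space. In addition, if $H_\mu$ is infinite dimensional and $X_1,X_2,\ldots$ are i.i.d. copies of $X$ with empirical measures $\mu_n=\frac1n\sum_{j=1}^n\delta_{X_j}$, $n\ge1$, then for all $a\in H_\mu$ the empirical half space depth $HD_{B^*}(a,\mu_n)$ is zero with $P$-probability one. Hence the empirical half space depth fails to approximate the true half space depth $HD_{B^*}(a,\mu)$ for all $a\in H_\mu$ in this setting, i.e. consistency fails at all such points.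
   Context: $X,X_1,X_2,\ldots$ are Borel measurable maps on a probability space $(\Omega,\mathcal{F},P)$. For a Borel probability $\nu$ on $B$ and $a\in B$, $$HD_{B^*}(a,\nu)=\inf_{t\in B^*}\nu(x\in B: t(x)\ge t(a)),$$ so $HD_{B^*}(a,\mu_n)=\inf_{t\in B^*}\frac1n\sum_{j=1}^nI(t(X_j)\ge t(a))$. The Hilbert space $H_\mu$ generating $\mu$: let $S:B^*\to B$ be the continuous linear map given by the Bochner integral $Sf=\int_Bxf(x)\,d\mu(x)$. $H_\mu$ is the completion of the range of $S$ with respect to the norm $\|\cdot\|_\mu$ obtained from the inner product $\langle Sf,Sg\rangle_\mu=\int_Bf(x)g(x)\,d\mu(x)$. It is viewed as a subset of $B$, since $\|x\|\le\sigma(\mu)\|x\|_\mu$ on $H_\mu$, where $\sigma(\mu)=\sup_{\|f\|_{B^*}\le1}(\int_Bf^2d\mu)^{1/2}<\infty$; here $\|\cdot\|$ and $\|\cdot\|_{B^*}$ are the norms of $B$ and $B^*$.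
   Formalization: The first formula, HD(a,μ)=1−Φ(‖a‖_μ) on H_μ, is stated only when X is not almost surely 0: for X=0 a.s., H_μ={0} and HD(0,μ)=1, whereas 1−Φ(0)=1/2. All other claims are stated without this restriction. *)

(* Defs.v *)
From HB Require Import structures.
From mathcomp Require Import all_boot all_order all_algebra finmap.
From mathcomp Require Import all_classical all_reals all_analysis.

Set Implicit Arguments.
Unset Strict Implicit.
Unset Printing Implicit Defensive.

Import Order.TTheory GRing.Theory Num.Theory.
Import numFieldNormedType.Exports.

Local Open Scope classical_set_scope.
Local Open Scope ring_scope.

Notation borel B := (g_sigma_algebraType (@open B)).

Definition separable (B : topologicalType) : Prop :=
  exists2 D : set B, countable D & dense D.

Definition dual (R : realType) (B : normedModType R) : set {linear B -> R^o} :=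
  [set t | continuous t].

Definition finite_dimensional (R : realType) (V : lmodType R) (H : set V) : Prop :=
  exists (n : nat) (e : 'I_n -> V),
    H = [set \sum_(i < n) c i *: e i | c in [set: 'I_n -> R]].

(* [normal_prob 0 0] is by convention the uniform law on [0, 1], so the
   degenerate Gaussian has to be singled out. *)
Definition centered_normal (R : realType) (s : R) (A : set R) : \bar R :=
  if s == 0 then \d_(0 : R) A else normal_prob 0 s A.

Definition Phi (R : realType) (r : R) : R := fine (normal_prob 0 1 `]-oo, r]).

Definition centered_gaussian (R : realType) (B : normedModType R)
    (d : measure_display) (T : measurableType d) (P : probability T R)
    (X : T -> B) : Prop :=
  forall t, dual t -> exists2 s : R, 0 <= s &
    forall A : set R, measurable A ->
      P ((fun w => t (X w)) @^-1` A) = centered_normal s A.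

Definition mutually_independent (R : realType) (d d' : measure_display)
    (T : measurableType d) (T' : measurableType d') (P : probability T R)
    (X_ : nat -> T -> T') : Prop :=
  forall (J : {fset nat}) (A : nat -> set T'),
    (forall j, measurable (A j)) ->
    P (\bigcap_(j in [set` J]) (X_ j @^-1` A j)) =
    (\prod_(j <- J) P (X_ j @^-1` A j))%E.

Definition iid_copies (R : realType) (d d' : measure_display)
    (T : measurableType d) (T' : measurableType d') (P : probability T R)
    (X : T -> T') (X_ : nat -> T -> T') : Prop :=
  mutually_independent P X_ /\
  forall j (A : set T'), measurable A -> P (X_ j @^-1` A) = P (X @^-1` A).

Definition empirical (R : realType) (B : normedModType R) (T : Type)
    (X_ : nat -> T -> borel B) (n : nat) (w : T) :
    {measure set (borel B) -> \bar R} :=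
  mscale (n%:R^-1)%:nng (msum (fun j => \d_(X_ j w)) n).

Definition HD (R : realType) (B : normedModType R)
    (nu : {measure set (borel B) -> \bar R}) (a : B) : \bar R :=
  ereal_inf [set nu [set x | t a <= t x] | t in @dual R B].

Section bochner.
Context (R : realType) (B : normedModType R).
Context (d : measure_display) (T : measurableType d) (mu : probability T R).

Definition simple_map (s : T -> B) : Prop :=
  measurable_fun setT (s : T -> borel B) /\ finite_set (range s).

Definition simple_integral (s : T -> B) : B :=
  \sum_(y \in range s) fine (mu (s @^-1` [set y])) *: y.

Definition is_bochner_integral (f : T -> B) (v : B) : Prop :=
  exists s : nat -> T -> B,
    [/\ forall n, simple_map (s n),
        {ae mu, forall x, s n x @[n --> \oo] --> f x},
        (\int[mu]_x (`|f x - s n x|)%:E)%E @[n --> \oo] --> 0%E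
      & simple_integral (s n) @[n --> \oo] --> v].

(* Value 0 when f is not Bochner integrable. *)
Definition bochner_integral (f : T -> B) : B :=
  xget 0 [set v | is_bochner_integral f v].

End bochner.

Section generating_hilbert_space.
Context (R : realType) (B : normedModType R) (mu : probability (borel B) R).

Definition covS (f : {linear B -> R^o}) : B :=
  bochner_integral mu (fun x : borel B => (f x : R) *: (x : B)).

(* The scalar product <S f, S g>_mu on the range of S. *)
Definition Hdot (f g : B -> R) : R := \int[mu]_x (f x * g x).

Definition Hseminorm (f : B -> R) : R := Num.sqrt (Hdot f f).

(* [f] lists functionals whose images under S form a ||.||_mu-Cauchy sequence,
   i.e. it represents a point of the abstract completion of the range of S;
   [a] is the image of that point under the continuous extension to the
   completion of the inclusion of the range of S in B. *)
Definition represents (f : nat -> {linear B -> R^o}) (a : B) : Prop :=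
  [/\ forall n, dual (f n),
      forall e : R, 0 < e -> exists N : nat, forall m n : nat,
        (N <= m)%N -> (N <= n)%N -> Hseminorm (fun x => f m x - f n x) < e
    & covS (f n) @[n --> \oo] --> a].

Definition Hspace : set B := [set a | exists f, represents f a].

(* The norm of the completion, i.e. the limit of ||S f_n||_mu along any
   representing sequence; meaningful on [Hspace] only. *)
Definition Hnorm (a : B) : R :=
  xget 0 [set r | exists2 f, represents f a &
                  Hseminorm (f n) @[n --> \oo] --> r].

End generating_hilbert_space.

(* Main.v *)
(* A functional t has law N(0, sd(t)^2) under mu, so sd(t) = 0 or
   mu{x | t a <= t x} = 1 - Phi(t a / sd(t)), and the depth of a is governed by
   the best constant C in |t a| <= C sd(t). By the Riesz theorem such a C exists
   exactly for a in H_mu, and the best one is ||a||_mu. Weak integrals become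
   Bochner integrals because the norm is square integrable: mu x mu is invariant
   under rotation by pi/4 (characteristic functions agree), hence Fernique's
   tail estimate.

   If H_mu has infinite dimension there are orthonormal functionals
   e_0, ..., e_(K-1) for every K. For fixed c the events e_k <= c are pairwise
   independent of equal positive probability, so almost surely one of them
   occurs. A point a of H_mu has |e_k a| <= C; taking c = -C - 1 shows that H_mu
   is null, and, applied to the events that e_k <= c at all of X_1, ..., X_n,
   that some half space {x | e_k a <= e_k x} contains no sample point. *)

Require Import Defs.
From HB Require Import structures.
From mathcomp Require Import all_boot all_order all_algebra finmap.
From mathcomp Require Import all_classical all_reals all_analysis.
From mathcomp Require Import measurable_realfun.
From mathcomp Require Import ring lra.

Set Implicit Arguments.
Unset Strict Implicit.
Unset Printing Implicit Defensive.

Import Order.TTheory GRing.Theory Num.Theory.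
Import numFieldNormedType.Exports.

Local Open Scope classical_set_scope.
Local Open Scope ring_scope.

(** Only the laws of single functionals are given, yet joint laws are needed: for two orthogonal
    functionals, and for countably many functionals on the product space. They come from uniqueness
    for characteristic functions, obtained without an inversion formula: indicators of half lines
    are bounded limits of trigonometric polynomials. This compares intersections of half spaces
    only, so in the product space a norm bound is written as countably many bounds on the
    functionals of [norming_sequence]. The same device settles measurability for the product of the
    two Borel sigma-algebras.

    Fernique's estimate is needed because S f integrates f(x) x, whose norm is of order |x|^2.
    Finite orthonormal families suffice, unrelated for different lengths: by Chebyshev, K pairwise
    independent events of probability p all fail with probability at most 1 / (K p).

    The formula 1 - Phi(|a|_mu) fails for the Dirac mass at 0, where the depth of 0 is 1 and not
    1/2; hence the condition [mu [set 0] != 1]. *)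

(* Hahn-Banach, by Zorn's lemma on graphs dominated by the norm. *)
Lemma norming_functional (R : realType) (B : normedModType R) (x0 : B) :
  exists t : {linear B -> R^o}, [/\ dual t, t x0 = `|x0| & forall x, `|t x| <= `|x|].
Proof.
(* The guard [G !=set0] makes the empty graph admissible, as the union of an empty chain must be. *)
pose P (G : set (B * R)) := [/\ G !=set0 ->  G (x0, `|x0|),
   forall x r y s c, G (x, r) -> G (y, s) -> G (c *: x + y, c * r + s)
    & forall x r, G (x, r) -> r <= `|x|].
have [G [[Gx0 Glin Gdom] Gmax]] : exists A, P A /\ forall C, A `<` C -> ~ P C.
  apply: Zorn_bigcup => F FP Ftot; split.
  - move=> [p [A FA Ap]]; exists A => //.
    by have [+ _ _] := FP _ FA; apply; exists p.
  - move=> x r y s c [A FA Ax] [C FC Cy].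
    have [AC|CA] := Ftot _ _ FA FC.
    + by exists C => //; have [_ + _] := FP _ FC; apply => //; exact: AC.
    + by exists A => //; have [_ + _] := FP _ FA; apply => //; exact: CA.
  - by move=> x r [A FA Ax]; have [_ _] := FP _ FA; apply.
have G0 : G !=set0.
  apply: contrapT => G0; apply: (Gmax [set p | exists c, p = (c *: x0, c * `|x0|)]).
    split; last by move=> /(_ (1 *: x0, 1 * `|x0|)) h; apply: G0; exists (1 *: x0, 1 * `|x0|); apply: h; exists 1.
    by move=> p Gp; exfalso; apply: G0; exists p.
  split.
  - by move=> _; exists 1; rewrite scale1r mul1r.
  - move=> x r y s c [a [-> ->]] [b [-> ->]]; exists (c * a + b).
    by rewrite scalerDl scalerA mulrDl mulrA.
  - by move=> x r [c [-> ->]]; rewrite normrZ ler_wpM2r// ler_norm.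
move: Gx0 => /(_ G0) Gx0.
have G00 : G (0, 0).
  have := Glin _ _ _ _ (-1) Gx0 Gx0.
  by rewrite scaleN1r addNr mulN1r addNr.
have GZ x r c : G (x, r) -> G (c *: x, c * r).
  by move=> Gx; have := Glin _ _ _ _ c Gx G00; rewrite !addr0.
have GB x r y s : G (x, r) -> G (y, s) -> G (x - y, r - s).
  move=> Gx Gy; have := Glin _ _ _ _ (-1) Gy Gx.
  by rewrite scaleN1r mulN1r addrC [- s + _]addrC.
have Gfun x r s : G (x, r) -> G (x, s) -> r = s.
  move=> Gr Gs.
  have := Gdom _ _ (GB _ _ _ _ Gr Gs).
  have := Gdom _ _ (GB _ _ _ _ Gs Gr).
  rewrite !subrr normr0 !subr_le0 => h1 h2.
  by apply/eqP; rewrite eq_le h1 h2.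
have Gtot x : exists r, G (x, r).
  apply: contrapT => nx.
  (* The value r at the new point x must satisfy v - |z - x| <= r <= |y + x| - u for all (z, v) and
     (y, u) in G. The supremum of the lower bounds does. *)
  pose S := [set p.2 - `|p.1 - x| | p in G].
  have ubS y u : G (y, u) -> ubound S (`|y + x| - u).
    move=> Gy _ [[z v] Gz <-] /=.
    rewrite lerBlDr addrAC lerBrDr.
    have := Gdom _ _ (Glin _ _ _ _ 1 Gz Gy); rewrite scale1r mul1r => /le_trans; apply.
    by rewrite (_ : z + y = (y + x) + (z - x)) ?ler_normD// addrACA subrr addr0 addrC.
  have S0 : S !=set0 by exists (0 - `|0 - x|); exists (0, 0).
  have supS : has_sup S by split => //; eexists; exact: ubS G00.
  pose r := sup S.
  have rlow z v : G (z, v) -> v - `|z - x| <= r.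
    by move=> Gz; apply: ub_le_sup; [case: supS|exists (z, v)].
  have rup y u : G (y, u) -> r <= `|y + x| - u.
    by move=> Gy; apply: ge_sup => //; exact: ubS.
  pose G' := [set p : B * R | exists c q, G q /\ p = (c *: x + q.1, c * r + q.2)].
  apply: (Gmax G').
    split; last first.
      move=> /(_ (x, r)) h; apply: nx; exists r; apply: h; exists 1, (0, 0).
      by rewrite scale1r mul1r !addr0.
    by move=> [y u] Gy; exists 0, (y, u); rewrite scale0r mul0r !add0r.
  split.
  - by move=> _; exists 0, (x0, `|x0|); rewrite scale0r mul0r !add0r.
  - move=> y u z v c [a [[y1 u1] [Gy [-> ->]]]] [b [[z1 v1] [Gz [-> ->]]]] /=.
    exists (c * a + b), (c *: y1 + z1, c * u1 + v1); split; first exact: Glin.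
    congr pair => /=.
      by rewrite scalerDr scalerDl scalerA addrACA.
    by rewrite mulrDr mulrDl mulrA addrACA.
  - move=> y u [c [[z v] [Gz [-> ->]]]] /=.
    (* Domination at c x + z reduces by homogeneity to c = -1 or c = 1, which are [rlow] and
       [rup]. *)
    have [c0|c0|->] := ltgtP c 0; last by rewrite scale0r mul0r !add0r; exact: Gdom.
    + have := rlow _ _ (GZ _ _ (- c)^-1 Gz).
      rewrite -(ler_pM2l (_ : 0 < - c)) ?oppr_gt0// mulrBr mulrA divff ?oppr_eq0 ?lt_eqF// mul1r.
      have c0' : 0 <= - c by rewrite oppr_ge0 ltW.
      rewrite -[X in X * `|_|](ger0_norm c0') -normrZ scalerBr scalerA divff ?oppr_eq0 ?lt_eqF// scale1r.
      by rewrite scaleNr opprK mulNr => h; rewrite -[X in _ <= `|X|]addrC; lra.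
    + have := rup _ _ (GZ _ _ c^-1 Gz).
      rewrite -(ler_pM2l c0) mulrBr mulrA divff ?gt_eqF// mul1r.
      rewrite -[X in X * `|_|](gtr0_norm c0) -normrZ scalerDr scalerA divff ?gt_eqF// scale1r.
      by move=> h; rewrite -[X in _ <= `|X|]addrC; lra.
pose t x : R^o := sval (cid (Gtot x)).
have Gt x : G (x, t x) by rewrite /t; case: cid.
have tlin : linear t.
  by move=> c x y; apply: Gfun (Gt _) _; exact: Glin.
have tle x : `|t x| <= `|x|.
  rewrite ler_norml Gdom// andbT -normrN lerNl; apply: Gdom.
  by have := GB _ _ _ _ G00 (Gt x); rewrite !sub0r.
pose tL : {linear B -> R^o} := HB.pack t (GRing.isLinear.Build _ _ _ _ t tlin).
exists tL; split => //; last first.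
- exact: Gfun (Gt _) Gx0.
- move=> x; apply/cvgrPdist_le => /= e e0; near=> y.
  rewrite -[t x]/(tL x) -[t y]/(tL y) -linearB; apply: (le_trans (tle _)).
  by near: y; exact: cvgr_dist_le.
Unshelve. all: by end_near. Qed.

(** Norming functionals at the points y of a countable dense set suffice: the one at y takes at x a
    value at least |y| - |x - y|, hence within e of |x| once |x - y| < e / 2. *)
Lemma norming_sequence (R : realType) (B : normedModType R) :
  @separable B -> exists tau : nat -> {linear B -> R^o},
    [/\ forall k, dual (tau k), forall k x, `|tau k x| <= `|x|
      & forall x e, 0 < e -> exists k, `|x| - e < tau k x].
Proof.
move=> [D /countable_injP[f finj] Dd].
pose t_ (x : B) := sval (cid (norming_functional x)).
pose d_ k := xget 0 [set x | D x /\ f x = k].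
exists (fun k => t_ (d_ k)); split.
- by move=> k; rewrite /t_; case: cid => t [].
- by move=> k; rewrite /t_; case: cid => t [].
move=> x e e0.
have [y [xy Dy]] : (ball x (e / 2) `&` D) !=set0.
  by apply: Dd; [exists x; apply: ballxx; rewrite divr_gt0|exact: ball_open; rewrite divr_gt0].
exists (f y).
have -> : d_ (f y) = y.
  by rewrite /d_; case: xgetP => [z _ [Dz /finj]|/(_ y)[]//]; apply; exact: mem_set.
rewrite /t_; case: cid => t [_ ty tle] /=.
move: xy; rewrite -ball_normE /= => xy.
have := tle (x - y); rewrite linearB ty ler_norml => /andP[+ _].
have := ler_normB y (y - x); rewrite opprB addrCA subrr addr0 (distrC y x).
lra.
Qed.

(** * The normal law *)

Section normal_law.
Context (R : realType).
Local Notation leb := (@lebesgue_measure R).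
Implicit Types (m s : R) (g : R -> R).

Import HBNNSimple.

(** Indicators hold by the definition of the law through its density; simple functions follow by
    linearity and the rest by monotone convergence. *)
Lemma ge0_integral_normal_prob m s (f : R -> \bar R) :
  measurable_fun setT f -> (forall x, 0 <= f x)%E ->
  (\int[normal_prob m s]_x f x = \int[leb]_x (f x * (normal_pdf m s x)%:E))%E.
Proof.
move=> mf f0.
pose p x := (normal_pdf m s x)%:E.
have p0 x : (0 <= p x)%E by rewrite lee_fin normal_pdf_ge0.
have mp : measurable_fun [set: R] p by apply/measurable_EFinP; exact: measurable_normal_pdf.
have indic (E : set R) : measurable E ->
    (\int[normal_prob m s]_x (\1_E x)%:E = \int[leb]_x ((\1_E x)%:E * p x))%E.
  move=> mE; rewrite integral_indic// setIT; transitivity (\int[leb]_(x in E) p x)%E => //; rewrite integral_mkcond.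
  apply: eq_integral => x _; rewrite patchE indicE.
  by case: ifPn => xE; rewrite ?mul1e ?mul0e.
have nnsfun (h : {nnsfun R >-> R}) :
    (\int[normal_prob m s]_x (h x)%:E = \int[leb]_x ((h x)%:E * p x))%E.
  under [LHS]eq_integral do rewrite fimfunE -fsumEFin//.
  rewrite [LHS]ge0_integral_fsum//; last 2 first.
  - move=> r; by apply/measurable_EFinP; apply: measurable_funM => //; apply: measurable_indic; rewrite -[X in measurable X]setTI; apply: (measurable_funP h) => //.
  - by move=> n x _; rewrite EFinM nnfun_muleindic_ge0.
  under [RHS]eq_integral.
    move=> x xD; rewrite fimfunE -fsumEFin// ge0_mule_fsuml; last first.
      by move=> r; rewrite EFinM nnfun_muleindic_ge0.
    over.
  rewrite [RHS]ge0_integral_fsum//; last 2 first.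
  - move=> r; apply: emeasurable_funM => //.
    by apply/measurable_EFinP; apply: measurable_funM => //; apply: measurable_indic; rewrite -[X in measurable X]setTI; apply: (measurable_funP h) => //.
  - by move=> n x _; rewrite EFinM mule_ge0// nnfun_muleindic_ge0.
  apply: eq_fsbigr => r _.
  have mh : measurable (h @^-1` [set r]).
    by rewrite -[X in measurable X]setTI; apply: (measurable_funP h) => //.
  have [r0|r0] := leP 0 r; last first.
    rewrite preimage_nnfun0// indic0.
    by rewrite !integral0_eq// => x _; rewrite mulr0 ?mul0e.
  transitivity (r%:E * \int[normal_prob m s]_x (\1_(h @^-1` [set r]) x)%:E)%E.
    rewrite -ge0_integralZl//.
    by apply/measurable_EFinP/measurable_indic.
  rewrite (indic _ mh) -ge0_integralZl//.
  - by apply: eq_integral => x _; rewrite EFinM muleA.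
  - by apply: emeasurable_funM => //; apply/measurable_EFinP/measurable_indic.
  - by move=> x _; rewrite mule_ge0// lee_fin.
pose f_ := nnsfun_approx measurableT mf.
transitivity (lim (\int[normal_prob m s]_x (f_ n x)%:E @[n --> \oo])%E).
  rewrite -monotone_convergence//=.
  - apply: eq_integral => ? /[!inE] xD; apply/esym/cvg_lim => //=.
    exact: cvg_nnsfun_approx.
  - by move=> n; apply/measurable_EFinP; apply: (@measurable_funPT _ _ _ _ (f_ n)).
  - by move=> n ? _; rewrite lee_fin.
  - move=> x _ a b ab; rewrite lee_fin.
    by have /lefP/(_ x) := nd_nnsfun_approx measurableT mf ab.
rewrite [X in _ = X](_ : _ = lim
    (\int[leb]_x ((f_ n x)%:E * p x) @[n --> \oo])%E); last first.
  rewrite -monotone_convergence//=.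
  - apply: eq_integral => x /[!inE] xD; apply/esym/cvg_lim => //.
    apply: cvgeZr => //; exact: cvg_nnsfun_approx.
  - by move=> n; apply: emeasurable_funM => //; apply/measurable_EFinP; apply: (@measurable_funPT _ _ _ _ (f_ n)).
  - by move=> n ? _; rewrite mule_ge0// lee_fin.
  - move=> x _ a b ab; apply: lee_wpmul2r => //; rewrite lee_fin.
    by have /lefP/(_ x) := nd_nnsfun_approx measurableT mf ab.
by apply: congr_lim; apply/funext => n /=; exact: nnsfun.
Qed.

Lemma integrable_normal_prob m s g : measurable_fun [set: R] g ->
  leb.-integrable setT (fun x => (g x * normal_pdf m s x)%:E) ->
  (normal_prob m s).-integrable setT (EFin \o g).
Proof.
move=> mg /integrableP[_ h]; apply/integrableP; split; first exact/measurable_EFinP.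
rewrite ge0_integral_normal_prob//; last first.
  by apply/measurableT_comp => //; exact/measurable_EFinP.
rewrite (le_lt_trans _ h)// le_eqVlt; apply/orP; left; apply/eqP.
apply: eq_integral => x _ /=; rewrite -EFinM normrM (ger0_norm (normal_pdf_ge0 _ _ _)).
by [].
Qed.

Lemma Rintegral_normal_prob m s g : measurable_fun [set: R] g ->
  leb.-integrable setT (fun x => (g x * normal_pdf m s x)%:E) ->
  \int[normal_prob m s]_x g x = \int[leb]_x (g x * normal_pdf m s x).
Proof.
move=> mg ig; congr fine.
rewrite integralE [RHS]integralE.
have mEg : measurable_fun [set: R] (EFin \o g) by exact/measurable_EFinP.
rewrite ge0_integral_normal_prob//; last exact: measurable_funepos.
rewrite ge0_integral_normal_prob//; last exact: measurable_funeneg.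
congr (_ - _)%E; apply: eq_integral => x _ /=.
- rewrite !funeposE /= -!EFin_max -EFinM maxr_pMl ?normal_pdf_ge0//.
  by rewrite mul0r.
- rewrite !funenegE /= -!EFin_max -EFinM maxr_pMl ?normal_pdf_ge0//.
  by rewrite mul0r mulNr.
Qed.

End normal_law.

(** * Integration by parts and the second moment of the normal law *)

Section normal_calculus.
Context (R : realType).
Local Notation leb := (@lebesgue_measure R).

(** Integration by parts over the whole line with vanishing boundary terms: the fundamental theorem
    on [-n - 1, n + 1], then dominated convergence. It serves for u = x p(x) and u = sin(t x) p(x),
    where p is a normal density. *)
Lemma integral_derive_vanishing (u v : R -> R) :
  (forall x, is_derive x (1 : R) u (v x)) -> continuous v ->
  leb.-integrable setT (EFin \o v) ->
  u n.+1%:R @[n --> \oo] --> (0 : R) -> u (- n.+1%:R) @[n --> \oo] --> (0 : R) ->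
  \int[leb]_x v x = 0.
Proof.
move=> duv cv iv up um.
pose v_ n x := ((EFin \o v) \_ `[- n.+1%:R, n.+1%:R]) x.
have mv : measurable_fun setT (EFin \o v) by case/integrableP : iv.
have cvgI : (\int[leb]_x v_ n x)%E @[n --> \oo] --> (\int[leb]_x (v x)%:E)%E.
  apply: (@dominated_cvg _ _ _ leb setT measurableT v_ (EFin \o v) (abse \o (EFin \o v))).
  - move=> n; apply/(measurable_restrictT _ _).1 => //.
    exact: measurable_funTS.
  - move=> x _; apply: cvg_near_cst; near=> n.
    rewrite /v_ patchE ifT// inE /= in_itv /= -ler_norml.
    near: n; exists (Num.truncn `|x|) => // n /= nx.
    rewrite ltW// (lt_le_trans (truncnS_gt _))// ler_nat ltnS.
    exact: nx.
  - by [].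
  - exact: integrable_abse.
  - move=> n x _; rewrite /v_ patchE; case: ifPn => //=.
    by rewrite normr0 lee_fin.
have E n : (\int[leb]_x v_ n x = (u n.+1%:R - u (- n.+1%:R))%:E)%E.
  rewrite /v_ -integral_mkcond.
  rewrite (@continuous_FTC2 _ v u) ?EFinB//.
  - by rewrite -subr_gt0 opprK.
  - by apply: continuous_subspaceT => x; exact: cv.
  - have cu x : {for x, continuous u}.
      apply: differentiable_continuous; apply/derivable1_diffP.
      by have := duv x => -[].
    split.
    + by move=> x _; have := duv x => -[].
    + by apply: cvg_at_right_filter; exact: cu.
    + by apply: cvg_at_left_filter; exact: cu.
  - by move=> x _; rewrite derive1E; have := duv x => -[].
have lim0 : (\int[leb]_x v_ n x)%E @[n --> \oo] --> 0%E.
  under eq_fun do rewrite E.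
  apply: cvg_EFin; first exact: nearW.
  by rewrite -[0](subr0 0); apply: cvgB.
rewrite /Rintegral.
by rewrite (cvg_unique _ cvgI lim0).
Unshelve. all: by end_near. Qed.

Lemma is_derive_normal_pdf (s x : R) : s != 0 ->
  is_derive x (1 : R) (normal_pdf 0 s) (- (x / s ^+ 2) * normal_pdf 0 s x).
Proof.
move=> s0; rewrite normal_pdfE// /normal_fun.
have -> : - (x / s ^+ 2) * (normal_peak s * expR (- (x - 0) ^+ 2 / (s ^+ 2 *+ 2))) =
   normal_peak s * ((- (2 * x)) / (s ^+ 2 *+ 2) * expR (- (x - 0) ^+ 2 / (s ^+ 2 *+ 2))).
  by rewrite subr0; field.
have h : is_derive x (1 : R) (fun x : R => - (x - 0) ^+ 2 / (s ^+ 2 *+ 2))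
     ((- (2 * x)) / (s ^+ 2 *+ 2)).
  apply: is_derive_eq.
  rewrite /GRing.scale /= !subr0. ring.
apply: is_derive_eq. rewrite /GRing.scale /=. ring.
Qed.

(** With y = x^2 / (4 s^2), half of the exponent absorbs the factor x^2 because y exp(-y) <= 1; the
    other half is the exponent of the density with deviation sqrt 2 s. *)
Lemma normal_pdf_sqr_le (s : R) : s != 0 -> exists2 C, 0 <= C &
  forall x, x ^+ 2 * normal_pdf 0 s x <= C * normal_pdf 0 (Num.sqrt 2 * s) x.
Proof.
move=> s0.
have r0 : Num.sqrt 2 * s != 0 by apply: mulf_neq0 => //; rewrite gt_eqF// sqrtr_gt0.
exists (4 * s ^+ 2 * normal_peak s / normal_peak (Num.sqrt 2 * s)).
  rewrite divr_ge0 ?normal_peak_ge0// mulr_ge0 ?normal_peak_ge0// mulr_ge0 ?sqr_ge0//.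
move=> x; rewrite !normal_pdfE// /normal_fun !subr0.
rewrite [leRHS]mulrA divfK ?gt_eqF ?normal_peak_gt0//.
rewrite exprMn sqr_sqrtr//.
set y := x ^+ 2 / (4 * s ^+ 2).
have y0 : 0 <= y by rewrite divr_ge0 ?sqr_ge0// mulr_ge0 ?sqr_ge0.
have -> : - x ^+ 2 / (s ^+ 2 *+ 2) = - y + - y by rewrite /y; field.
have -> : - x ^+ 2 / (2 * s ^+ 2 *+ 2) = - y by rewrite /y; field.
have -> : x ^+ 2 * (normal_peak s * expR (- y + - y)) =
   (4 * s ^+ 2 * normal_peak s) * ((y * expR (- y)) * expR (- y)).
  by rewrite expRD /y; field.
apply: ler_wpM2l; first by rewrite mulr_ge0 ?normal_peak_ge0// mulr_ge0 ?sqr_ge0.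
rewrite -[leRHS]mul1r ler_wpM2r ?expR_ge0//.
rewrite expRN ler_pdivrMr ?expR_gt0// mul1r.
by apply: le_trans (expR_ge1Dx _); rewrite lerDr.
Qed.

Lemma cvg_natr_inv : n.+1%:R^-1 @[n --> \oo] --> (0 : R).
Proof. exact: cvg_harmonic. Qed.

Lemma normal_pdf_sqr_integrable (s : R) : s != 0 ->
  leb.-integrable setT (fun x => (x ^+ 2 * normal_pdf 0 s x)%:E).
Proof.
move=> s0; have [C C0 hC] := normal_pdf_sqr_le s0.
have mp := @measurable_normal_pdf R 0 s.
apply: (@le_integrable _ _ _ leb setT measurableT _ (fun x => (C * normal_pdf 0 (Num.sqrt 2 * s) x)%:E)) => //.
- apply/measurable_EFinP; apply: measurable_funM => //; exact: measurable_funX.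
- move=> x _; rewrite lee_fin ger0_norm; last first.
    by apply: mulr_ge0; [exact: sqr_ge0|exact: normal_pdf_ge0].
  by rewrite (le_trans (hC x))// ler_norm.
- exact: (integrableZl measurableT C (@integrable_normal_pdf R 0 (Num.sqrt 2 * s))).
Qed.

Lemma normal_second_moment (s : R) : s != 0 ->
  (normal_prob 0 s).-integrable setT (fun x => (x ^+ 2)%:E) /\
  \int[normal_prob 0 s]_x (x ^+ 2) = s ^+ 2.
Proof.
move=> s0; have ip2 := normal_pdf_sqr_integrable s0.
have mX : measurable_fun [set: R] (fun x : R => x ^+ 2) by exact: measurable_funX.
split; first exact: integrable_normal_prob.
rewrite Rintegral_normal_prob//.
have [C C0 hC] := normal_pdf_sqr_le s0.
(* The bound x^2 p(x) <= D gives |x p(x)| <= D / |x|, the decay of the boundary terms. The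
   derivative of x p(x) is p(x) - x^2 p(x) / s^2. *)
pose D := C * normal_peak (Num.sqrt 2 * s).
have r0 : Num.sqrt 2 * s != 0 by apply: mulf_neq0 => //; rewrite gt_eqF// sqrtr_gt0.
have hD x : x ^+ 2 * normal_pdf 0 s x <= D.
  by rewrite (le_trans (hC x))// ler_wpM2l// normal_pdf_ub.
have ip := @integrable_normal_pdf R 0 s.
have : \int[leb]_x (normal_pdf 0 s x - (s ^+ 2)^-1 * (x ^+ 2 * normal_pdf 0 s x)) = 0.
  apply: (@integral_derive_vanishing (fun x => x * normal_pdf 0 s x)).
  - move=> x; have h := is_derive_normal_pdf x s0.
    apply: is_derive_eq; rewrite /GRing.scale /=; field.
    exact: s0.
  - move=> x; apply: cvgB; first exact: continuous_normal_pdf.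
    apply: cvgM; first exact: cvg_cst.
    by apply: cvgM; [exact: exprn_continuous|exact: continuous_normal_pdf].
  - rewrite /comp; under eq_fun do rewrite EFinB.
    apply: integrableB => //; under eq_fun do rewrite EFinM.
    exact: integrableZl.
  - apply: (@squeeze_cvgr _ _ _ _ (cst 0) (fun n => D * n.+1%:R^-1)).
    + near=> n; rewrite mulr_ge0 ?normal_pdf_ge0//=.
      by rewrite ler_pdivlMr// mulrAC -expr2.
    + exact: cvg_cst.
    + by rewrite -[0](mulr0 D); apply: cvgM; [exact: cvg_cst|exact: cvg_natr_inv].
  - apply: (@squeeze_cvgr _ _ _ _ (fun n => - (D * n.+1%:R^-1)) (cst 0)).
    + near=> n; rewrite mulNr oppr_le0 mulr_ge0 ?normal_pdf_ge0//= andbT.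
      by rewrite lerN2 ler_pdivlMr// mulrAC -expr2 -sqrrN.
    + by rewrite -[0](oppr0) -[0](mulr0 D); apply: cvgN; apply: cvgM; [exact: cvg_cst|exact: cvg_natr_inv].
    + exact: cvg_cst.
rewrite RintegralB//; last exact: (integrableZl measurableT (s ^+ 2)^-1 ip2).
rewrite RintegralZl// /Rintegral integral_normal_pdf /= -/(Rintegral _ _ _).
move=> /eqP; rewrite subr_eq0 => /eqP h.
by rewrite -[LHS](mulVKf (_ : s ^+ 2 != 0)) ?sqrf_eq0// -h mulr1.
Unshelve. all: by end_near. Qed.
End normal_calculus.

(** * Characteristic function of the normal law *)

Section normal_characteristic.
Context (R : realType).
Local Notation leb := (@lebesgue_measure R).

Lemma measurable_cosf d (T : measurableType d) (f : T -> R) :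
  measurable_fun setT f -> measurable_fun setT (fun x => cos (f x)).
Proof.
move=> mf; apply: measurableT_comp => //; apply: continuous_measurable_fun.
exact: continuous_cos.
Qed.

Lemma measurable_sinf d (T : measurableType d) (f : T -> R) :
  measurable_fun setT f -> measurable_fun setT (fun x => sin (f x)).
Proof.
move=> mf; apply: measurableT_comp => //; apply: continuous_measurable_fun.
exact: continuous_sin.
Qed.

Lemma normr_cos_le1 (x : R) : `|cos x| <= 1.
Proof. by rewrite ler_norml cos_geN1 cos_le1. Qed.

Lemma normr_sin_le1 (x : R) : `|sin x| <= 1.
Proof. by rewrite ler_norml sin_geN1 sin_le1. Qed.

Lemma normal_pdf_dominated (s : R) (g : R -> R) : s != 0 ->
  measurable_fun setT g -> (forall x, `|g x| <= 1 + x ^+ 2) ->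
  leb.-integrable setT (fun x => (g x * normal_pdf 0 s x)%:E).
Proof.
move=> s0 mg hg; have mp := @measurable_normal_pdf R 0 s.
apply: (@le_integrable _ _ _ leb setT measurableT _
  (fun x => (normal_pdf 0 s x)%:E + (x ^+ 2 * normal_pdf 0 s x)%:E)%E) => //.
- by apply/measurable_EFinP; apply: measurable_funM.
- move=> x _; rewrite -EFinD lee_fin normrM.
  rewrite -[X in X + _]mul1r -mulrDl normrM ler_wpM2r//.
  by rewrite (le_trans (hg x))// ler_norm.
- apply: integrableD => //; first exact: integrable_normal_pdf.
  exact: normal_pdf_sqr_integrable.
Qed.

Lemma normr_le_1sqr (x : R) : `|x| <= 1 + x ^+ 2.
Proof.
rewrite -[x ^+ 2]ger0_norm ?sqr_ge0// normrX.
by have := sqr_ge0 (`|x| - 1); have := normr_ge0 x; nra.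
Qed.

(** Stein's identity E[Z g(Z)] = E[g'(Z)] for g(x) = sin(t x): the derivative of g p is (g' - x g)
    p. *)
Lemma stein_sin (t : R) :
  \int[normal_prob 0 1]_x (x * sin (t * x)) =
  t * \int[normal_prob 0 1]_x cos (t * x).
Proof.
have o0 : (1 : R) != 0 by exact: oner_neq0.
have mt : measurable_fun [set: R] (fun x : R => t * x) by exact: measurable_funM.
have m1 : measurable_fun [set: R] (fun x : R => x * sin (t * x)).
  by apply: measurable_funM => //; exact: measurable_sinf.
have m2 : measurable_fun [set: R] (fun x : R => cos (t * x)) by exact: measurable_cosf.
have i1 : leb.-integrable setT (fun x => (x * sin (t * x) * normal_pdf 0 1 x)%:E).
  apply: normal_pdf_dominated => // x; rewrite normrM.
  rewrite (le_trans _ (normr_le_1sqr x))// -[leRHS]mulr1 ler_wpM2l//.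
  exact: normr_sin_le1.
have i2 : leb.-integrable setT (fun x => (cos (t * x) * normal_pdf 0 1 x)%:E).
  apply: normal_pdf_dominated => // x.
  by rewrite (le_trans (normr_cos_le1 _))// lerDl sqr_ge0.
rewrite !Rintegral_normal_prob//.
rewrite -RintegralZl//; apply/esym/eqP; rewrite -subr_eq0 -RintegralB//; last first.
  exact: (integrableZl measurableT t i2).
have [C C0 hC] := normal_pdf_sqr_le o0.
pose D := C * normal_peak (Num.sqrt 2 * 1 : R).
have r0 : Num.sqrt 2 * 1 != 0 :> R by apply: mulf_neq0 => //; rewrite gt_eqF// sqrtr_gt0.
have hD x : x ^+ 2 * normal_pdf 0 1 x <= D.
  by rewrite (le_trans (hC x))// ler_wpM2l// normal_pdf_ub.
have D0 : 0 <= D by rewrite mulr_ge0// normal_peak_ge0.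
have bnd (x : R) n : `|x| = n.+1%:R -> `|sin (t * x) * normal_pdf 0 1 x| <= D * n.+1%:R^-1.
  move=> xn; rewrite normrM -[X in _ * X <= _]mulr1.
  rewrite (le_trans (ler_wpM2r _ (normr_sin_le1 _)))// mul1r mulr1.
  rewrite ger0_norm ?normal_pdf_ge0// ler_pdivlMr//.
  rewrite (le_trans _ (hD x))// mulrC ler_wpM2r ?normal_pdf_ge0//.
  rewrite -[x ^+ 2]ger0_norm ?sqr_ge0// normrX xn.
  by rewrite expr2 ler_peMl// ler1n.
apply/eqP; apply: (@integral_derive_vanishing _ (fun x => sin (t * x) * normal_pdf 0 1 x)).
- move=> x; have h := is_derive_normal_pdf x o0.
  have h2 : is_derive x (1 : R) (fun x => sin (t * x)) (t * cos (t * x)).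
    apply: is_derive_eq; rewrite /GRing.scale /=; ring.
  apply: is_derive_eq; rewrite /GRing.scale /=; rewrite expr1n divr1; ring.
- move=> x; have cm : {for x, continuous (fun y : R => t * y)}.
    by apply: cvgM; [exact: cvg_cst|exact: cvg_id].
  apply: cvgB.
    apply: cvgM; first exact: cvg_cst.
    apply: cvgM; last exact: continuous_normal_pdf.
    apply: continuous_comp => //; exact: continuous_cos.
  apply: cvgM; last exact: continuous_normal_pdf.
  apply: cvgM; first exact: cvg_id.
  apply: continuous_comp => //; exact: continuous_sin.
- rewrite /comp; under eq_fun do rewrite EFinB.
  apply: integrableB => //; exact: (integrableZl measurableT t i2).
- apply: norm_cvg0; apply: (@squeeze_cvgr _ _ _ _ (cst 0) (fun n => D * n.+1%:R^-1)).
  + by near=> n; rewrite normr_ge0 bnd//= ger0_norm.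
  + exact: cvg_cst.
  + by rewrite -[0](mulr0 D); apply: cvgM; [exact: cvg_cst|exact: cvg_natr_inv].
- apply: norm_cvg0; apply: (@squeeze_cvgr _ _ _ _ (cst 0) (fun n => D * n.+1%:R^-1)).
  + by near=> n; rewrite normr_ge0 bnd//= normrN ger0_norm.
  + exact: cvg_cst.
  + by rewrite -[0](mulr0 D); apply: cvgM; [exact: cvg_cst|exact: cvg_natr_inv].
Unshelve. all: by end_near. Qed.

Lemma normal_integrable_dominated (g : R -> R) :
  measurable_fun setT g -> (forall x, `|g x| <= 1 + x ^+ 2) ->
  (normal_prob 0 1).-integrable setT (EFin \o g).
Proof.
move=> mg hg; apply: integrable_normal_prob => //.
by apply: normal_pdf_dominated => //; exact: oner_neq0.
Qed.

(** Differentiation under the integral, dominated by |x|, gives - E[Z sin(t Z)], which [stein_sin]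
    turns into the linear equation psi' = - t psi. *)
Lemma is_derive_normal_cos (t : R) :
  is_derive t (1 : R) (fun t => \int[normal_prob 0 1]_x cos (t * x))
    (- (t * \int[normal_prob 0 1]_x cos (t * x))).
Proof.
have d1 (s x : R) : is_derive s (1 : R) (fun s => cos (s * x)) (- (x * sin (s * x))).
  apply: is_derive_eq; rewrite /GRing.scale /=; ring.
have mt (s : R) : measurable_fun [set: R] (fun x : R => s * x) by exact: measurable_funM.
have tI : `]t - 1, t + 1[%classic t by rewrite /= in_itv /= ltrBlDr ltrDl ltr01.
have ic s : `]t - 1, t + 1[%classic s -> (normal_prob 0 1).-integrable setT
    (EFin \o (fun x : R => cos (s * x))).
  move=> _; apply: normal_integrable_dominated; first exact: measurable_cosf.
  by move=> x; rewrite (le_trans (normr_cos_le1 _))// lerDl sqr_ge0.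
have iG : (normal_prob 0 1).-integrable setT (EFin \o (fun x : R => `|x|)).
  apply: normal_integrable_dominated; first exact: measurableT_comp.
  by move=> x; rewrite normr_id normr_le_1sqr.
have dd s (x : R) : `]t - 1, t + 1[%classic s -> setT x -> derivable (fun s : R => cos (s * x)) s 1.
  by move=> _ _; have := d1 s x => -[].
have p1 (s x : R) : partial1of2 (fun s x : R => cos (s * x)) s x = - (x * sin (s * x)).
  by rewrite partial1of2E; have := d1 s x => -[].
have G_ub s (x : R) : `]t - 1, t + 1[%classic s -> setT x ->
    `|partial1of2 (fun s x : R => cos (s * x)) s x| <= `|x|.
  move=> _ _; rewrite p1 normrN normrM -[leRHS]mulr1 ler_wpM2l//.
  exact: normr_sin_le1.
split.
  exact: (derivable_under_integral measurableT tI ic dd (fun x => normr_ge0 x) iG G_ub).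
rewrite -derive1E.
have -> := differentiation_under_integral measurableT tI ic dd (fun x => normr_ge0 x) iG G_ub.
under eq_Rintegral do rewrite p1.
rewrite -stein_sin -[RHS]mulN1r -RintegralZl//.
  by apply: eq_Rintegral => x _; rewrite mulN1r.
apply: normal_integrable_dominated.
  by apply: measurable_funM => //; exact: measurable_sinf.
move=> x; rewrite normrM.
rewrite (le_trans _ (normr_le_1sqr x))// -[leRHS]mulr1 ler_wpM2l//.
exact: normr_sin_le1.
Qed.

Lemma normal_cos (t : R) :
  \int[normal_prob 0 1]_x cos (t * x) = expR (- t ^+ 2 / 2).
Proof.
pose psi (t : R) := \int[normal_prob 0 1]_x cos (t * x).
have psi0 : psi 0 = 1.
  rewrite /psi; under eq_Rintegral do rewrite mul0r cos0.
  rewrite /Rintegral integral_cst// mul1e -[RHS]/(fine 1%E); congr fine; exact: (probability_setT (normal_prob 0 1)).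
have dpsi (s : R) : is_derive s (1 : R) psi (- (s * psi s)) by exact: is_derive_normal_cos.
have : psi t * expR (t ^+ 2 / 2) = psi 0 * expR (0 ^+ 2 / 2).
  clearbody psi.
  apply: (@is_derive_0_is_cst _ (fun t => psi t * expR (t ^+ 2 / 2))) => s.
  have h := dpsi s.
  have h2 : is_derive s (1 : R) (fun s : R => s ^+ 2 / 2) s.
    apply: is_derive_eq; rewrite /GRing.scale /=; by field.
  have h3 : is_derive s (1 : R) (fun s : R => expR (s ^+ 2 / 2)) (s * expR (s ^+ 2 / 2)).
    apply: is_derive_eq; rewrite /GRing.scale /=; by field.
  have := is_deriveM h h3; rewrite /GRing.scale /=.
  suff -> : psi s * (s * expR (s ^+ 2 / 2)) + expR (s ^+ 2 / 2) * - (s * psi s) = 0 by [].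
  ring.
rewrite psi0 expr0n mul0r expR0 mulr1 -/(psi t) => h.
rewrite mulNr expRN; apply: (mulIf (lt0r_neq0 (expR_gt0 (t ^+ 2 / 2)))).
by rewrite h mulVf// expR_eq0.
Qed.

End normal_characteristic.

(** * Uniqueness by characteristic functions *)

Lemma probability_bounded_integrable d (T : measurableType d) (R : realType)
    (P : probability T R) (f : T -> R) (M : R) :
  measurable_fun setT f -> (forall x, `|f x| <= M) ->
  P.-integrable setT (EFin \o f).
Proof.
move=> mf fM; apply: (@le_integrable _ _ _ P setT measurableT _ (fun=> M%:E)).
- exact/measurable_EFinP.
- by move=> x _ /=; rewrite lee_fin (le_trans (fM x))// ler_norm.
- exact: finite_measure_integrable_cst.
Qed.

Lemma cvg_Rintegral_bounded d (T : measurableType d) (R : realType)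
    (P : probability T R) (f_ : nat -> T -> R) (f : T -> R) (M : R) :
  (forall n, measurable_fun setT (f_ n)) -> (forall n x, `|f_ n x| <= M) ->
  (forall x, f_ n x @[n --> \oo] --> f x) ->
  \int[P]_x f_ n x @[n --> \oo] --> \int[P]_x f x.
Proof.
move=> mf fM cf.
have mlim : measurable_fun setT f by apply: (measurable_fun_cvg mf) => x _; exact: cf.
have flim x : `|f x| <= M.
  by apply: (cvgr_to_le (cvg_norm (cf x))); exact: nearW.
have : (\int[P]_x (f_ n x)%:E)%E @[n --> \oo] --> (\int[P]_x (f x)%:E)%E.
  apply: (@dominated_cvg _ _ _ P setT measurableT _ _ (fun=> M%:E)) => //.
  - by move=> n; exact/measurable_EFinP.
  - by move=> x _; apply: cvg_EFin; [exact: nearW|exact: cf].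
  - exact: finite_measure_integrable_cst.
  - by move=> n x _ /=; rewrite lee_fin.
have fin (g : T -> R) : measurable_fun setT g -> (forall x, `|g x| <= M) ->
    (\int[P]_x (g x)%:E)%E \is a fin_num.
  by move=> mg gM; apply: integrable_fin_num => //; exact: probability_bounded_integrable mg gM.
rewrite -(fineK (fin _ mlim flim)) => /fine_cvg; exact.
Qed.

Section bounded_indicator_approximation.
Context (R : realType).

Lemma cvg_natr_geometric (q : R) : 0 <= q < 1 -> n%:R * q ^+ n @[n --> \oo] --> (0 : R).
Proof.
move=> /andP[q0 q1]; have [->|qn0] := eqVneq q 0.
  apply: cvg_near_cst; near=> n; rewrite expr0n.
  by rewrite (_ : (n == 0)%N = false) ?mulr0//; apply/negbTE; rewrite -lt0n; near: n; exact: nbhs_infty_gt.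
have {}q0 : 0 < q by rewrite lt_neqAle eq_sym qn0.
pose l := - ln q; have l0 : 0 < l by rewrite oppr_gt0 ln_lt0// q0.
have qE n : q ^+ n = expR (- (n%:R * l)).
  by rewrite /l mulrN opprK expRM_natl lnK.
(* As exp(y) >= y, one has q^n = exp(n l / 2)^-2 <= 4 / (n l)^2, which beats the factor n. *)
rewrite -cvg_shiftS /=; apply: (@squeeze_cvgr _ _ _ _ (cst 0) (fun n => 4 / l ^+ 2 * n.+1%:R^-1)).
- near=> n; rewrite mulr_ge0 ?exprn_ge0 ?(ltW q0)//=.
  rewrite qE expRN -[X in X^-1](_ : expR (n.+1%:R * l / 2) ^+ 2 = _); last first.
    by rewrite -expRM_natl; congr expR; field.
  have h := expR_ge1Dx (n.+1%:R * l / 2).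
  set E := expR _ in h *.
  have n0 : 0 < n.+1%:R :> R by [].
  have nl : 0 < n.+1%:R * l / 2 by rewrite divr_gt0// mulr_gt0.
  have hE : (n.+1%:R * l / 2) ^+ 2 <= E ^+ 2.
    by rewrite lerXn2r// ?nnegrE ?expR_ge0 ?(ltW nl)// (le_trans _ h)// lerDr.
  rewrite ler_pdivrMr ?exprn_gt0 ?expR_gt0//.
  rewrite (le_trans _ (ler_wpM2l _ hE))//; last by rewrite mulr_ge0// divr_ge0// sqr_ge0.
  rewrite le_eqVlt; apply/orP; left; apply/eqP.
  by move: (n.+1%:R : R) n0 => N n0; field; rewrite !gt_eqF.
- exact: cvg_cst.
- by rewrite -[0](mulr0 (4 / l ^+ 2)); apply: cvgM; [exact: cvg_cst|exact: cvg_natr_inv].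
Unshelve. all: by end_near. Qed.

(* Polynomials in u converging boundedly on [0, 1] to the indicator of u < 1/2;
   the extra factor n in the exponent kills the point u = 1/2. *)
Lemma cvg_step_polynomial (u : R) : 0 <= u <= 1 ->
  (1 - u ^+ n) ^+ (n * 2 ^ n) @[n --> \oo] --> (((u < 1 / 2)%R : nat)%:R : R).
Proof.
move=> /andP[u0 u1].
have un01 n : 0 <= u ^+ n <= 1 by rewrite exprn_ge0//= exprn_ile1.
have b01 n : 0 <= 1 - u ^+ n <= 1 by have := un01 n; lra.
case: ltP => hu.
  apply: (@squeeze_cvgr _ _ _ _ (fun n => 1 - n%:R * (2 * u) ^+ n) (cst 1)).
  - near=> n; apply/andP; split; last by apply: exprn_ile1; have /andP[] := b01 n.
    (* Bernoulli's inequality, used for m = n 2^n, where m u^n = n (2 u)^n tends to 0. *)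
    have bern m : 1 - m%:R * u ^+ n <= (1 - u ^+ n) ^+ m.
      elim: m => [|m IH]; first by rewrite mul0r subr0 expr0.
      rewrite exprS; have /andP[h0 h1] := b01 n; have /andP[h2 h3] := un01 n.
      apply: le_trans (ler_wpM2l h0 IH).
      have m0 : 0 <= m%:R :> R by [].
      rewrite -natr1; nra.
    apply: le_trans (bern _); rewrite natrM natrX exprMn mulrA.
    exact: lexx.
  - rewrite -[X in _ --> X](subr0 1); apply: cvgB; first exact: cvg_cst.
    by apply: cvg_natr_geometric; lra.
  - exact: cvg_cst.
apply: (@squeeze_cvgr _ _ _ _ (cst 0) (fun n => n%:R^-1)).
- near=> n; apply/andP; split; first by apply: exprn_ge0; have /andP[] := b01 n.
  have n0 : (0 : R) < n%:R by rewrite ltr0n; near: n; exact: nbhs_infty_gt.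
  (* For 2 u >= 1 the power is at most exp(- n (2 u)^n) <= exp(- n) <= 1 / n. *)
  have h1 : (1 - u ^+ n) ^+ (n * 2 ^ n) <= expR (- u ^+ n) ^+ (n * 2 ^ n).
    apply: lerXn2r; rewrite ?nnegrE ?expR_ge0//; first by have /andP[] := b01 n.
    exact: expR_ge1Dx.
  apply: (le_trans h1); rewrite -expRM_natl mulrN expRN lef_pV2 ?posrE ?expR_gt0//.
  apply: (@le_trans _ _ (1 + n%:R)); first by rewrite lerDr.
  apply: (le_trans (expR_ge1Dx _)); rewrite ler_expR natrM natrX -mulrA -exprMn.
  by rewrite ler_peMr// exprn_ege1//; lra.
- exact: cvg_cst.
- by rewrite -cvg_shiftS /=; exact: cvg_natr_inv.
Unshelve. all: by end_near. Qed.

End bounded_indicator_approximation.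

(** Trigonometric polynomials only reach periodic events such as sin(y / k) < 0. Stretching the
    period recovers the half line, since y / k eventually lies in ]-pi, pi[. *)
Lemma sin_lt0_near (R : realType) (y : R) :
  \forall k \near \oo, (sin (y / k.+1%:R) < 0) = (y < 0).
Proof.
have pos (z : R) : 0 < z -> \forall k \near \oo, 0 < sin (z / k.+1%:R).
  move=> z0; near=> k; apply: sin_gt0_pi.
  rewrite divr_gt0//= ltr_pdivrMr// -ltr_pdivrMl ?pi_gt0//.
  rewrite (lt_le_trans (truncnS_gt _))// ler_nat ltnS.
  by near: k; exists (Num.truncn (pi^-1 * z)).
have [y0|y0|->] := ltgtP y 0.
- have := pos (- y); rewrite oppr_gt0 => /(_ y0); apply: filterS => k.
  by rewrite mulNr sinN oppr_gt0.
- by have := pos _ y0; apply: filterS => k h; rewrite ltNge ltW.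
- by apply: nearW => k; rewrite mul0r sin0 ltxx.
Unshelve. all: by end_near. Qed.

Lemma lt_addr_inv_near (R : realType) (y c : R) :
  \forall k \near \oo, (y < c + k.+1%:R^-1) = (y <= c).
Proof.
have [yc|yc] := leP y c.
  by apply: nearW => k; rewrite (le_lt_trans yc)// ltrDl.
near=> k; apply/negbTE; rewrite -leNgt -lerBrDl.
near: k; apply: (cvgr_le 0); [exact: cvg_natr_inv|by rewrite subr_gt0].
Unshelve. all: by end_near. Qed.

(* A family L of pairs of random variables, linear and with matching
   characteristic functions, has matching finite-dimensional laws: the integrals
   of trigonometric polynomials agree, and these converge boundedly to
   indicators of half lines. *)
Section cosine_determines.
Context (R : realType) (d1 d2 : measure_display).
Context (T1 : measurableType d1) (T2 : measurableType d2).
Context (P1 : probability T1 R) (P2 : probability T2 R).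
Variable L : (T1 -> R) -> (T2 -> R) -> Prop.
Hypothesis L_measurable : forall p q, L p q -> measurable_fun setT p /\ measurable_fun setT q.
Hypothesis L_linear : forall p q p' q' c, L p q -> L p' q' ->
  L (fun x => p x + c * p' x) (fun x => q x + c * q' x).
Hypothesis L_cos : forall p q, L p q ->
  \int[P1]_x cos (p x) = \int[P2]_x cos (q x).
Hypothesis L_sin : forall p q, L p q ->
  \int[P1]_x sin (p x) = \int[P2]_x sin (q x).

Let bounded_by (M : R) (h1 : T1 -> R) (h2 : T2 -> R) :=
  [/\ measurable_fun setT h1, measurable_fun setT h2,
      forall x, `|h1 x| <= M & forall x, `|h2 x| <= M].

(** Agreement is required against every cosine in L and not just for total masses, so that it
    survives multiplication by further trigonometric factors. The phase phi covers sines as well. *)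
Let trig_eq (h1 : T1 -> R) (h2 : T2 -> R) :=
  (exists M, bounded_by M h1 h2) /\
  forall p q phi, L p q ->
    \int[P1]_x (h1 x * cos (p x + phi)) = \int[P2]_x (h2 x * cos (q x + phi)).

(** The multipliers form an algebra; by [multiplier_cos] it contains all polynomials in the cosines
    of members of L. *)
Let multiplier (g1 : T1 -> R) (g2 : T2 -> R) := forall h1 h2,
  trig_eq h1 h2 -> trig_eq (fun x => h1 x * g1 x) (fun x => h2 x * g2 x).

Let L_zero p q : L p q -> L (fun=> 0) (fun=> 0).
Proof.
move=> Lpq; have := L_linear (-1) Lpq Lpq.
congr L; apply/funext => x; rewrite mulN1r subrr//.
Qed.

Let L_scale p q c : L p q -> L (fun x => c * p x) (fun x => c * q x).
Proof.
move=> Lpq; have := L_linear c (L_zero Lpq) Lpq.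
by congr L; apply/funext => x; rewrite add0r.
Qed.

Let integrable_cosM d (T : measurableType d) (P : probability T R) M (h p : T -> R) phi :
  measurable_fun setT h -> (forall x, `|h x| <= M) -> measurable_fun setT p ->
  P.-integrable setT (EFin \o (fun x => h x * cos (p x + phi))).
Proof.
move=> mh hM mp; apply: (@probability_bounded_integrable _ _ _ _ _ M).
  by apply: measurable_funM => //; apply: measurable_cosf; exact: measurable_funD.
move=> x; rewrite normrM -[leRHS]mulr1.
by apply: ler_pM => //; exact: normr_cos_le1.
Qed.

Let trig_eq_comb h1 h2 h1' h2' c : trig_eq h1 h2 -> trig_eq h1' h2' ->
  trig_eq (fun x => h1 x + c * h1' x) (fun x => h2 x + c * h2' x).
Proof.
move=> [[M [mh1 mh2 b1 b2]] e] [[M' [mh1' mh2' b1' b2']] e']; split.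
  exists (M + `|c| * M'); split.
  - by apply: measurable_funD => //; exact: measurable_funM.
  - by apply: measurable_funD => //; exact: measurable_funM.
  - move=> x; apply: (le_trans (ler_normD _ _)); apply: lerD => //.
    by rewrite normrM ler_wpM2l.
  - move=> x; apply: (le_trans (ler_normD _ _)); apply: lerD => //.
    by rewrite normrM ler_wpM2l.
move=> p q phi Lpq; have [mp mq] := L_measurable Lpq.
have split_int d (T : measurableType d) (P : probability T R) M0 M1 (h h' f : T -> R) :
    measurable_fun setT h -> (forall x, `|h x| <= M0) ->
    measurable_fun setT h' -> (forall x, `|h' x| <= M1) -> measurable_fun setT f ->
    \int[P]_x ((h x + c * h' x) * cos (f x + phi)) =
    \int[P]_x (h x * cos (f x + phi)) + c * \int[P]_x (h' x * cos (f x + phi)).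
  move=> mh hM mh' hM' mf.
  have i1 := integrable_cosM P phi mh hM mf.
  have i2 := integrable_cosM P phi mh' hM' mf.
  rewrite -RintegralZl// -RintegralD//; last exact: (integrableZl measurableT c i2).
  by apply: eq_Rintegral => x _; rewrite mulrDl mulrA.
by rewrite (split_int _ _ _ M M')// (split_int _ _ _ M M')// (e _ _ phi Lpq) (e' _ _ phi Lpq).
Qed.

(** A product of two cosines is half the sum of the cosines of the sum and of the difference of
    their arguments, and L is stable under both. *)
Let multiplier_cos p q phi : L p q ->
  multiplier (fun x => cos (p x + phi)) (fun x => cos (q x + phi)).
Proof.
move=> Lpq h1 h2 [[M [mh1 mh2 b1 b2]] e]; have [mp mq] := L_measurable Lpq.
split.
  exists M; split.
  - by apply: measurable_funM => //; apply: measurable_cosf; exact: measurable_funD.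
  - by apply: measurable_funM => //; apply: measurable_cosf; exact: measurable_funD.
  - move=> x; rewrite normrM -[leRHS]mulr1; apply: ler_pM => //; exact: normr_cos_le1.
  - move=> x; rewrite normrM -[leRHS]mulr1; apply: ler_pM => //; exact: normr_cos_le1.
move=> p' q' phi' Lpq'; have [mp' mq'] := L_measurable Lpq'.
have LD := L_linear 1 Lpq Lpq'; have LB := L_linear (-1) Lpq Lpq'.
have [mpD mqD] := L_measurable LD; have [mpB mqB] := L_measurable LB.
have split_int d (T : measurableType d) (P : probability T R) (h f f' : T -> R) :
    measurable_fun setT h -> (forall x, `|h x| <= M) ->
    measurable_fun setT (fun x => f x + 1 * f' x) -> measurable_fun setT (fun x => f x + -1 * f' x) ->
    \int[P]_x (h x * cos (f x + phi) * cos (f' x + phi')) =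
    2^-1 * (\int[P]_x (h x * cos (f x + 1 * f' x + (phi + phi'))) +
            \int[P]_x (h x * cos (f x + -1 * f' x + (phi - phi')))).
  move=> mh hM mfD mfB.
  have i1 := integrable_cosM P (phi + phi') mh hM mfD.
  have i2 := integrable_cosM P (phi - phi') mh hM mfB.
  rewrite -RintegralD// -RintegralZl//; last exact: (integrableD measurableT i1 i2).
  apply: eq_Rintegral => x _.
  have -> : f x + 1 * f' x + (phi + phi') = (f x + phi) + (f' x + phi') by ring.
  have -> : f x + -1 * f' x + (phi - phi') = (f x + phi) - (f' x + phi') by ring.
  by move: (f x + phi) (f' x + phi') => u v; rewrite cosD cosB; field.
by rewrite !split_int// (e _ _ _ LD) (e _ _ _ LB).
Qed.

Let multiplierM g1 g2 g1' g2' : multiplier g1 g2 -> multiplier g1' g2' ->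
  multiplier (fun x => g1 x * g1' x) (fun x => g2 x * g2' x).
Proof.
move=> mg mg' h1 h2 /mg /mg'.
by congr trig_eq; apply/funext => x; rewrite mulrA.
Qed.

Let multiplier_comb g1 g2 g1' g2' c : multiplier g1 g2 -> multiplier g1' g2' ->
  multiplier (fun x => g1 x + c * g1' x) (fun x => g2 x + c * g2' x).
Proof.
move=> mg mg' h1 h2 h; have := trig_eq_comb c (mg _ _ h) (mg' _ _ h).
by congr trig_eq; apply/funext => x; ring.
Qed.

Let multiplier1 : multiplier (fun=> 1) (fun=> 1).
Proof. by move=> h1 h2; congr trig_eq; apply/funext => x; rewrite mulr1. Qed.

Let multiplierX g1 g2 n : multiplier g1 g2 ->
  multiplier (fun x => g1 x ^+ n) (fun x => g2 x ^+ n).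
Proof.
move=> mg; elim: n => [|n IH]; first exact: multiplier1.
by have := multiplierM mg IH; congr multiplier; apply/funext => x; rewrite exprS.
Qed.

(** The uniform bound 1 is what dominated convergence requires; [trig_eq] alone bounds each pair by
    a constant of its own. *)
Let trig_eq_lim (h1_ : nat -> T1 -> R) (h2_ : nat -> T2 -> R) h1 h2 :
  (forall n, bounded_by 1 (h1_ n) (h2_ n)) -> (forall n, trig_eq (h1_ n) (h2_ n)) ->
  (forall x, h1_ n x @[n --> \oo] --> h1 x) -> (forall x, h2_ n x @[n --> \oo] --> h2 x) ->
  bounded_by 1 h1 h2 /\ trig_eq h1 h2.
Proof.
move=> hb he c1 c2.
have b : bounded_by 1 h1 h2.
  split.
  - by apply: (@measurable_fun_cvg _ _ _ _ h1_) => [n|x _]; [have [] := hb n|exact: c1].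
  - by apply: (@measurable_fun_cvg _ _ _ _ h2_) => [n|x _]; [have [] := hb n|exact: c2].
  - move=> x; apply: (cvgr_to_le (cvg_norm (c1 x))).
    by apply: nearW => n; have [] := hb n.
  - move=> x; apply: (cvgr_to_le (cvg_norm (c2 x))).
    by apply: nearW => n; have [] := hb n.
split => //; split; first by exists 1.
move=> p q phi Lpq; have [mp mq] := L_measurable Lpq.
have lim_int d (T : measurableType d) (P : probability T R) (h_ : nat -> T -> R) (h f : T -> R) :
    (forall n, measurable_fun setT (h_ n)) -> (forall n x, `|h_ n x| <= 1) ->
    (forall x, h_ n x @[n --> \oo] --> h x) -> measurable_fun setT f ->
    \int[P]_x (h_ n x * cos (f x + phi)) @[n --> \oo] --> \int[P]_x (h x * cos (f x + phi)).
  move=> mh hM ch mf; apply: (@cvg_Rintegral_bounded _ _ _ P _ _ 1).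
  - by move=> n; apply: measurable_funM => //; apply: measurable_cosf; exact: measurable_funD.
  - by move=> n x; rewrite normrM mulr_ile1//; exact: normr_cos_le1.
  - by move=> x; apply: cvgMl.
have l1 := lim_int _ _ P1 h1_ h1 p (fun n => let: And4 a _ _ _ := hb n in a)
   (fun n => let: And4 _ _ a _ := hb n in a) c1 mp.
have l2 := lim_int _ _ P2 h2_ h2 q (fun n => let: And4 _ a _ _ := hb n in a)
   (fun n => let: And4 _ _ _ a := hb n in a) c2 mq.
have e : (fun n => \int[P1]_x (h1_ n x * cos (p x + phi))) =
         (fun n => \int[P2]_x (h2_ n x * cos (q x + phi))).
  by apply/funext => n; have [_] := he n; apply.
rewrite e in l1.
exact: (cvg_unique _ l1 l2).
Qed.

Let good h1 h2 := bounded_by 1 h1 h2 /\ trig_eq h1 h2.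

Let good_step p q (k c : R) h1 h2 : 0 < k -> L p q -> good h1 h2 ->
  good (fun x => h1 x * ((sin ((p x - c) / k) < 0)%R : nat)%:R)
       (fun x => h2 x * ((sin ((q x - c) / k) < 0)%R : nat)%:R).
Proof.
move=> k0 Lpq [[mh1 mh2 b1 b2] eh]; have [mp mq] := L_measurable Lpq.
(* The sine is rescaled to [0, 1], so that a negative sine means u < 1 / 2, the step of
   [cvg_step_polynomial]. *)
pose u (y : R) := (1 + sin ((y - c) / k)) / 2.
have u01 y : 0 <= u y <= 1.
  by have := sin_geN1 ((y - c) / k); have := sin_le1 ((y - c) / k); rewrite /u; lra.
pose F n y := (1 - u y ^+ n) ^+ (n * 2 ^ n).
have F1 n y : `|F n y| <= 1.
  have /andP[u0 u1] := u01 y.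
  have h0 : 0 <= u y ^+ n by rewrite exprn_ge0.
  have h1' : u y ^+ n <= 1 by rewrite exprn_ile1.
  rewrite /F normrX; apply: exprn_ile1; first exact: normr_ge0.
  by rewrite ger0_norm; lra.
have mF n d (T : measurableType d) (f : T -> R) : measurable_fun setT f ->
    measurable_fun setT (fun x => F n (f x)).
  move=> mf; apply: measurable_funX; apply: measurable_funB => //.
  apply: measurable_funX; apply: measurable_funM => //; apply: measurable_funD => //.
  by apply: measurable_sinf; apply: measurable_funM => //; exact: measurable_funB.
have mulF n : multiplier (fun x => F n (p x)) (fun x => F n (q x)).
  apply: multiplierX.
  have mu : multiplier (fun x => u (p x)) (fun x => u (q x)).
    (* u is 1/2 plus half a cosine: the inner combination 1 - 1/2 is the constant, and the phase -
       pi / 2 turns the cosine into a sine. *)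
    have := multiplier_comb 2^-1 (multiplier_comb (- 2^-1) multiplier1 multiplier1)
      (multiplier_cos (- (c / k) - pi / 2) (L_scale k^-1 Lpq)).
    have uE y : 1 + - 2^-1 * 1 + 2^-1 * cos (k^-1 * y + (- (c / k) - pi / 2)) = u y.
      have -> : k^-1 * y + (- (c / k) - pi / 2) = (y - c) / k - pi / 2.
        by field; rewrite gt_eqF.
      by rewrite cosB cos_pihalf sin_pihalf mulr0 mulr1 add0r /u; field.
    by congr multiplier; apply/funext => x; rewrite uE.
  have := multiplier_comb (-1) multiplier1 (multiplierX n mu).
  by congr multiplier; apply/funext => x; rewrite mulN1r.
have cF y : F n y @[n --> \oo] --> (((sin ((y - c) / k) < 0)%R : nat)%:R : R).
  have -> : (sin ((y - c) / k) < 0) = (u y < 1 / 2).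
    by rewrite /u; apply/idP/idP => ?; lra.
  exact: cvg_step_polynomial.
apply: (@trig_eq_lim (fun n x => h1 x * F n (p x)) (fun n x => h2 x * F n (q x))).
- move=> n; split.
  + by apply: measurable_funM => //; exact: mF.
  + by apply: measurable_funM => //; exact: mF.
  + by move=> x; rewrite normrM mulr_ile1.
  + by move=> x; rewrite normrM mulr_ile1.
- by move=> n; exact: mulF.
- by move=> x; apply: cvgMr; exact: cF.
- by move=> x; apply: cvgMr; exact: cF.
Qed.

Let good_indicatorM (b1_ : nat -> T1 -> bool) (b2_ : nat -> T2 -> bool) b1 b2 h1 h2 :
  (forall n, good (fun x => h1 x * (b1_ n x : nat)%:R) (fun x => h2 x * (b2_ n x : nat)%:R)) ->
  (forall x, \forall n \near \oo, b1_ n x = b1 x) ->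
  (forall x, \forall n \near \oo, b2_ n x = b2 x) ->
  good (fun x => h1 x * (b1 x : nat)%:R) (fun x => h2 x * (b2 x : nat)%:R).
Proof.
move=> hg c1 c2; apply: (@trig_eq_lim (fun n x => h1 x * (b1_ n x : nat)%:R)
   (fun n x => h2 x * (b2_ n x : nat)%:R)).
- by move=> n; have [] := hg n.
- by move=> n; have [] := hg n.
- by move=> x; apply: cvg_near_cst; near=> n; rewrite (near (c1 x) n).
- by move=> x; apply: cvg_near_cst; near=> n; rewrite (near (c2 x) n).
Unshelve. all: by end_near. Qed.

Let good_lt p q (c : R) h1 h2 : L p q -> good h1 h2 ->
  good (fun x => h1 x * ((p x < c)%R : nat)%:R)
       (fun x => h2 x * ((q x < c)%R : nat)%:R).
Proof.
move=> Lpq hg.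
apply: (@good_indicatorM (fun k x => sin ((p x - c) / k.+1%:R) < 0)
   (fun k x => sin ((q x - c) / k.+1%:R) < 0)).
- by move=> k; apply: good_step.
- by move=> x; have := sin_lt0_near (p x - c); apply: filterS => k ->; rewrite subr_lt0.
- by move=> x; have := sin_lt0_near (q x - c); apply: filterS => k ->; rewrite subr_lt0.
Qed.

Let good_le p q (c : R) h1 h2 : L p q -> good h1 h2 ->
  good (fun x => h1 x * ((p x <= c)%R : nat)%:R)
       (fun x => h2 x * ((q x <= c)%R : nat)%:R).
Proof.
move=> Lpq hg.
apply: (@good_indicatorM (fun k x => p x < c + k.+1%:R^-1)
   (fun k x => q x < c + k.+1%:R^-1)).
- by move=> k; apply: good_lt.
- by move=> x; exact: lt_addr_inv_near.
- by move=> x; exact: lt_addr_inv_near.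
Qed.

Let bigcapS T (E : nat -> set T) n :
  \bigcap_(i < n.+1) E i = \bigcap_(i < n) E i `&` E n.
Proof. by rewrite !bigcap_mkord big_ord_recr. Qed.

Lemma cylinder_eq (p : nat -> T1 -> R) (q : nat -> T2 -> R) (c : nat -> R) n :
  (forall i, L (p i) (q i)) ->
  P1 (\bigcap_(i < n) [set x | p i x <= c i]) =
  P2 (\bigcap_(i < n) [set x | q i x <= c i]).
Proof.
move=> Lpq.
have meas d (T : measurableType d) (f : nat -> T -> R) m :
    (forall i, measurable_fun setT (f i)) -> measurable (\bigcap_(i < m) [set x | f i x <= c i]).
  move=> mf; apply: bigcap_measurableType => // i _.
  have -> : [set x | f i x <= c i] = setT `&` f i @^-1` `]-oo, c i].
    by rewrite setTI; apply/seteqP; split => x /=; rewrite in_itv.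
  exact: mf.
have mp i := proj1 (L_measurable (Lpq i)); have mq i := proj2 (L_measurable (Lpq i)).
have : good (\1_(\bigcap_(i < n) [set x | p i x <= c i]))
            (\1_(\bigcap_(i < n) [set x | q i x <= c i])).
  elim: n => [|n IH].
    (* For the constant weight 1, agreement is the equality of characteristic functions, after
       expanding the cosine of a sum. *)
    rewrite !bigcap_mkord !big_ord0 !indicT; split.
      by split => // x; rewrite normr1.
    split; first by exists 1; split => // x; rewrite normr1.
    move=> p' q' phi Lpq'; have [mp' mq'] := L_measurable Lpq'.
    have split_int d (T : measurableType d) (P : probability T R) (f : T -> R) :
        measurable_fun setT f -> \int[P]_x (1 * cos (f x + phi)) =
          cos phi * \int[P]_x cos (f x) - sin phi * \int[P]_x sin (f x).
      move=> mf.
      have i1 : P.-integrable setT (EFin \o (fun x => cos (f x))).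
        apply: (@probability_bounded_integrable _ _ _ _ _ 1); first exact: measurable_cosf.
        by move=> x; exact: normr_cos_le1.
      have i2 : P.-integrable setT (EFin \o (fun x => sin (f x))).
        apply: (@probability_bounded_integrable _ _ _ _ _ 1); first exact: measurable_sinf.
        by move=> x; exact: normr_sin_le1.
      rewrite -!RintegralZl// -RintegralB//; first last.
      - exact: (integrableZl measurableT _ i2).
      - exact: (integrableZl measurableT _ i1).
      by apply: eq_Rintegral => x _; rewrite cosD; ring.
    by rewrite !split_int// (L_cos Lpq') (L_sin Lpq').
  have := good_le (c n) (Lpq n) IH; rewrite !bigcapS !indicI.
  congr good; apply/funext => x /=; rewrite [in RHS]indicE.
    by congr (_ * (nat_of_bool _)%:R); apply/idP/idP; rewrite inE.
  by congr (_ * (nat_of_bool _)%:R); apply/idP/idP; rewrite inE.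
(* Testing against the zero pair with phase 0 leaves the bare indicators, whose integrals are the
   two probabilities. *)
move=> [_ [_]] /(_ _ _ 0 (L_zero (Lpq 0))).
under eq_Rintegral do rewrite addr0 cos0 mulr1.
under [X in _ = X -> _]eq_Rintegral do rewrite addr0 cos0 mulr1.
have m1 := meas _ _ p n mp; have m2 := meas _ _ q n mq.
rewrite /Rintegral !integral_indic// !setIT.
move=> h; have {h} := congr1 (@EFin R) h; rewrite !fineK ?fin_num_measure//; exact.
Qed.

Lemma countable_cylinder_eq (p : nat -> T1 -> R) (q : nat -> T2 -> R) (c : nat -> R) :
  (forall i, L (p i) (q i)) ->
  P1 (\bigcap_i [set x | p i x <= c i]) = P2 (\bigcap_i [set x | q i x <= c i]).
Proof.
move=> Lpq.
have lim d (T : measurableType d) (P : probability T R) (f : nat -> T -> R) :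
    (forall i, measurable_fun setT (f i)) ->
    P (\bigcap_(i < n) [set x | f i x <= c i]) @[n --> \oo] --> P (\bigcap_i [set x | f i x <= c i]).
  move=> mf.
  have mE i : measurable [set x | f i x <= c i].
    have -> : [set x | f i x <= c i] = setT `&` f i @^-1` `]-oo, c i].
      by rewrite setTI; apply/seteqP; split => x /=; rewrite in_itv.
    exact: mf.
  have -> : \bigcap_i [set x | f i x <= c i] = \bigcap_n \bigcap_(i < n) [set x | f i x <= c i].
    apply/seteqP; split => x h; first by move=> n _ i _; exact: h.
    by move=> i _; apply: (h i.+1) => //=.
  apply: nonincreasing_cvg_mu => //.
  - by rewrite -ge0_fin_numE//; apply: fin_num_measure; apply: bigcap_measurableType.
  - by move=> n; apply: bigcap_measurableType.
  - by apply: bigcap_measurableType => n _; apply: bigcap_measurableType.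
  - move=> m n mn; apply/subsetPset => x h i /= im; apply: h => /=.
    exact: leq_trans im mn.
have mp i := proj1 (L_measurable (Lpq i)); have mq i := proj2 (L_measurable (Lpq i)).
have l1 := lim _ _ P1 p mp; have l2 := lim _ _ P2 q mq.
have e : (fun n => P1 (\bigcap_(i < n) [set x | p i x <= c i])) =
         (fun n => P2 (\bigcap_(i < n) [set x | q i x <= c i])).
  by apply/funext => n; exact: cylinder_eq.
rewrite e in l1.
exact: (cvg_unique _ l1 l2).
Qed.

End cosine_determines.

(** * Pairwise independent events *)

Lemma Rintegral_sum d (T : measurableType d) (R : realType)
    (mu : {measure set T -> \bar R}) n (f : nat -> T -> R) :
  (forall i, mu.-integrable setT (EFin \o f i)) ->
  mu.-integrable setT (EFin \o (fun x => \sum_(i < n) f i x)) /\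
  \int[mu]_x (\sum_(i < n) f i x) = \sum_(i < n) \int[mu]_x f i x.
Proof.
move=> fi; elim: n => [|n [IHi IH]].
  split.
    by under eq_fun do rewrite big_ord0; exact: integrable0.
  under eq_Rintegral do rewrite big_ord0.
  by rewrite big_ord0 /Rintegral integral0.
split.
  under eq_fun do rewrite big_ord_recr.
  exact: (integrableD measurableT IHi (fi n)).
under eq_Rintegral do rewrite big_ord_recr.
by rewrite RintegralD// IH big_ord_recr.
Qed.

Lemma Rintegral_indic d (T : measurableType d) (R : realType)
    (mu : {measure set T -> \bar R}) (A : set T) :
  measurable A -> \int[mu]_x \1_A x = fine (mu A).
Proof. by move=> mA; rewrite /Rintegral integral_indic// setIT. Qed.

Lemma Rintegral_prob_cst d (T : measurableType d) (R : realType)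
    (P : probability T R) (r : R) : \int[P]_x r = r.
Proof.
rewrite Rintegral_cst//; transitivity (r * fine (P setT)) => //.
by rewrite probability_setT mulr1.
Qed.

(* Chebyshev's inequality for the number of events that occur. *)
Lemma pairwise_independent_none d (T : measurableType d) (R : realType)
    (P : probability T R) (E : nat -> set T) (p : R) (K : nat) :
  (forall k, (k < K)%N -> measurable (E k)) ->
  (forall k, (k < K)%N -> P (E k) = p%:E) ->
  (forall k l, (k < K)%N -> (l < K)%N -> k != l -> P (E k `&` E l) = (p ^+ 2)%:E) ->
  0 < p -> (P (\bigcap_(k < K) ~` E k) * (K%:R * p)%:E <= 1)%E.
Proof.
(* Events of index at least K are replaced by the empty set, since [Rintegral_sum] asks for
   integrability at all indices. *)
wlog : E / forall k, measurable (E k).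
  move=> W mE PE PEE p0.
  pose E' k := if (k < K)%N then E k else set0.
  have E'E k : (k < K)%N -> E' k = E k by rewrite /E' => ->.
  have -> : \bigcap_(k < K) ~` E k = \bigcap_(k < K) ~` E' k.
    by apply: eq_bigcapr => k /= kK; rewrite E'E.
  apply: W => //.
  - by move=> k; rewrite /E'; case: ifPn => // kK; exact: mE.
  - by move=> k kK; rewrite E'E//; exact: mE.
  - by move=> k kK; rewrite E'E//; exact: PE.
  - by move=> k l kK lK; rewrite !E'E//; exact: PEE.
move=> mE _ PE PEE p0.
pose f k x : R := \1_(E k) x - p.
have p1 k : (k < K)%N -> p <= 1.
  by move=> kK; rewrite -lee_fin -(PE _ kK); exact: probability_le1.
have mf k : measurable_fun setT (f k).
  by apply: measurable_funB => //; exact: measurable_indic.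
have fb k x : `|f k x| <= 1 + `|p|.
  rewrite (le_trans (ler_normB _ _))// lerD2r indicE.
  by case: (_ \in _); rewrite ?normr1 ?normr0.
have iff k l : P.-integrable setT (EFin \o (fun x => f k x * f l x)).
  apply: (@probability_bounded_integrable _ _ _ _ _ ((1 + `|p|) * (1 + `|p|))).
    exact: measurable_funM.
  by move=> x; rewrite normrM ler_pM.
have cov k l : (k < K)%N -> (l < K)%N ->
    \int[P]_x (f k x * f l x) = if k == l then p - p ^+ 2 else 0.
  move=> kK lK.
  have mI := measurableI _ _ (mE k) (mE l).
  have ii A : measurable A -> P.-integrable setT (EFin \o (\1_A : T -> R)).
    move=> mA; apply: (@probability_bounded_integrable _ _ _ _ _ 1).
      exact: measurable_indic.
    by move=> x; rewrite indicE; case: (_ \in _); rewrite ?normr1 ?normr0.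
  have -> : \int[P]_x (f k x * f l x) = \int[P]_x (\1_(E k `&` E l) x +
      (- p) * (\1_(E k) x + \1_(E l) x) + p ^+ 2).
    by apply: eq_Rintegral => x _; rewrite /f indicI /=; ring.
  have i1 := ii _ mI.
  have i2 : P.-integrable setT (EFin \o (fun x => \1_(E k) x + \1_(E l) x : R)).
    exact: (integrableD measurableT (ii _ (mE k)) (ii _ (mE l))).
  have i3 : P.-integrable setT (EFin \o (fun x => - p * (\1_(E k) x + \1_(E l) x))).
    exact: (integrableZl measurableT _ i2).
  rewrite RintegralD//; first last.
  - exact: finite_measure_integrable_cst.
  - exact: (integrableD measurableT i1 i3).
  rewrite RintegralD// RintegralZl// RintegralD//; [|exact: ii..].
  have RI A : measurable A -> \int[P]_x \1_A x = fine (P A) by exact: Rintegral_indic.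
  rewrite !RI// Rintegral_prob_cst !PE//=; case: eqVneq => [->|kl].
    by rewrite setIid PE//=; ring.
  by rewrite PEE//=; ring.
pose S x := \sum_(k < K) f k x.
have SE x : S x ^+ 2 = \sum_(k < K) \sum_(l < K) f k x * f l x.
  by rewrite expr2 mulr_suml; apply: eq_bigr => k _; rewrite mulr_sumr.
have h2 k := Rintegral_sum K (iff k).
have [iS2 eS2] := Rintegral_sum K (fun k => proj1 (h2 k)).
have iS : P.-integrable setT (EFin \o (fun x => S x ^+ 2)).
  by under eq_fun do rewrite /= SE.
have ES : \int[P]_x (S x ^+ 2) = K%:R * (p - p ^+ 2).
  under eq_Rintegral do rewrite SE.
  rewrite eS2; transitivity (\sum_(k < K) (p - p ^+ 2)); last first.
    by rewrite sumr_const card_ord mulr_natl.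
  apply: eq_bigr => k _; rewrite (h2 k).2 (bigD1 k)//= cov// eqxx big1 ?addr0//.
  by move=> l lk; rewrite cov// eq_sym -val_eqE/= in lk *; rewrite (negbTE lk).
set F := \bigcap_(k < K) ~` E k.
have mF : measurable F by apply: bigcap_measurableType => k _; exact: measurableC.
have PFfin : P F \is a fin_num by exact: fin_num_measure.
have [->|K0] := posnP K; first by rewrite mul0r mule0.
have Kp0 : 0 < K%:R * p by rewrite mulr_gt0// ltr0n.
have i1F : P.-integrable setT (EFin \o (\1_F : T -> R)).
  apply: (@probability_bounded_integrable _ _ _ _ _ 1); first exact: measurable_indic.
  by move=> x; rewrite indicE; case: (_ \in _); rewrite ?normr1 ?normr0.
have : (K%:R * p) ^+ 2 * fine (P F) <= K%:R * (p - p ^+ 2).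
  rewrite -ES -[fine (P F)]Rintegral_indic// -RintegralZl//.
  apply: le_Rintegral => //; first exact: (integrableZl measurableT _ i1F).
  move=> x _; rewrite indicE; case: (boolP (x \in F)); last by rewrite mulr0 sqr_ge0.
  (* When no event occurs, every centred indicator is -p and the square of the sum is (K p)^2. *)
  rewrite inE mulr1 => Fx; rewrite le_eqVlt; apply/orP; left; apply/eqP.
  rewrite /S (eq_bigr (fun=> - p)); last first.
    move=> k _; have := Fx k (ltn_ord k); rewrite /f indicE => h.
    by rewrite memNset// sub0r.
  by rewrite sumr_const card_ord mulNrn sqrrN -[p *+ K]mulr_natl.
rewrite -[P F](fineK PFfin) -EFinM lee_fin.
have : K%:R * (p - p ^+ 2) <= K%:R * p.
  by rewrite ler_wpM2l// gerBl sqr_ge0.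
move=> a b; rewrite -(ler_pM2l Kp0) mulr1 mulrA mulrAC -expr2.
exact: le_trans b a.
Qed.

(** N lies in a set of measure at most 1 / (K p) for every K. The events may change completely with
    K. *)
Lemma unavoidable_negligible d (T : measurableType d) (R : realType)
    (P : probability T R) (N : set T) (p : R) : 0 < p ->
  (forall K, exists E : nat -> set T,
    [/\ forall k, (k < K)%N -> measurable (E k),
        forall k, (k < K)%N -> P (E k) = p%:E,
        forall k l, (k < K)%N -> (l < K)%N -> k != l ->
          P (E k `&` E l) = (p ^+ 2)%:E
      & N `<=` \bigcap_(k < K) ~` E k]) ->
  P.-negligible N.
Proof.
move=> p0 /choice[E hE].
pose F K := \bigcap_(k < K) ~` E K k.
have mF K : measurable (F K).
  have [mE _ _ _] := hE K.
  by apply: bigcap_measurableType => k kK; apply: measurableC; exact: mE.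
have mI : measurable (\bigcap_K F K) by apply: bigcapT_measurable.
exists (\bigcap_K F K); split => //; last first.
  by move=> x Nx K _; have [_ _ _ sub] := hE K; exact: sub.
have fin : P (\bigcap_K F K) \is a fin_num by exact: fin_num_measure.
apply/eqP; rewrite -(fineK fin) eqe; apply/negPn/negP => h.
have m0 : 0 < fine (P (\bigcap_K F K)) by rewrite lt_neqAle eq_sym h fine_ge0.
(* This K exceeds 1 / (m p), where m is the supposedly positive measure of the intersection. *)
pose K := (Num.truncn (fine (P (\bigcap_K F K)) * p)^-1).+1.
have [mE PE PEE _] := hE K.
have := pairwise_independent_none mE PE PEE p0; apply/negP; rewrite -ltNge.
have hm : ((fine (P (\bigcap_K F K)))%:E <= P (F K))%E.
  rewrite fineK//; apply: le_measure; rewrite ?inE//.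
  by move=> x; exact.
apply: (@lt_le_trans _ _ ((fine (P (\bigcap_K F K)))%:E * (K%:R * p)%:E)%E).
  rewrite -EFinM lte_fin mulrCA -ltr_pdivrMr ?mulr_gt0// div1r.
  exact: truncnS_gt.
by apply: lee_wpmul2r => //; rewrite lee_fin mulr_ge0// ltW.
Qed.

Lemma measurable_continuous_borel (R : realType) (B : normedModType R) (f : B -> R) :
  continuous f -> measurable_fun setT (f : borel B -> R).
Proof.
move=> cf; apply: (measurability _ (RGenOpens.measurableE R)).
move=> _ [_ [a [b ->] <-]]; rewrite setTI; apply: sub_sigma_algebra.
by apply: open_comp => [x _|]; [exact: cf|exact: interval_open].
Qed.

(** * Functionals of a Gaussian vector *)

Definition dual_comb (R : realType) (B : normedModType R) (c : R)
  (f g : {linear B -> R^o}) : {linear B -> R^o} := f \+ (c \*: g).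

Lemma dual_combE (R : realType) (B : normedModType R) (c : R)
  (f g : {linear B -> R^o}) x : dual_comb c f g x = f x + c * g x :> R.
Proof. by []. Qed.

Lemma dual_comb_dual (R : realType) (B : normedModType R) (c : R)
  (f g : {linear B -> R^o}) : dual f -> dual g -> dual (dual_comb c f g).
Proof.
move=> df dg x; apply: cvgD; first exact: df.
by apply: cvgZr; exact: dg.
Qed.

Arguments dual_comb_dual {R B} c {f g}.

Lemma dual_measurable (R : realType) (B : normedModType R)
  (t : {linear B -> R^o}) : dual t -> measurable_fun setT (t : borel B -> R).
Proof. exact: measurable_continuous_borel. Qed.

(** [centered_gaussian] as a property of the law alone; the two are convertible for
    [distribution P X]. *)
Definition gaussian (R : realType) (B : normedModType R)
    (mu : probability (borel B) R) : Prop :=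
  forall t, @dual R B t -> exists2 s : R, 0 <= s &
    forall A : set R, measurable A -> mu (t @^-1` A) = centered_normal s A.

Section gaussian_functionals.
Context (R : realType) (B : normedModType R) (mu : probability (borel B) R).
Hypothesis hG : gaussian mu.
Implicit Types (f g t : {linear B -> R^o}).

Lemma ge0_integral_law t (h : R -> \bar R) (m : probability (measurableTypeR R) R) : dual t ->
  (forall A : set R, measurable A -> mu (t @^-1` A) = m A) ->
  measurable_fun setT h -> (forall x, 0 <= h x)%E ->
  (\int[mu]_x h (t x) = \int[m]_x h x)%E.
Proof.
move=> dt tm mh h0; have mt := dual_measurable dt.
transitivity (\int[pushforward mu (t : borel B -> measurableTypeR R)]_y h y)%E.
  by rewrite ge0_integral_pushforward.
by apply: eq_measure_integral => A mA _; exact: tm.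
Qed.

Lemma integral_law t (h : R -> R) (m : probability (measurableTypeR R) R) : dual t ->
  (forall A : set R, measurable A -> mu (t @^-1` A) = m A) ->
  measurable_fun setT h -> \int[mu]_x h (t x) = \int[m]_x h x.
Proof.
move=> dt tm mh; congr fine; rewrite integralE [RHS]integralE.
have mEh : measurable_fun [set: R] (EFin \o h) by exact/measurable_EFinP.
rewrite -(ge0_integral_law dt tm (measurable_funepos mEh))//.
rewrite -(ge0_integral_law dt tm (measurable_funeneg mEh))//.
by congr (_ - _)%E; apply: eq_integral => x _; rewrite ?funeposE ?funenegE.
Qed.

Lemma integrable_law t (h : R -> R) (m : probability (measurableTypeR R) R) : dual t ->
  (forall A : set R, measurable A -> mu (t @^-1` A) = m A) ->
  measurable_fun setT h -> m.-integrable setT (EFin \o h) ->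
  mu.-integrable setT (EFin \o (fun x => h (t x))).
Proof.
move=> dt tm mh /integrableP[_ ih]; have mt := dual_measurable dt.
have mEh : measurable_fun [set: R] (EFin \o h) by exact/measurable_EFinP.
apply/integrableP; split; first by apply/measurable_EFinP; exact: measurableT_comp.
have mab : measurable_fun setT (fun x : R => `|(h x)%:E|%E).
  by apply/measurableT_comp => //; exact/measurable_EFinP.
by have /= -> := ge0_integral_law dt tm mab.
Qed.

(** The second moment identifies the anonymous parameter s of the hypothesis with [Hseminorm mu t].
    The case s = 0 is computed apart because the law is then a Dirac mass. *)
Lemma dual_law t : dual t -> mu.-integrable setT (EFin \o (fun x => t x * t x)) /\
  forall A : set R, measurable A -> mu (t @^-1` A) = centered_normal (Hseminorm mu t) A.
Proof.
move=> dt; have [s s0 tA] := hG dt.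
have mX : measurable_fun [set: R] (fun x : R => x * x) by exact: measurable_funM.
suff [i e] : mu.-integrable setT (EFin \o (fun x => t x * t x)) /\
    \int[mu]_x (t x * t x) = s ^+ 2.
  have sE : Hseminorm mu t = s by rewrite /Hseminorm /Hdot e sqrtr_sqr ger0_norm.
  by split=> [|A mA]; [exact: i|rewrite sE; exact: tA].
have [s_eq0|s_neq0] := eqVneq s 0.
  pose m : probability (measurableTypeR R) R := \d_(0 : measurableTypeR R).
  have tm (A : set R) : measurable A -> mu (t @^-1` A) = m A.
    by move=> mA; rewrite tA// /centered_normal s_eq0 eqxx.
  split.
    apply: (integrable_law dt tm mX); apply/integrableP; split; first exact/measurable_EFinP.
    have mab : measurable_fun setT (fun x : R => `|(x * x)%:E|%E).
      by apply/measurableT_comp => //; exact/measurable_EFinP.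
    have -> : (\int[m]_x `|(x * x)%:E| = 0)%E; last exact: ltry.
    transitivity (m setT * `|(0 * 0)%R%:E|)%E.
      exact: (@integral_dirac _ (measurableTypeR R) (0 : R) R setT measurableT _ mab).
    by rewrite mulr0 /= normr0 mule0.
  rewrite (integral_law dt tm mX) /Rintegral.
  have -> : (\int[m]_x (x * x)%:E = 0)%E; last by rewrite s_eq0 expr0n.
  transitivity (m setT * (0 * 0)%R%:E)%E.
    by apply: (@integral_dirac _ (measurableTypeR R) (0 : R) R setT measurableT); exact/measurable_EFinP.
  by rewrite mulr0 mule0.
pose m : probability (measurableTypeR R) R := normal_prob 0 s.
have tm (A : set R) : measurable A -> mu (t @^-1` A) = m A.
  by move=> mA; rewrite tA// /centered_normal (negbTE s_neq0).
have [i e] := normal_second_moment s_neq0.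
split.
  apply: (integrable_law dt tm mX).
  by move: i; congr integrable; apply/funext => x; rewrite /= expr2.
rewrite (integral_law dt tm mX) -e; apply: eq_Rintegral => x _; rewrite expr2//.
Qed.

End gaussian_functionals.

Definition dual_scale (R : realType) (B : normedModType R) (c : R)
  (f : {linear B -> R^o}) : {linear B -> R^o} := c \*: f.

Lemma dual_scaleE (R : realType) (B : normedModType R) (c : R)
  (f : {linear B -> R^o}) x : dual_scale c f x = c * f x :> R.
Proof. by []. Qed.

Lemma dual_scale_dual (R : realType) (B : normedModType R) (c : R)
  (f : {linear B -> R^o}) : dual f -> dual (dual_scale c f).
Proof. by move=> df x; apply: cvgZr; exact: df. Qed.

Arguments dual_scale_dual {R B} c {f}.

(** * The covariance form on functionals *)

Section covariance.
Context (R : realType) (B : normedModType R) (mu : probability (borel B) R).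
Hypothesis hG : gaussian mu.
Implicit Types (f g h t : {linear B -> R^o}) (c : R).
Local Notation sd := (Hseminorm mu).
Local Notation dot := (Hdot mu).

Lemma Hdot_integrable f g : dual f -> dual g ->
  mu.-integrable setT (EFin \o (fun x => f x * g x)).
Proof.
move=> df dg; have [fi _] := dual_law hG df; have [gi _] := dual_law hG dg.
have mf := dual_measurable df; have mg := dual_measurable dg.
apply: (@le_integrable _ _ _ mu setT measurableT _
  (fun x => ((f x : R) * f x)%:E + ((g x : R) * g x)%:E)%E).
- by apply/measurable_EFinP; exact: measurable_funM.
- move=> x _; rewrite -EFinD lee_fin [leRHS]ger0_norm; last first.
    by rewrite addr_ge0// -expr2 sqr_ge0.
  by rewrite ler_norml; apply/andP; split; nra.
- exact: (integrableD measurableT fi gi).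
Qed.

Lemma HdotC (f g : B -> R) : dot f g = dot g f.
Proof. by apply: eq_Rintegral => x _; rewrite mulrC. Qed.

Lemma Hdot_combl c f g h : dual f -> dual g -> dual h ->
  dot (dual_comb c f g) h = dot f h + c * dot g h.
Proof.
move=> df dg dh.
have i1 := Hdot_integrable df dh; have i2 := Hdot_integrable dg dh.
rewrite /Hdot -RintegralZl// -RintegralD//; last exact: (integrableZl measurableT c i2).
by apply: eq_Rintegral => x _; rewrite dual_combE mulrDl mulrA.
Qed.

Lemma Hdot_scalel c f h : dual f -> dual h -> dot (dual_scale c f) h = c * dot f h.
Proof.
move=> df dh; rewrite /Hdot -RintegralZl//; last exact: Hdot_integrable.
by apply: eq_Rintegral => x _; rewrite dual_scaleE mulrA.
Qed.

Lemma Hdot_ge0 (f : B -> R) : 0 <= dot f f.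
Proof. by apply: Rintegral_ge0 => x _; rewrite -expr2 sqr_ge0. Qed.

Lemma Hseminorm_ge0 (f : B -> R) : 0 <= sd f.
Proof. exact: sqrtr_ge0. Qed.

Lemma Hseminorm_sqr (f : B -> R) : sd f ^+ 2 = dot f f.
Proof. by rewrite sqr_sqrtr// Hdot_ge0. Qed.

Lemma Hseminorm_comb_sqr c f g : dual f -> dual g ->
  sd (dual_comb c f g) ^+ 2 = sd f ^+ 2 + 2 * c * dot f g + c ^+ 2 * sd g ^+ 2.
Proof.
move=> df dg; have dc := dual_comb_dual c df dg.
rewrite !Hseminorm_sqr Hdot_combl// [dot f _]HdotC [dot g _]HdotC !Hdot_combl//.
by rewrite (HdotC g f); ring.
Qed.

Lemma Hseminorm_scale c f : dual f -> sd (dual_scale c f) = `|c| * sd f.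
Proof.
move=> df; have dc := dual_scale_dual c df.
apply/eqP; rewrite -(@eqrXn2 _ 2)// ?mulr_ge0 ?Hseminorm_ge0//; apply/eqP.
rewrite exprMn !Hseminorm_sqr Hdot_scalel// [dot f _]HdotC Hdot_scalel//.
by rewrite real_normK ?num_real// expr2 mulrA.
Qed.

Lemma Hdot_cauchy_schwarz f g : dual f -> dual g -> `|dot f g| <= sd f * sd g.
Proof.
move=> df dg.
have q c : 0 <= sd f ^+ 2 + 2 * c * dot f g + c ^+ 2 * sd g ^+ 2.
  by rewrite -Hseminorm_comb_sqr// sqr_ge0.
have [g0|g0] := eqVneq (sd g) 0.
  rewrite g0 mulr0; have [->|d0] := eqVneq (dot f g) 0; first by rewrite normr0.
  (* For sd g = 0 the quadratic is affine in c; this c would give it the value -1. *)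
  have := q (- (sd f ^+ 2 + 1) / (2 * dot f g)).
  rewrite g0 expr0n mulr0 addr0.
  have -> : 2 * (- (sd f ^+ 2 + 1) / (2 * dot f g)) * dot f g = - (sd f ^+ 2 + 1).
    by field.
  by rewrite opprD addrA subrr add0r oppr_ge0 ler10.
have gp : 0 < sd g by rewrite lt_neqAle eq_sym g0 Hseminorm_ge0.
rewrite -(@ler_pXn2r _ 2)// ?nnegrE ?mulr_ge0 ?Hseminorm_ge0//.
rewrite real_normK ?num_real//.
(* The minimizer of the quadratic. *)
have := q (- dot f g / sd g ^+ 2).
have -> : sd f ^+ 2 + 2 * (- dot f g / sd g ^+ 2) * dot f g +
   (- dot f g / sd g ^+ 2) ^+ 2 * sd g ^+ 2 = sd f ^+ 2 - dot f g ^+ 2 / sd g ^+ 2.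
  by field.
by rewrite subr_ge0 ler_pdivrMr ?exprn_gt0// exprMn.
Qed.

Lemma dual_law_degenerate t (A : set R) : dual t -> sd t = 0 -> measurable A ->
  mu (t @^-1` A) = \d_(0 : R) A.
Proof. by move=> dt t0 mA; rewrite (dual_law hG dt).2// /centered_normal t0 eqxx. Qed.

Lemma dual_law_standard t (A : set R) : dual t -> sd t = 1 -> measurable A ->
  mu (t @^-1` A) = normal_prob 0 1 A.
Proof.
move=> dt t1 mA.
by rewrite (dual_law hG dt).2// /centered_normal t1 (negbTE (oner_neq0 _)).
Qed.

Lemma dual_ae0 t : dual t -> sd t = 0 -> {ae mu, forall x, t x = 0}.
Proof.
move=> dt t0; exists (t @^-1` [set~ 0]); split => //.
- rewrite -[X in measurable X]setTI; apply: dual_measurable => //.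
  by apply: measurableC; exact: measurable_set1.
- rewrite dual_law_degenerate//; last by apply: measurableC; exact: measurable_set1.
  by rewrite diracE memNset//; apply.
Qed.

Lemma dual_standardize t : dual t -> 0 < sd t ->
  let u := dual_scale (sd t)^-1 t in [/\ dual u, sd u = 1 & forall x, t x = sd t * u x].
Proof.
move=> dt t0 u; split; first exact: dual_scale_dual.
  by rewrite Hseminorm_scale// gtr0_norm ?invr_gt0// mulVf// gt_eqF.
by move=> x; rewrite /u dual_scaleE mulrA divff ?mul1r// gt_eqF.
Qed.

Lemma dual_tail t c : dual t -> 0 < sd t ->
  mu [set x | c <= t x] = normal_prob 0 1 `[c / sd t, +oo[%classic.
Proof.
move=> dt t0; have [du u1 tu] := dual_standardize dt t0.
rewrite -(dual_law_standard du u1)//; congr (mu _).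
have E x : (c / sd t <= dual_scale (sd t)^-1 t x) = (c <= t x).
  by rewrite [in RHS]tu ler_pdivrMr// mulrC.
apply/seteqP; split => x /= ctx; first by rewrite in_itv /= andbT E.
by rewrite -E; move: ctx; rewrite in_itv /= andbT.
Qed.

Lemma dual_cos t : dual t -> \int[mu]_x cos (t x) = expR (- sd t ^+ 2 / 2).
Proof.
move=> dt; have := Hseminorm_ge0 t; rewrite le_eqVlt => /predU1P[t0|t0].
  rewrite -t0 expr0n oppr0 mul0r expR0 -[RHS](Rintegral_prob_cst mu 1).
  congr fine; apply: ae_eq_integral => //.
  - by apply/measurable_EFinP; apply: measurable_cosf; exact: dual_measurable.
  - have [N [mN N0 sN]] := dual_ae0 dt (esym t0); exists N; split => //.
    by apply: subset_trans sN => x /= nx tx; apply: nx => _; rewrite tx cos0.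
have [du u1 tu] := dual_standardize dt t0.
have tm (A : set R) : measurable A -> mu (dual_scale (sd t)^-1 t @^-1` A) =
    (normal_prob 0 1 : probability (measurableTypeR R) R) A.
  by move=> mA; rewrite dual_law_standard.
rewrite -normal_cos -(integral_law du tm); last first.
  by apply: measurable_cosf; exact: measurable_funM.
by apply: eq_Rintegral => x _; rewrite -tu.
Qed.

(** The law of a functional depends on its seminorm only, so t and -t have the same law and the
    integral equals its negative. *)
Lemma dual_sin t : dual t -> \int[mu]_x sin (t x) = 0.
Proof.
move=> dt; have := Hseminorm_ge0 t; rewrite le_eqVlt => /predU1P[t0|t0].
  rewrite -[RHS](Rintegral_prob_cst mu 0).
  congr fine; apply: ae_eq_integral => //.
  - by apply/measurable_EFinP; apply: measurable_sinf; exact: dual_measurable.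
  - have [N [mN N0 sN]] := dual_ae0 dt (esym t0); exists N; split => //.
    by apply: subset_trans sN => x /= nx tx; apply: nx => _; rewrite tx sin0.
have E u : dual u -> sd u = sd t ->
    \int[mu]_x sin (u x) = \int[normal_prob 0 1]_x sin (sd t * x).
  move=> du ut; have u0 : 0 < sd u by rewrite ut.
  have [dv v1 uv] := dual_standardize du u0.
  have vm (A : set R) : measurable A -> mu (dual_scale (sd u)^-1 u @^-1` A) =
      (normal_prob 0 1 : probability (measurableTypeR R) R) A.
    by move=> mA; rewrite dual_law_standard.
  rewrite -(integral_law dv vm); last first.
    by apply: measurable_sinf; exact: measurable_funM.
  by apply: eq_Rintegral => x _; rewrite -ut -uv.
have dn := dual_scale_dual (-1) dt.
have := E _ dn; rewrite Hseminorm_scale// normrN1 mul1r => /(_ erefl).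
rewrite -(E t dt erefl).
have -> : \int[mu]_x sin (dual_scale (-1) t x) = - \int[mu]_x sin (t x).
  rewrite -[RHS]mulN1r -RintegralZl//.
    by apply: eq_Rintegral => x _; rewrite dual_scaleE !mulN1r sinN.
  apply: (@probability_bounded_integrable _ _ _ _ _ 1).
    by apply: measurable_sinf; exact: dual_measurable.
  by move=> x; exact: normr_sin_le1.
lra.
Qed.

End covariance.

(** * Tails of the standard normal law *)

Section normal_tails.
Context (R : realType).
Local Notation N := (@normal_prob R 0 1).

Lemma normal_itv_gt0 (a b : R) : a < b -> (0 < N `[a, b]%classic)%E.
Proof.
(* A lower bound of the density on [a, b], where x^2 <= a^2 + b^2. *)
move=> ab; pose m := normal_peak 1 * expR (- (a ^+ 2 + b ^+ 2)).
have o0 : (1 : R) != 0 by exact: oner_neq0.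
have m0 : 0 < m by rewrite mulr_gt0 ?expR_gt0// normal_peak_gt0.
have : (\int[lebesgue_measure]_(x in `[a, b]) m%:E <= N `[a, b]%classic)%E.
  apply: ge0_le_integral => //=.
  - by move=> x _; rewrite lee_fin ltW.
  - by apply/measurable_EFinP; apply: measurable_funTS; exact: measurable_normal_pdf.
  - move=> x; rewrite in_itv /= => /andP[ax xb].
    rewrite lee_fin normal_pdfE// /normal_fun /m ler_wpM2l ?normal_peak_ge0//.
    rewrite ler_expR subr0 expr1n mulNr lerN2.
    have : x ^+ 2 <= a ^+ 2 + b ^+ 2 by have [x0|x0] := leP 0 x; nra.
    by have := sqr_ge0 a; have := sqr_ge0 b; lra.
apply: lt_le_trans; rewrite integral_cst//= lebesgue_measure_itv/= lte_fin ab.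
by rewrite -EFinB -EFinM lte_fin mulr_gt0// subr_gt0.
Qed.

Lemma normal_lower_gt0 (c : R) : (0 < N `]-oo, c]%classic)%E.
Proof.
apply: (lt_le_trans (@normal_itv_gt0 (c - 1) c _)); first by rewrite gtrBl.
apply: le_measure; rewrite ?inE//.
by move=> x /=; rewrite !in_itv /= => /andP[].
Qed.

Lemma normal_tail_gt0 (c : R) : (0 < N `[c, +oo[%classic)%E.
Proof.
apply: (lt_le_trans (@normal_itv_gt0 c (c + 1) _)); first by rewrite ltrDl.
apply: le_measure; rewrite ?inE//.
by move=> x /=; rewrite !in_itv /= => /andP[->].
Qed.

Lemma normal_tailE (c : R) : N `[c, +oo[%classic = (1 - Phi c)%:E.
Proof.
have Nc : N [set c] = 0%E.
  have /null_content_dominatesP := @normal_prob_dominates R 0 1.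
  by apply => //; exact: lebesgue_measure_set1.
have -> : N `[c, +oo[%classic = N `]c, +oo[%classic.
  have -> : `[c, +oo[%classic = [set c] `|` `]c, +oo[%classic by rewrite setU1itv.
  rewrite measureU//; first by rewrite [X in (X + _)%E]Nc add0e.
  by apply/seteqP; split => x //= [->]; rewrite in_itv /= ltxx.
have -> : `]c, +oo[%classic = ~` `]-oo, c]%classic.
  by rewrite setCitvl.
rewrite (@probability_setC _ _ _ (normal_prob 0 1))//.
by rewrite EFinB fineK// fin_num_measure.
Qed.

Lemma normal_tail_le (c c' : R) : c <= c' -> (N `[c', +oo[%classic <= N `[c, +oo[%classic)%E.
Proof.
move=> cc; apply: le_measure; rewrite ?inE//.
by move=> x /=; rewrite !in_itv /= !andbT; exact: le_trans.
Qed.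

(** Closed upper tails are continuous from the left, being decreasing intersections. This carries a
    bound on the depth along a sequence of functionals to its limit. *)
Lemma normal_tail_lim (u : nat -> R) (c : R) (y : \bar R) : u n @[n --> \oo] --> c ->
  (forall n, y <= N `[u n, +oo[%classic)%E -> (y <= N `[c, +oo[%classic)%E.
Proof.
move=> uc yu.
have y' k : (y <= N `[(c - k.+1%:R^-1)%R, +oo[%classic)%E.
  have : \forall n \near \oo, c - k.+1%:R^-1 <= u n.
    by apply: (cvgr_ge c) => //; rewrite gtrBl.
  move=> [n _ /(_ n (leqnn _)) h]; apply: (le_trans (yu n)).
  exact: normal_tail_le.
have cv : N `[(c - k.+1%:R^-1)%R, +oo[%classic @[k --> \oo] --> N `[c, +oo[%classic.
  have -> : `[c, +oo[%classic = \bigcap_k `[c - k.+1%:R^-1, +oo[%classic.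
    apply/seteqP; split => x /=.
      by rewrite in_itv /= andbT => cx k _; rewrite /= in_itv /= andbT lerBlDr (le_trans cx)// lerDl.
    move=> h; rewrite in_itv /= andbT.
    apply: (@cvgr_to_le _ \oo _ _ (fun k => c - k.+1%:R^-1)).
      by rewrite -[X in _ --> X]subr0; apply: cvgB; [exact: cvg_cst|exact: cvg_natr_inv].
    by apply: nearW => k; have := h k I; rewrite /= in_itv /= andbT.
  apply: nonincreasing_cvg_mu => //.
  - by rewrite -ge0_fin_numE// fin_num_measure.
  - by apply: bigcap_measurableType => k _.
  - move=> m n mn; apply/subsetPset => x /=; rewrite !in_itv /= !andbT; apply: le_trans.
    by rewrite lerD2l lerN2 lef_pV2 ?posrE// ler_nat.
by apply: (cvge_to_ge cv); exact: nearW.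
Qed.

End normal_tails.

(** * Fernique's theorem *)

Definition prod_prob d1 d2 (T1 : measurableType d1) (T2 : measurableType d2) (R : realType)
    (P1 : probability T1 R) (P2 : probability T2 R) : probability (T1 * T2)%type R :=
  (P1 \x P2)%E.

Lemma Rintegral_prodM d1 d2 (T1 : measurableType d1) (T2 : measurableType d2) (R : realType)
    (P1 : probability T1 R) (P2 : probability T2 R) (f : T1 -> R) (g : T2 -> R) M :
  measurable_fun setT f -> measurable_fun setT g ->
  (forall x, `|f x| <= M) -> (forall x, `|g x| <= M) ->
  \int[prod_prob P1 P2]_z (f z.1 * g z.2) = \int[P1]_x f x * \int[P2]_y g y.
Proof.
move=> mf mg fM gM.
have i1 : P1.-integrable setT (EFin \o f) by exact: probability_bounded_integrable fM.
have i2 : P2.-integrable setT (EFin \o g) by exact: probability_bounded_integrable gM.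
have i12 : (prod_prob P1 P2).-integrable setT (EFin \o (fun z => f z.1 * g z.2)).
  apply: (@probability_bounded_integrable _ _ _ _ _ (M * M)).
    by apply: measurable_funM; exact: measurableT_comp.
  by move=> z; rewrite normrM ler_pM.
rewrite /Rintegral.
have -> : (\int[prod_prob P1 P2]_z (f z.1 * g z.2)%:E =
    \int[P1]_x \int[P2]_y (f x * g y)%:E)%E.
  by have := integral12_prod_meas1 i12 => <-.
have -> : (\int[P1]_x \int[P2]_y (f x * g y)%:E =
    \int[P1]_x ((f x)%:E * (\int[P2]_y g y)%:E))%E.
  apply: eq_integral => x _; under eq_integral do rewrite EFinM.
  by rewrite integralZl// /Rintegral fineK// integrable_fin_num.
rewrite integralZr// fineM//; last exact: integrable_fin_num.
Qed.

Section product_law.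
Context (R : realType) (B : normedModType R) (mu : probability (borel B) R).
Hypothesis hG : gaussian mu.
Local Notation sd := (Hseminorm mu).
Local Notation dot := (Hdot mu).

Lemma prod_dual_cos_sin (t t' : {linear B -> R^o}) : dual t -> dual t' ->
  \int[prod_prob mu mu]_z cos (t z.1 + t' z.2) = expR (- (sd t ^+ 2 + sd t' ^+ 2) / 2) /\
  \int[prod_prob mu mu]_z sin (t z.1 + t' z.2) = 0.
Proof.
move=> dt dt'.
have mc u : dual u -> measurable_fun setT (fun x : borel B => cos (u x) : R).
  by move=> du; apply: measurable_cosf; exact: dual_measurable.
have ms u : dual u -> measurable_fun setT (fun x : borel B => sin (u x) : R).
  by move=> du; apply: measurable_sinf; exact: dual_measurable.
have ii (f g : borel B -> R) : measurable_fun setT f -> measurable_fun setT g ->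
    (forall x, `|f x| <= 1) -> (forall x, `|g x| <= 1) ->
    (prod_prob mu mu).-integrable setT (EFin \o (fun z => f z.1 * g z.2)).
  move=> mf mg f1 g1; apply: (@probability_bounded_integrable _ _ _ _ _ 1).
    by apply: measurable_funM; exact: measurableT_comp.
  by move=> z; rewrite normrM mulr_ile1.
have c1 u (x : borel B) := normr_cos_le1 (u x : R).
have s1 u (x : borel B) := normr_sin_le1 (u x : R).
split.
  under eq_Rintegral do rewrite cosD.
  rewrite RintegralB//; [|exact: (ii _ _ (mc t dt) (mc t' dt') (c1 t) (c1 t'))
     |exact: (ii _ _ (ms t dt) (ms t' dt') (s1 t) (s1 t'))].
  rewrite (Rintegral_prodM mu mu (mc t dt) (mc t' dt') (c1 t) (c1 t')).
  rewrite (Rintegral_prodM mu mu (ms t dt) (ms t' dt') (s1 t) (s1 t')).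
  by rewrite !dual_cos// !dual_sin// mulr0 subr0 -expRD; congr expR; field.
under eq_Rintegral do rewrite sinD.
rewrite RintegralD//; [|exact: (ii _ _ (ms t dt) (mc t' dt') (s1 t) (c1 t'))
   |exact: (ii _ _ (mc t dt) (ms t' dt') (c1 t) (s1 t'))].
rewrite (Rintegral_prodM mu mu (ms t dt) (mc t' dt') (s1 t) (c1 t')).
rewrite (Rintegral_prodM mu mu (mc t dt) (ms t' dt') (c1 t) (s1 t')).
by rewrite !dual_sin// mul0r mulr0 addr0.
Qed.

End product_law.

Section fernique.
Context (R : realType) (B : normedModType R) (mu : probability (borel B) R).
Hypothesis hG : gaussian mu.
Local Notation sd := (Hseminorm mu).
Local Notation dot := (Hdot mu).
Local Notation nu := (prod_prob mu mu).

Let measurable_sum (u v : {linear B -> R^o}) : dual u -> dual v ->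
  measurable_fun setT (fun z : borel B * borel B => u z.1 + v z.2 : R).
Proof.
move=> du dv; apply: measurable_funD.
  exact: (measurableT_comp (dual_measurable du) measurable_fst).
exact: (measurableT_comp (dual_measurable dv) measurable_snd).
Qed.

(** Uncorrelated functionals of a Gaussian law are independent: for orthonormal e and f, a e + b f
    under mu has the characteristic function of a e(z.1) + b f(z.2) under mu x mu, as both variances
    are a^2 + b^2. *)
Lemma orthonormal_pair_law (e f : {linear B -> R^o}) (c : R) : dual e -> dual f ->
  sd e = 1 -> sd f = 1 -> dot e f = 0 ->
  mu ([set x | e x <= c] `&` [set x | f x <= c]) = ((Phi c) ^+ 2)%:E.
Proof.
move=> de df e1 f1 ef0.
pose L (p : borel B -> R) (q : borel B * borel B -> R) := exists a b : R,
  p = (fun x => a * e x + b * f x) /\ q = (fun z => a * e z.1 + b * f z.2).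
pose ev a b := dual_comb b (dual_scale a e) f.
have dev a b : dual (ev a b) by exact/dual_comb_dual/df/dual_scale_dual/de.
have main := @cylinder_eq R _ _ (borel B) (borel B * borel B)%type mu nu L.
have L_meas p q : L p q -> measurable_fun setT p /\ measurable_fun setT q.
  move=> [a [b [-> ->]]]; split; first exact: (dual_measurable (dev a b)).
  exact: (measurable_sum (dual_scale_dual a de) (dual_scale_dual b df)).
have L_lin p q p' q' c' : L p q -> L p' q' ->
    L (fun x => p x + c' * p' x) (fun x => q x + c' * q' x).
  move=> [a [b [-> ->]]] [a' [b' [-> ->]]]; exists (a + c' * a'), (b + c' * b').
  by split; apply/funext => x; ring.
have sdev a b : sd (ev a b) ^+ 2 = sd (dual_scale a e) ^+ 2 + sd (dual_scale b f) ^+ 2.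
  have da := dual_scale_dual a de.
  rewrite Hseminorm_comb_sqr// Hdot_scalel// ef0 !mulr0 addr0 !Hseminorm_scale//.
  by congr (_ + _); rewrite exprMn real_normK ?num_real.
have L_cos p q : L p q -> \int[mu]_x cos (p x) = \int[nu]_x cos (q x).
  move=> [a [b [-> ->]]]; have := dual_cos hG (dev a b).
  have [+ _] := prod_dual_cos_sin hG (dual_scale_dual a de) (dual_scale_dual b df).
  by rewrite sdev => -> ->.
have L_sin p q : L p q -> \int[mu]_x sin (p x) = \int[nu]_x sin (q x).
  move=> [a [b [-> ->]]]; have := dual_sin hG (dev a b).
  by have [_ +] := prod_dual_cos_sin hG (dual_scale_dual a de) (dual_scale_dual b df) => -> ->.
pose p i (x : borel B) : R := if i == 0%N then e x else f x.
pose q i (z : borel B * borel B) : R := if i == 0%N then e z.1 else f z.2.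
have Lpq i : L (p i) (q i).
  rewrite /p /q; case: (i == 0%N).
    by exists 1, 0; split; apply/funext => x; rewrite mul1r mul0r addr0.
  by exists 0, 1; split; apply/funext => x; rewrite mul1r mul0r add0r.
have := main L_meas L_lin L_cos L_sin p q (fun=> c) 2 Lpq.
rewrite !bigcap_mkord !big_ord_recr !big_ord0 /= !setTI => ->.
have -> : [set x | q 0 x <= c] `&` [set x | q 1 x <= c] =
   [set x | e x <= c] `*` [set x | f x <= c] by [].
have mset t : dual t -> measurable ([set x | t x <= c] : set (borel B)) /\
   (sd t = 1 -> mu [set x | t x <= c] = (Phi c)%:E).
  move=> dt; have E : [set x | t x <= c] = t @^-1` `]-oo, c].
    by apply/seteqP; split => x /=; rewrite in_itv.
  split; first by rewrite E -[X in measurable X]setTI; apply: dual_measurable.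
  move=> t1; rewrite E dual_law_standard// /Phi fineK//.
  exact: (fin_num_measure (normal_prob 0 1)).
transitivity (mu [set x | (e x <= c)%R] * mu [set x | (f x <= c)%R])%E.
  by apply: product_measure1E; [exact: (mset _ de).1|exact: (mset _ df).1].
by rewrite (mset _ de).2// (mset _ df).2// -EFinM expr2.
Qed.

Let Hseminorm_scale_sqr r (f : {linear B -> R^o}) : dual f ->
  sd (dual_scale r f) ^+ 2 = r ^+ 2 * sd f ^+ 2.
Proof.
move=> df; rewrite (Hseminorm_scale hG r df) exprMn; congr (_ * _).
by rewrite real_normK ?num_real.
Qed.

(** The parallelogram law with the squared seminorms abstracted to scalars; in its use r is the
    square of 1 / sqrt 2. *)
Let half_parallelogram (r x y x' y' a b m : R) : r = 2^-1 ->
  x = r * x' -> y = r * y' -> x' = a + 2 * 1 * m + 1 ^+ 2 * b ->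
  y' = a + 2 * -1 * m + (-1) ^+ 2 * b -> x + y = a + b.
Proof. by move=> -> -> -> -> ->; field. Qed.

(* Countably many half-space constraints suffice, since the norm is a countable
   supremum of functionals. *)
Lemma rotation_invariance (u v : nat -> {linear B -> R^o}) (c : nat -> R) :
  (forall i, dual (u i)) -> (forall i, dual (v i)) ->
  nu (\bigcap_i [set z | u i z.1 + v i z.2 <= c i]) =
  nu (\bigcap_i [set z | u i (z.1 + z.2) + v i (z.1 - z.2) <= Num.sqrt 2 * c i]).
Proof.
move=> du dv; pose r : R := (Num.sqrt 2)^-1.
have s20 : 0 < Num.sqrt 2 :> R by rewrite sqrtr_gt0.
have r2 : r ^+ 2 = 2^-1 by rewrite exprVn sqr_sqrtr.
(* L pairs a functional on the product with its composition with (x, y) |-> ((x + y) / sqrt 2, (x -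
   y) / sqrt 2). *)
pose L (p q : borel B * borel B -> R) := exists u v : {linear B -> R^o},
  [/\ dual u, dual v, p = (fun z => u z.1 + v z.2) &
      q = (fun z => r * (u (z.1 + z.2) + v (z.1 - z.2)))].
pose lt (u v : {linear B -> R^o}) := dual_scale r (dual_comb 1 u v).
pose rt (u v : {linear B -> R^o}) := dual_scale r (dual_comb (-1) u v).
have dlt u' v' : dual u' -> dual v' -> dual (lt u' v').
  by move=> d1 d2; exact/dual_scale_dual/dual_comb_dual.
have drt u' v' : dual u' -> dual v' -> dual (rt u' v').
  by move=> d1 d2; exact/dual_scale_dual/dual_comb_dual.
(* The composed functional is again a sum of one functional per coordinate, which gives both its
   measurability and its characteristic function. *)
have qE (u' v' : {linear B -> R^o}) : (fun z => r * (u' (z.1 + z.2) + v' (z.1 - z.2))) =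
    (fun z : borel B * borel B => lt u' v' z.1 + rt u' v' z.2 : R).
  apply/funext => z; rewrite /lt /rt !dual_scaleE !dual_combE.
  have -> : u' (z.1 + z.2) = u' z.1 + u' z.2 :> R by exact: linearD.
  have -> : v' (z.1 - z.2) = v' z.1 - v' z.2 :> R by exact: linearB.
  by ring.
have main := @countable_cylinder_eq R _ _ (borel B * borel B)%type (borel B * borel B)%type nu nu L.
have L_meas p q : L p q -> measurable_fun setT p /\ measurable_fun setT q.
  move=> [u' [v' [du' dv' -> ->]]]; split; first exact: measurable_sum.
  by rewrite qE; apply: measurable_sum; [exact: dlt|exact: drt].
have L_lin p q p' q' c' : L p q -> L p' q' ->
    L (fun x => p x + c' * p' x) (fun x => q x + c' * q' x).
  move=> [u1 [v1 [du1 dv1 -> ->]]] [u2 [v2 [du2 dv2 -> ->]]].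
  exists (dual_comb c' u1 u2), (dual_comb c' v1 v2); split; try exact: dual_comb_dual.
    by apply/funext => x; rewrite !dual_combE; ring.
  by apply/funext => x; rewrite !dual_combE; ring.
have sdE u' v' : dual u' -> dual v' ->
    sd (lt u' v') ^+ 2 + sd (rt u' v') ^+ 2 = sd u' ^+ 2 + sd v' ^+ 2.
  move=> du' dv'; have d1 := dual_comb_dual 1 du' dv'.
  have d2 := dual_comb_dual (-1) du' dv'.
  apply: half_parallelogram r2 _ _ _ _; [exact: (Hseminorm_scale_sqr r d1)|
    exact: (Hseminorm_scale_sqr r d2)|exact: (Hseminorm_comb_sqr hG 1 du' dv')|
    exact: (Hseminorm_comb_sqr hG (-1) du' dv')].
have L_cos p q : L p q -> \int[nu]_x cos (p x) = \int[nu]_x cos (q x).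
  move=> [u' [v' [du' dv' -> qe]]]; rewrite qE in qe; rewrite qe.
  rewrite (prod_dual_cos_sin hG du' dv').1.
  by rewrite (prod_dual_cos_sin hG (dlt _ _ du' dv') (drt _ _ du' dv')).1 sdE.
have L_sin p q : L p q -> \int[nu]_x sin (p x) = \int[nu]_x sin (q x).
  move=> [u' [v' [du' dv' -> qe]]]; rewrite qE in qe; rewrite qe.
  rewrite (prod_dual_cos_sin hG du' dv').2.
  by rewrite (prod_dual_cos_sin hG (dlt _ _ du' dv') (drt _ _ du' dv')).2.
have := main L_meas L_lin L_cos L_sin (fun i z => u i z.1 + v i z.2)
  (fun i z => r * (u i (z.1 + z.2) + v i (z.1 - z.2))) c.
move=> -> ; last by move=> i; exists (u i), (v i).
congr (nu _); apply: eq_bigcapr => i _; apply/funext => z; apply/propext => /=.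
by rewrite /r ler_pdivrMl.
Qed.

End fernique.

Section fernique_integrability.
Context (R : realType) (B : normedModType R) (mu : probability (borel B) R).
Hypothesis hG : gaussian mu.
Hypothesis hB : @separable B.
Local Notation nu := (prod_prob mu mu).

(** Turns a norm bound into countably many half-space constraints, the form in which
    [rotation_invariance] is stated. *)
Lemma norm_ballE (tau : nat -> {linear B -> R^o}) :
  (forall k x, `|tau k x| <= `|x|) ->
  (forall x e, 0 < e -> exists k, `|x| - e < tau k x) ->
  forall x c, (forall k, tau k x <= c) <-> `|x| <= c.
Proof.
move=> tle tex x c; split => [h|xc k]; last first.
  by rewrite (le_trans _ xc)// (le_trans _ (tle k x))// ler_norm.
apply/ler_addgt0Pr => e e0; have [k kx] := tex x e e0.
by rewrite -lerBlDr (le_trans (ltW kx)).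
Qed.

Lemma measurable_norm_borel : measurable_fun setT (fun x : borel B => `|x : B| : R).
Proof. by apply: measurable_continuous_borel; exact: norm_continuous. Qed.

Let far (c : R) : set (borel B) := [set x | c < `|x : B|].

Let measurable_far c : measurable (far c).
Proof.
have -> : far c = (fun x : borel B => `|x : B| : R) @^-1` `]c, +oo[.
  by apply/seteqP; split => x /=; rewrite in_itv /= andbT.
by rewrite -[X in measurable X]setTI; exact: measurable_norm_borel.
Qed.

Let measurable_near c : measurable (~` far c).
Proof. exact: measurableC. Qed.

(* If |x| <= s and |y| > t then both |x + y| and |x - y| exceed t - s. *)
Lemma fernique_step (s t : R) :
  (mu (~` far s) * mu (far t) <= mu (far ((t - s) / Num.sqrt 2)) ^+ 2)%E.
Proof.
have [tau [dtau tle tex]] := norming_sequence hB.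
have bE := norm_ballE tle tex.
(* The zero functional leaves one coordinate unconstrained. *)
have [z0 dz0 z0E] : exists2 z0 : {linear B -> R^o}, dual z0 & forall x, z0 x = 0 :> R.
  exists (dual_scale 0 (tau 0%N)); first exact: dual_scale_dual.
  by move=> x; rewrite dual_scaleE mul0r.
set q := Num.sqrt 2.
have q0 : 0 < q :> R by rewrite sqrtr_gt0.
have qq : q * q = 2 by rewrite -expr2 sqr_sqrtr.
pose A : set (borel B * borel B) := [set z | `|z.1 : B| <= s].
pose A' : set (borel B * borel B) := [set z | `|(z.1 : B) + z.2| <= q * s].
pose D : set (borel B * borel B) := [set z | `|z.1 : B| <= s /\ `|z.2 : B| <= t].
pose D' : set (borel B * borel B) :=
  [set z | `|(z.1 : B) + z.2| <= q * s /\ `|(z.1 : B) - z.2| <= q * t].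
have AE : nu A = nu A'.
  have := rotation_invariance hG (fun=> s) dtau (fun=> dz0).
  congr (nu _ = nu _); apply/seteqP; split => z /=.
  - by move=> h; apply/bE => k; have := h k I; rewrite /= z0E addr0.
  - by move=> /bE h k _; rewrite /= z0E addr0.
  - by move=> h; apply/bE => k; have := h k I; rewrite /= z0E addr0.
  - by move=> /bE h k _; rewrite /= z0E addr0.
(* Two families of constraints interleaved in one sequence: even indices bound the first coordinate
   by s, odd ones the second by t. *)
pose u i := if odd i then z0 else tau i./2.
pose v i := if odd i then tau i./2 else z0.
pose c (i : nat) := if odd i then t else s.
have du i : dual (u i) by rewrite /u; case: odd.
have dv i : dual (v i) by rewrite /v; case: odd.
have DE : nu D = nu D'.
  have := rotation_invariance hG c du dv.
  congr (nu _ = nu _); apply/seteqP; split => z /=.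
  - move=> h; split; apply/bE => k.
      by have := h k.*2 I; rewrite /= /u /v /c odd_double doubleK z0E addr0.
    by have := h k.*2.+1 I; rewrite /= /u /v /c /= odd_double/= uphalf_double z0E add0r.
  - move=> [/bE h1 /bE h2] i _; rewrite /= /u /v /c; case: odd; first by rewrite z0E add0r.
    by rewrite z0E addr0.
  - move=> h; split; apply/bE => k.
      by have := h k.*2 I; rewrite /= /u /v /c odd_double doubleK z0E addr0.
    by have := h k.*2.+1 I; rewrite /= /u /v /c /= odd_double/= uphalf_double z0E add0r.
  - move=> [/bE h1 /bE h2] i _; rewrite /= /u /v /c; case: odd; first by rewrite z0E add0r.
    by rewrite z0E addr0.
have AX : A = ~` far s `*` setT.
  apply/seteqP; split => z; rewrite /setX /far /=.
    by move=> h; split=> //; apply/negP; rewrite -leNgt.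
  by move=> [/negP + _]; rewrite -leNgt.
have farE r x : far r x = (r < `|x : B|) by [].
have nfarE r x : (~ far r x) = (`|x : B| <= r).
  by apply/propext; split => [/negP|h]; rewrite ?farE -?leNgt//; apply/negP; rewrite -leNgt.
have ADX : A `\` D = ~` far s `*` far t.
  apply/seteqP; split => z; rewrite /setX /=.
    move=> [As nD]; split; first by rewrite nfarE.
    by rewrite farE ltNge; apply/negP => h; apply: nD.
  move=> []; rewrite nfarE farE => As tz; split => // -[_].
  by rewrite leNgt tz.
(* Measurability refers to the product sigma-algebra, so the norm of z.1 + a z.2 is tested through
   the functionals tau k, each a sum of functions of one coordinate. *)
have mlin (a r : R) : measurable [set z : borel B * borel B | `|(z.1 : B) + a *: (z.2 : B)| <= r].
  have -> : [set z : borel B * borel B | `|(z.1 : B) + a *: (z.2 : B)| <= r] =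
     \bigcap_k ((fun z : borel B * borel B => tau k z.1 + a * tau k z.2 : R) @^-1` `]-oo, r]).
    have tE k (z : borel B * borel B) : tau k ((z.1 : B) + a *: (z.2 : B)) =
        tau k z.1 + a * tau k z.2 :> R by rewrite linearD linearZ.
    apply/seteqP; split => z /=.
      by move=> /bE h k _ /=; rewrite in_itv /= -tE.
    by move=> h; apply/bE => k; have := h k I; rewrite /= in_itv /= -tE.
  apply: bigcap_measurableType => k _; rewrite -[X in measurable X]setTI.
  have : measurable_fun setT (fun z : borel B * borel B => tau k z.1 + a * tau k z.2 : R).
    apply: measurable_funD.
      exact: (measurableT_comp (dual_measurable (dtau k)) measurable_fst).
    apply: measurable_funM => //.
    exact: (measurableT_comp (dual_measurable (dtau k)) measurable_snd).
  by apply.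
have mA' : measurable A'.
  by have := mlin 1 (q * s); congr measurable; apply/funext => z; rewrite /= scale1r.
have mD' : measurable D'.
  apply: measurableI => //.
  by have := mlin (-1) (q * t); congr measurable; apply/funext => z; rewrite /= scaleN1r.
have mA : measurable A by rewrite AX; exact: measurableX.
have mD : measurable D.
  have -> : D = (~` far s) `*` (~` far t).
    by apply/seteqP; split => z; rewrite /setX /= !nfarE.
  exact: measurableX.
have finnu X : measurable X -> (nu X < +oo)%E.
  by move=> mX; rewrite -ge0_fin_numE// fin_num_measure.
(* The condition |y| > t is not an intersection of half spaces; the event is reached as a difference
   of two that are. *)
have EQ : nu (A `\` D) = nu (A' `\` D').
  rewrite !measureD// ?finnu//.
  have -> : A `&` D = D by apply/setIidPr => z [].
  have -> : A' `&` D' = D' by apply/setIidPr => z [].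
  by rewrite [X in (X - _)%E]AE [X in (_ - X)%E]DE.
have sub : A' `\` D' `<=` far ((t - s) / q) `*` far ((t - s) / q).
  move=> z [zA nD]; have zD : q * t < `|(z.1 : B) - z.2|.
    by rewrite ltNge; apply/negP => h; apply: nD.
  have zA' : `|(z.1 : B) + z.2| <= q * s by exact: zA.
  (* Applied to x = z.1 and x = z.2, whose doubles are z.1 + z.2 plus or minus z.1 - z.2. *)
  have half (x : B) : `|(z.1 : B) - z.2| <= `|x + x| + `|(z.1 : B) + z.2| ->
      (t - s) / q < `|x|.
    move=> h; rewrite ltr_pdivrMr//.
    have := ler_normD x x; rewrite -(ltr_pM2l q0) mulrCA qq mulrBr; lra.
  split; apply: half.
    have := ler_normD ((z.1 : B) + z.1) (- ((z.1 : B) + z.2)).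
    by rewrite normrN opprD addrACA subrr add0r.
  have := ler_normD ((z.1 : B) + z.2) (- ((z.2 : B) + z.2)).
  by rewrite normrN opprD addrACA subrr addr0 [leRHS]addrC.
have <- : nu (~` far s `*` far t) = (mu (~` far s) * mu (far t))%E by exact: product_measure1E.
have <- : nu (far ((t - s) / q) `*` far ((t - s) / q)) = (mu (far ((t - s) / q)) ^+ 2)%E.
  by rewrite expe2; exact: product_measure1E.
rewrite -ADX EQ; apply: le_measure; rewrite ?inE//.
- exact: measurableD.
- exact: measurableX.
Qed.

Let exists_near : exists2 s : R, 0 < s & (mu (far s) <= (28^-1)%:E)%E.
Proof.
have cv : mu (far n%:R) @[n --> \oo] --> mu (\bigcap_n far n%:R).
  apply: nonincreasing_cvg_mu => //.
  - by rewrite -ge0_fin_numE// fin_num_measure.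
  - exact: bigcap_measurableType.
  - move=> m n mn; apply/subsetPset => x; apply: le_lt_trans.
    by rewrite ler_nat.
have e0 : \bigcap_n far n%:R = set0.
  apply/seteqP; split => // x /(_ (Num.truncn `|x : B|).+1 I).
  by rewrite /far /= ltNge ltW// truncnS_gt.
rewrite e0 measure0 in cv.
have /fine_cvgP[_ cvf] := cv.
have [m _ h] : \forall n \near \oo, fine (mu (far n%:R)) < 28^-1.
  by apply: (cvgr_lt 0 cvf); rewrite invr_gt0.
exists m.+1%:R => //; rewrite -[X in (X <= _)%E]fineK ?fin_num_measure//.
by rewrite lee_fin; apply/ltW/h => /=.
Qed.

(* 27 / 28 is the lower bound for mu{|x| <= s}, and the ratio 1 / 27 makes
   9^n mu{|x| > s 3^n} summable. *)
Let far_decay (s : R) n : 0 < s -> (mu (far s) <= (28^-1)%:E)%E ->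
  fine (mu (far (s * 3 ^+ n))) <= 27 / 28 * 27^-1 ^+ n.+1.
Proof.
move=> s0 sle; pose F r := fine (mu (far r)).
have FE r : mu (far r) = (F r)%:E by rewrite fineK// fin_num_measure.
have GE r : mu (~` far r) = (1 - F r)%:E by rewrite probability_setC// FE EFinB.
have F0 r : 0 <= F r by rewrite fine_ge0.
have Fs : F s <= 28^-1 by rewrite -lee_fin -FE.
have Fnear r r' : r <= r' -> F r' <= F r.
  move=> rr; rewrite -lee_fin -!FE; apply: le_measure; rewrite ?inE//.
  by move=> x; exact: le_lt_trans.
elim: n => [|n IH].
  by rewrite expr0 mulr1 -/(F s) (le_trans Fs)// expr1; lra.
have := fernique_step s (s * 3 ^+ n.+1); rewrite FE GE FE -EFinM expe2 -EFinM lee_fin.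
have p3 : (3 : R) ^+ n >= 1 by rewrite exprn_ege1// ler1n.
have q0 : 0 < Num.sqrt 2 :> R by rewrite sqrtr_gt0.
have q1 : Num.sqrt 2 <= 2 :> R.
  by rewrite -(@ler_pXn2r _ 2)// ?nnegrE ?sqrtr_ge0// sqr_sqrtr//; lra.
(* The ratio 3 leaves room: 3^(n+1) - 1 >= 2 * 3^n >= sqrt 2 * 3^n. *)
have h : s * 3 ^+ n <= (s * 3 ^+ n.+1 - s) / Num.sqrt 2.
  rewrite ler_pdivlMr// exprS.
  have : s * 3 ^+ n * Num.sqrt 2 <= s * 3 ^+ n * 2.
    by rewrite ler_wpM2l// mulr_ge0// ltW// exprn_gt0.
  have : s <= s * 3 ^+ n by rewrite ler_peMr// ltW.
  lra.
have {}IH : F ((s * 3 ^+ n.+1 - s) / Num.sqrt 2) <= 27 / 28 * 27^-1 ^+ n.+1.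
  exact: le_trans (Fnear _ _ h) IH.
move=> step.
rewrite -[leLHS]/(F (s * 3 ^+ n.+1)).
set y := F (s * 3 ^+ n.+1) in step *; set z := F ((_ - _) / _) in IH step.
(* The step gives y <= 27/28 w^2, and w <= 1/27 turns one factor w into the new power. *)
have w1 : (27^-1 : R) ^+ n.+1 <= 27^-1.
  by rewrite exprS ler_piMr// ?invr_ge0// exprn_ile1// ?invr_ge0// invf_le1//; lra.
have w0 : (0 : R) <= 27^-1 ^+ n.+1 by rewrite exprn_ge0// invr_ge0.
rewrite exprS; set w := 27^-1 ^+ n.+1 in IH w1 w0 *.
have y0 : 0 <= y by exact: F0.
have z0 : 0 <= z by exact: F0.
have a1 : 27 / 28 * y <= z * z.
  apply: le_trans step; apply: ler_wpM2r => //; lra.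
have a2 : z * z <= (27 / 28 * w) * (27 / 28 * w) by apply: ler_pM.
nra.
Qed.

(** Raising the truncation level from s 3^n to s 3^(n+1) adds at most (s 3^(n+1))^2 mu{|x| > s 3^n}
    to the second moment. By [far_decay] this is at most s^2 3^-(n+1), so the truncated moments stay
    below 2 s^2. *)
Lemma norm_sqr_integrable :
  mu.-integrable setT (fun x : borel B => (`|x : B| ^+ 2)%:E).
Proof.
have [s s0 sle] := exists_near.
have mN := measurable_norm_borel.
pose g n (x : borel B) : R := Num.min `|x : B| (s * 3 ^+ n).
have mg n : measurable_fun setT (g n) by exact: measurable_minr.
have s3 n : 0 < s * 3 ^+ n by rewrite mulr_gt0// exprn_gt0.
have g0 n x : 0 <= g n x by rewrite /g le_min normr_ge0 ltW.
have mg2 n : measurable_fun setT (fun x => g n x ^+ 2) by exact: measurable_funX.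
have ig n : mu.-integrable setT (EFin \o (fun x => g n x ^+ 2)).
  apply: (@probability_bounded_integrable _ _ _ _ _ ((s * 3 ^+ n) ^+ 2)) => // x.
  rewrite ger0_norm ?sqr_ge0// lerXn2r// ?nnegrE ?g0 ?(ltW (s3 n))//.
  by rewrite /g ge_min lexx orbT.
have bound n : \int[mu]_x (g n x ^+ 2) <= s ^+ 2 * (2 - 3^-1 ^+ n).
  elim: n => [|n IH].
    rewrite expr0 (_ : 2 - 1 = 1); last by ring.
    rewrite mulr1 -[leRHS](Rintegral_prob_cst mu); apply: le_Rintegral => //.
      exact: finite_measure_integrable_cst.
    move=> x _; rewrite lerXn2r// ?nnegrE ?g0 ?(ltW s0)//.
    by rewrite /g expr0 mulr1 ge_min lexx orbT.
  have step : \int[mu]_x (g n.+1 x ^+ 2) <=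
      \int[mu]_x (g n x ^+ 2) + (s * 3 ^+ n.+1) ^+ 2 * fine (mu (far (s * 3 ^+ n))).
    have i1 : mu.-integrable setT (EFin \o (\1_(far (s * 3 ^+ n)) : borel B -> R)).
      apply: (@probability_bounded_integrable _ _ _ _ _ 1); first exact: measurable_indic.
      by move=> x; rewrite indicE; case: (_ \in _); rewrite ?normr1 ?normr0.
    have i2 := integrableZl measurableT ((s * 3 ^+ n.+1) ^+ 2) i1.
    rewrite -[fine _](Rintegral_indic mu)// -RintegralZl// -RintegralD//.
    apply: le_Rintegral => //; first exact: (integrableD measurableT (ig n) i2).
    move=> x _; rewrite indicE; case: (boolP (x \in _)) => [_|].
      rewrite mulr1 -[leLHS]add0r lerD ?sqr_ge0// lerXn2r// ?nnegrE ?g0 ?(ltW (s3 _))//.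
      by rewrite /g ge_min lexx orbT.
    rewrite mulr0 addr0 notin_setE /far /= => /negP; rewrite -leNgt => xs.
    rewrite lerXn2r// ?nnegrE ?g0//; apply: (@le_trans _ _ `|x : B|).
      by rewrite /g ge_min lexx.
    by rewrite /g le_min lexx.
  apply: (le_trans step); apply: (le_trans (lerD IH (ler_wpM2l _ (far_decay n s0 sle)))).
    exact: sqr_ge0.
  have -> : (s * 3 ^+ n.+1) ^+ 2 * (27 / 28 * 27^-1 ^+ n.+1) = s ^+ 2 * (27 / 28 * 3^-1 ^+ n.+1).
    have <- : ((3 : R) ^+ n.+1) ^+ 2 * 27^-1 ^+ n.+1 = 3^-1 ^+ n.+1.
      by rewrite -exprM mulnC exprM -exprMn; congr (_ ^+ _); field.
    by ring.
  rewrite -mulrDr ler_wpM2l ?sqr_ge0// exprS.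
  have : (0 : R) <= 3^-1 ^+ n by rewrite exprn_ge0// invr_ge0.
  set w := 3^-1 ^+ n; lra.
apply/integrableP; split.
  by apply/measurable_EFinP; apply: measurable_funX.
apply: (@le_lt_trans _ _ (s ^+ 2 * 2)%:E); last exact: ltry.
have glim (x : borel B) : limn (fun n => (g n x ^+ 2)%:E) = `|(`|x : B| ^+ 2)%:E|%E.
  apply/cvg_lim => //; apply: cvg_near_cst; near=> n.
  rewrite /= ger0_norm ?sqr_ge0//; congr (_ ^+ 2)%:E.
  rewrite /g min_l// mulrC -ler_pdivrMr//.
  apply: (@le_trans _ _ n%:R); last by rewrite -natrX ler_nat ltnW// ltn_expl.
  apply: (le_trans (ltW (truncnS_gt _))); rewrite ler_nat.
  by near: n; exact: nbhs_infty_gt.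
have cv : (\int[mu]_x ((g n x ^+ 2)%:E))%E @[n --> \oo] -->
          (\int[mu]_x `|(`|x : B| ^+ 2)%:E|)%E.
  have <- : (\int[mu]_x (limn (fun n => (g n x ^+ 2)%R%:E)) =
      \int[mu]_x `|(`|x : B| ^+ 2)%:E|)%E by apply: eq_integral => x _; exact: glim.
  apply: cvg_monotone_convergence => //.
  - by move=> n; apply/measurable_EFinP.
  - by move=> n x _; rewrite lee_fin sqr_ge0.
  - move=> x _ m n mn; rewrite lee_fin lerXn2r// ?nnegrE ?g0// /g le_min ge_min lexx/= ge_min.
    by rewrite ler_pM2l// ler_eXn2l ?mn ?orbT// ltr1n.
apply: (cvge_to_le cv); apply: nearW => n.
rewrite -[X in (X <= _)%E]fineK; last exact: (integrable_fin_num measurableT (ig n)).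
rewrite lee_fin (le_trans (bound n))// ler_wpM2l ?sqr_ge0// gerBl exprn_ge0// invr_ge0//.
Unshelve. all: by end_near. Qed.

End fernique_integrability.

(** * Bochner integral and covariance operator *)

Lemma dual_bounded (R : realType) (B : normedModType R) (t : {linear B -> R^o}) :
  dual t -> exists2 C : R, 0 < C & forall x, `|t x| <= C * `|x|.
Proof.
move=> dt.
have /linear_boundedP[M [_ hM]] := (linear_bounded_continuous t).2 dt.
exists (`|M| + 1); first by rewrite ltr_wpDl.
by apply: hM; rewrite (le_lt_trans (ler_norm M))// ltrDl.
Qed.

Lemma cauchy_seq_cvg (R : realType) (B : completeNormedModType R) (u : nat -> B) :
  (forall e : R, 0 < e -> exists N : nat, forall m n : nat,
    (N <= m)%N -> (N <= n)%N -> `|u m - u n| < e) ->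
  exists l : B, u n @[n --> \oo] --> l.
Proof.
move=> h; suff /cvg_ex[l ul] : cvg (u @ \oo) by exists l.
apply/cauchy_cvgP; apply: cauchy_exP => e e0.
have [N hN] := h e e0; exists (u N); exists N => // n /= Nn.
by rewrite -ball_normE /=; exact: hN.
Qed.

Lemma dual_separates (R : realType) (B : normedModType R) (x y : B) :
  (forall t : {linear B -> R^o}, dual t -> t x = t y) -> x = y.
Proof.
move=> h; have [t [dt tx _]] := norming_functional (x - y).
apply/eqP; rewrite -subr_eq0 -normr_eq0 -tx linearB (h _ dt) subrr//.
Qed.

Lemma borel_closed_measurable (R : realType) (B : normedModType R) (A : set B) :
  closed A -> measurable (A : set (borel B)).
Proof.
move=> cA; rewrite -[A]setCK; apply: measurableC; apply: sub_sigma_algebra.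
exact: closed_openC.
Qed.

Section bochner_theory.
Context (R : realType) (B : completeNormedModType R).
Hypothesis hB : @separable B.
Context (d : measure_display) (T : measurableType d) (P : probability T R).

(** Separability enters here: |F - G| <= r amounts to countably many conditions on the real
    functions tau k (F) - tau k (G). *)
Lemma measurable_norm_sub (F G : T -> B) :
  measurable_fun setT (F : T -> borel B) -> measurable_fun setT (G : T -> borel B) ->
  measurable_fun setT (fun x => `|F x - G x| : R).
Proof.
move=> mF mG; have [tau [dtau tle tex]] := norming_sequence hB.
have bE := norm_ballE tle tex.
apply: (measurability _ (RGenOInfty.measurableE R)) => _ [_ [r ->] <-].
rewrite setTI.
have -> : (fun x => `|F x - G x| : R) @^-1` `]r, +oo[ =
   ~` \bigcap_k ((fun x => tau k (F x) - tau k (G x) : R) @^-1` `]-oo, r]).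
  rewrite -[LHS]setCK; congr (~` _); apply/seteqP; split => x /=.
    rewrite in_itv /= andbT => /negP; rewrite -leNgt => /bE h k _.
    by rewrite /= in_itv /=; have := h k; rewrite linearB.
  move=> h; rewrite in_itv /= andbT; apply/negP; rewrite -leNgt; apply/bE => k.
  by have := h k I; rewrite /= in_itv /= linearB.
apply: measurableC; apply: bigcap_measurableType => k _; rewrite -[X in measurable X]setTI.
have : measurable_fun setT (fun x => tau k (F x) - tau k (G x) : R).
  by apply: measurable_funB; exact: (measurableT_comp (dual_measurable (dtau k))).
by apply.
Qed.

Lemma measurable_norm (F : T -> B) : measurable_fun setT (F : T -> borel B) ->
  measurable_fun setT (fun x => `|F x| : R).
Proof. by move=> mF; exact: (measurableT_comp (@measurable_norm_borel R B) mF). Qed.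

Lemma simple_map_bounded (s : T -> B) : simple_map s -> exists M : R, forall x, `|s x| <= M.
Proof.
move=> [_ /finite_seqP[r sr]].
exists (\sum_(y <- r) `|y|) => x.
have : s x \in r by have : range s (s x) by []; rewrite sr.
elim: r {sr} => [|y r IH]; first by rewrite in_nil.
rewrite in_cons big_cons => /predU1P[->|/IH h]; first by rewrite lerDl sumr_ge0.
by rewrite (le_trans h)// lerDr.
Qed.

Lemma simple_integral_dual (s : T -> B) (t : {linear B -> R^o}) :
  simple_map s -> dual t -> t (simple_integral P s) = \int[P]_x (t (s x) : R) :> R.
Proof.
move=> [ms /finite_seqP[r0 sr0]] dt.
pose r := undup r0; have sr : range s = [set` r].
  by rewrite sr0; apply/seteqP; split => x /=; rewrite mem_undup.
have mE y : measurable (s @^-1` [set y]).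
  rewrite -[X in measurable X]setTI; apply: ms => //; apply: borel_closed_measurable.
  by apply: accessible_closed_set1; apply: hausdorff_accessible; exact: norm_hausdorff.
rewrite /simple_integral sr -fsbig_seq ?undup_uniq// linear_sum.
pose f y x : R := (t y : R) * \1_(s @^-1` [set y]) x.
have fE x : (t (s x) : R) = \sum_(y <- r) f y x.
  have xr : s x \in r by have : range s (s x) by []; rewrite sr.
  rewrite (bigD1_seq (s x))//= ?undup_uniq// [X in X + _](_ : _ = t (s x)); last first.
    by rewrite /f indicE mem_set// mulr1.
  rewrite big1 ?addr0// => y ys; rewrite /f indicE memNset ?mulr0//.
  by move=> /= sy; rewrite sy eqxx in ys.
have i1 y : P.-integrable setT (EFin \o (\1_(s @^-1` [set y]) : T -> R)).
  apply: (@probability_bounded_integrable _ _ _ _ _ 1); first exact: measurable_indic.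
  by move=> x; rewrite indicE; case: (_ \in _); rewrite ?normr1 ?normr0.
have i2 y : P.-integrable setT (EFin \o f y).
  exact: (integrableZl measurableT _ (i1 y)).
under eq_Rintegral do rewrite fE.
have [_ ->] : P.-integrable setT (EFin \o (fun x => \sum_(y <- r) f y x)) /\
    \int[P]_x (\sum_(y <- r) f y x) = \sum_(y <- r) \int[P]_x f y x.
  elim: (r) => [|y r' [IHi IH]].
    split; first by under eq_fun do rewrite big_nil; exact: integrable0.
    under eq_Rintegral do rewrite big_nil.
    by rewrite big_nil /Rintegral integral0.
  split.
    under eq_fun do rewrite big_cons.
    exact: (integrableD measurableT (i2 y) IHi).
  under eq_Rintegral do rewrite big_cons.
  by rewrite RintegralD// IH big_cons.
apply: eq_bigr => y _; rewrite linearZ /= RintegralZl// Rintegral_indic//.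
by rewrite mulrC.
Qed.

Let integrable_norm_sub (F s : T -> B) : measurable_fun setT (F : T -> borel B) ->
  P.-integrable setT (fun x => (`|F x|)%:E) -> simple_map s ->
  P.-integrable setT (EFin \o (fun x => `|F x - s x|)).
Proof.
move=> mF iF ss; have [M hM] := simple_map_bounded ss.
apply: (@le_integrable _ _ _ P setT measurableT _ (fun x => (`|F x|)%:E + M%:E)%E).
- by apply/measurable_EFinP; apply: measurable_norm_sub => //; case: ss.
- move=> x _; rewrite -EFinD lee_fin normr_id.
  rewrite (le_trans (ler_normB _ _))//; apply: le_trans (ler_norm _).
  by rewrite lerD2l.
- apply: integrableD => //; exact: finite_measure_integrable_cst.
Qed.

(** Used with C = 1 and a norming functional to see that simple integrals form a Cauchy sequence,
    and with any functional to identify their limit. *)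
Lemma simple_integral_approx (F s : T -> B) (t : {linear B -> R^o}) (C : R) :
  measurable_fun setT (F : T -> borel B) -> P.-integrable setT (fun x => (`|F x|)%:E) ->
  simple_map s -> dual t -> 0 <= C -> (forall x, `|t x| <= C * `|x|) ->
  `|t (simple_integral P s) - \int[P]_x (t (F x) : R)| <= C * \int[P]_x `|F x - s x|.
Proof.
move=> mF iF ss dt C0 tC; have [ms _] := ss.
have mtF : measurable_fun setT (fun x => t (F x) : R).
  exact: (measurableT_comp (dual_measurable dt) mF).
have mts : measurable_fun setT (fun x => t (s x) : R).
  exact: (measurableT_comp (dual_measurable dt) ms).
have [M hM] := simple_map_bounded ss.
have i1 : P.-integrable setT (EFin \o (fun x => t (F x) : R)).
  apply: (@le_integrable _ _ _ P setT measurableT _ (fun x => C%:E * (`|F x|)%:E)%E).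
  - exact/measurable_EFinP.
  - by move=> x _; rewrite -EFinM lee_fin (le_trans (tC _))// ler_norm.
  - exact: integrableZl.
have i2 : P.-integrable setT (EFin \o (fun x => t (s x) : R)).
  apply: (@probability_bounded_integrable _ _ _ _ _ (C * M)) => // x.
  by rewrite (le_trans (tC _))// ler_wpM2l.
have i3 := integrable_norm_sub mF iF ss.
rewrite simple_integral_dual// distrC -RintegralB// -RintegralZl//.
have i12 : P.-integrable setT (EFin \o (fun x => (t (F x) : R) - t (s x))).
  exact: (integrableB measurableT i1 i2).
apply: (le_trans (le_normr_Rintegral measurableT i12)).
apply: le_Rintegral => //.
- exact: (integrable_norm i12).
- exact: (integrableZl measurableT C i3).
by move=> x _; have := tC (F x - s x); rewrite linearB.
Qed.

End bochner_theory.

Section bochner_existence.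
Context (R : realType) (B : completeNormedModType R).
Hypothesis hB : @separable B.
Context (d : measure_display) (T : measurableType d) (P : probability T R).

Let dense_sequence : exists2 e : nat -> B, e 0%N = 0 & forall x (eps : R), 0 < eps ->
  exists k, `|x - e k| < eps.
Proof.
have [D /countable_injP[f finj] Dd] := hB.
pose d_ k := xget 0 [set x | D x /\ f x = k].
exists (fun k => if k is k'.+1 then d_ k' else 0) => // x eps e0.
have [y [xy Dy]] : (ball x eps `&` D) !=set0.
  by apply: Dd; [exists x; exact: ballxx|exact: ball_open].
exists (f y).+1.
have -> : d_ (f y) = y.
  by rewrite /d_; case: xgetP => [z _ [Dz /finj]|/(_ y)[]//]; apply; exact: mem_set.
by move: xy; rewrite -ball_normE.
Qed.

(** The point closest to F x among e 0, ..., e n, ties going to the smaller index. With e 0 = 0 the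
    error never exceeds |F x|, which supplies the dominating function. *)
Fixpoint nearest_point (e : nat -> B) (F : T -> B) n (x : T) : B :=
  if n is m.+1 then
    if `|F x - e n| < `|F x - nearest_point e F m x| then e n else nearest_point e F m x
  else e 0%N.

Let nearest_le e F n x k : (k <= n)%N ->
  `|F x - nearest_point e F n x| <= `|F x - e k|.
Proof.
elim: n => [|n IH] /=; first by rewrite leqn0 => /eqP ->.
rewrite leq_eqVlt ltnS; case: ifPn => h /predU1P[->|/IH kn]//.
- exact: le_trans (ltW h) kn.
- by rewrite leNgt.
Qed.

Let nearest_simple e F n : measurable_fun setT (F : T -> borel B) ->
  simple_map (nearest_point e F n).
Proof.
move=> mF; elim: n => [|n [IHm IHf]].
  have -> : nearest_point e F 0 = cst (e 0%N) by [].
  split; first exact: measurable_cst.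
  by apply: (@sub_finite_set _ _ [set e 0%N]) => [_ [x _ <-]|]; [|exact: finite_set1].
have mc : measurable_fun setT ((fun=> e n.+1) : T -> borel B) by exact: measurable_cst.
split.
  have mb : measurable_fun setT
      (fun x => `|F x - e n.+1| < `|F x - nearest_point e F n x|).
    apply: measurable_fun_ltr; first exact: (measurable_norm_sub hB mF mc).
    exact: (measurable_norm_sub hB mF IHm).
  exact: (measurable_fun_ifT mb mc IHm).
apply: (@sub_finite_set _ _ ([set e n.+1] `|` range (nearest_point e F n))).
  by move=> _ [x _ <-] /=; case: ifPn => _; [left|right; exists x].
by rewrite finite_setU; split => //; exact: finite_set1.
Qed.

(** Dominated convergence makes the L1 errors of [nearest_point] vanish. A functional norming the
    difference of two simple integrals bounds it by the sum of their errors. *)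
Lemma bochner_integral_exists (F : T -> B) : measurable_fun setT (F : T -> borel B) ->
  P.-integrable setT (fun x => (`|F x|)%:E) -> exists v, is_bochner_integral P F v.
Proof.
move=> mF iF; have [e e0 edense] := dense_sequence.
pose s n := nearest_point e F n.
have ss n : simple_map (s n) by exact: nearest_simple.
have mFs n : measurable_fun setT (fun x => `|F x - s n x| : R).
  by apply: (measurable_norm_sub hB) => //; case: (ss n).
have sF x : `|F x - s n x| @[n --> \oo] --> (0 : R).
  apply/cvgrPdist_lt => eps eps0; have [k hk] := edense (F x) eps eps0.
  exists k => // n /= kn; rewrite sub0r normrN normr_id.
  exact: le_lt_trans (nearest_le e F x kn) hk.
have sle n x : `|F x - s n x| <= `|F x|.
  by have := nearest_le e F x (leq0n n); rewrite e0 subr0.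
have I0 : (\int[P]_x (`|F x - s n x|)%:E)%E @[n --> \oo] --> 0%E.
  rewrite -[X in _ --> X](@integral0 _ _ _ P setT).
  apply: (@dominated_cvg _ _ _ P setT measurableT _ _ (fun x => (`|F x|)%:E)) => //.
  - by move=> n; apply/measurable_EFinP.
  - by move=> x _; apply: cvg_EFin; [exact: nearW|exact: sF].
  - by move=> n x _; rewrite /= lee_fin normr_id.
have [v sv] : exists v : B, simple_integral P (s n) @[n --> \oo] --> v.
  apply: cauchy_seq_cvg => eps eps0.
  have /fine_cvgP[_ /cvgrPdist_lt/(_ (eps / 2))] := I0.
  move=> []; first by rewrite divr_gt0.
  move=> N _ hN; exists N => m n Nm Nn.
  have [t [dt tx tle]] := norming_functional (simple_integral P (s m) - simple_integral P (s n)).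
  have tle1 x : `|t x| <= 1 * `|x| by rewrite mul1r.
  have E k := simple_integral_approx hB mF iF (ss k) dt ler01 tle1.
  have small k : (N <= k)%N -> \int[P]_x `|F x - s k x| < eps / 2.
    by move=> /hN /=; rewrite sub0r normrN => /(le_lt_trans (ler_norm _)).
  rewrite -tx linearB.
  have := E m; have := E n; have := small m Nm; have := small n Nn.
  rewrite !mul1r !ler_norml.
  set a := Rintegral _ _ _; set b := Rintegral _ _ _; set c := Rintegral _ _ _.
  move=> h1 h2 /andP[h3 h4] /andP[h5 h6].
  have -> : t (simple_integral P (s m)) - t (simple_integral P (s n)) =
    (t (simple_integral P (s m)) - t (simple_integral P (s n)) : R) by [].
  lra.
exists v; exists s; split => //.
by apply: aeW => x; apply/cvgrPdist_lt => eps eps0; move/cvgrPdist_lt/(_ eps eps0): (sF x);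
  apply: filterS => n; rewrite sub0r normrN normr_id.
Qed.

(** This holds for whichever vector [xget] selects, and by [dual_separates] it determines that
    vector. *)
Lemma bochner_integral_dual (F : T -> B) (t : {linear B -> R^o}) :
  measurable_fun setT (F : T -> borel B) ->
  P.-integrable setT (fun x => (`|F x|)%:E) -> dual t ->
  t (bochner_integral P F) = \int[P]_x (t (F x) : R) :> R.
Proof.
move=> mF iF dt; have [C C0 tC] := dual_bounded dt.
have : is_bochner_integral P F (bochner_integral P F).
  exact: (xgetPex 0 (bochner_integral_exists mF iF)).
set v := bochner_integral P F => -[s [ss _ I0 sv]].
have E k := simple_integral_approx hB mF iF (ss k) dt (ltW C0) tC.
have l1 : t (simple_integral P (s n)) @[n --> \oo] --> t v.
  by apply: (cvg_comp _ _ sv); exact: dt.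
have /fine_cvgP[_ I0'] := I0.
have l2 : t (simple_integral P (s n)) @[n --> \oo] --> (\int[P]_x (t (F x) : R) : R^o).
  apply/cvgrPdist_le => eps eps0.
  have : \forall n \near \oo, \int[P]_x `|F x - s n x| <= eps / C.
    by apply: (cvgr_le 0 I0'); rewrite divr_gt0.
  apply: filterS => n hn; rewrite distrC (le_trans (E n))//.
  by rewrite mulrC -ler_pdivlMr.
exact: (cvg_unique _ l1 l2).
Qed.

End bochner_existence.

Section covariance_operator.
Context (R : realType) (B : completeNormedModType R) (mu : probability (borel B) R).
Hypothesis hG : gaussian mu.
Hypothesis hB : @separable B.
Implicit Types (f g t : {linear B -> R^o}).

(** Here Fernique's estimate is used: |f(x) x| <= C |x|^2 is integrable. Everything later about
    [covS] rests on this weak identity. *)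
Lemma covS_dual f t : dual f -> dual t -> t (covS mu f) = Hdot mu t f :> R.
Proof.
move=> df dt; have [C C0 fC] := dual_bounded df.
have cF : continuous (fun x : B => (f x : R) *: x).
  by move=> x; apply: cvgZ; [exact: df|exact: cvg_id].
have mF : measurable_fun setT ((fun x : borel B => (f x : R) *: (x : B)) : borel B -> borel B).
  apply: (@measurability _ _ (borel B) (borel B) setT _ (@open B) erefl) => _ [A oA <-]; rewrite setTI.
  apply: sub_sigma_algebra; apply: open_comp oA => x _; exact: cF.
have iF : mu.-integrable setT (fun x : borel B => (`|(f x : R) *: (x : B)|)%:E).
  apply: (@le_integrable _ _ _ mu setT measurableT _ (fun x => C%:E * (`|x : B| ^+ 2)%:E)%E).
  - by apply/measurable_EFinP; exact: measurable_norm mF.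
  - move=> x _; rewrite -EFinM lee_fin normr_id normrZ.
    rewrite [leRHS]ger0_norm ?mulr_ge0 ?sqr_ge0 ?(ltW C0)//.
    by rewrite expr2 mulrA ler_wpM2r.
  - by apply: integrableZl => //; exact: norm_sqr_integrable.
rewrite /covS (bochner_integral_dual hB mF iF dt).
by apply: eq_Rintegral => x _; rewrite linearZ mulrC.
Qed.

(** The finiteness of sigma(mu). *)
Lemma Hseminorm_le_norm : exists2 C : R, 0 <= C & forall t, dual t ->
  (forall x, `|t x| <= `|x|) -> Hseminorm mu t <= C.
Proof.
have i2 := norm_sqr_integrable hG hB.
exists (Num.sqrt (\int[mu]_x (`|x : B| ^+ 2))); first exact: sqrtr_ge0.
move=> t dt tle; rewrite /Hseminorm ler_wsqrtr// /Hdot.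
apply: le_Rintegral => //; first exact: Hdot_integrable.
move=> x _; rewrite -expr2 -[t x ^+ 2]ger0_norm ?sqr_ge0// normrX.
by rewrite lerXn2r// ?nnegrE.
Qed.

Lemma covS_comb c f g : dual f -> dual g ->
  covS mu (dual_comb c f g) = covS mu f + c *: covS mu g.
Proof.
move=> df dg; apply: dual_separates => t dt.
have -> : t (covS mu f + c *: covS mu g) = t (covS mu f) + c * t (covS mu g) :> R.
  by rewrite linearD linearZ.
transitivity (Hdot mu t (dual_comb c f g)).
  exact: covS_dual (dual_comb_dual c df dg) dt.
transitivity (Hdot mu f t + c * Hdot mu g t).
  exact: etrans (HdotC mu t _) (Hdot_combl hG c df dg dt).
congr (_ + c * _); first exact: etrans (HdotC mu f t) (esym (covS_dual df dt)).
exact: etrans (HdotC mu g t) (esym (covS_dual dg dt)).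
Qed.

(** Continuity of the inclusion of the range of S in B, so that a Cauchy sequence for the Hilbert
    norm has a limit in B. *)
Lemma covS_le : exists2 C : R, 0 <= C & forall f, dual f ->
  `|covS mu f| <= C * Hseminorm mu f.
Proof.
have [C C0 hC] := Hseminorm_le_norm; exists C => // f df.
have [t [dt <- tle]] := norming_functional (covS mu f).
rewrite (covS_dual df dt) (le_trans (ler_norm _))//.
rewrite (le_trans (Hdot_cauchy_schwarz hG dt df))// ler_wpM2r ?Hseminorm_ge0//.
exact: hC.
Qed.

End covariance_operator.

(** * The generating Hilbert space *)

Section generating_space.
Context (R : realType) (B : completeNormedModType R) (mu : probability (borel B) R).
Hypothesis hG : gaussian mu.
Hypothesis hB : @separable B.
Implicit Types (f g t : {linear B -> R^o}) (a : B) (C : R).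
Local Notation sd := (Hseminorm mu).
Local Notation dot := (Hdot mu).

(** Stands for membership in the ball of radius C of H_mu, as a closed condition on a that mentions
    no sequence. *)
Definition covariance_bounded C a := forall t, dual t -> `|t a : R| <= C * sd t.

Lemma Hseminorm_subE f g : Hseminorm mu (fun x => f x - g x) = sd (dual_comb (-1) f g).
Proof. by congr Hseminorm; apply/funext => x; rewrite dual_combE mulN1r. Qed.

Lemma Hseminorm_dist f g : dual f -> dual g ->
  `|sd f - sd g| <= sd (dual_comb (-1) f g).
Proof.
move=> df dg.
rewrite -(@ler_pXn2r _ 2)// ?nnegrE ?Hseminorm_ge0// real_normK ?num_real//.
rewrite Hseminorm_comb_sqr//.
have := Hdot_cauchy_schwarz hG df dg; rewrite ler_norml => /andP[_ h]; lra.
Qed.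

Lemma Hdot_comb_cvg (f_ : nat -> {linear B -> R^o}) a t : (forall n, dual (f_ n)) -> dual t ->
  covS mu (f_ n) @[n --> \oo] --> a -> dot t (f_ n) @[n --> \oo] --> (t a : R).
Proof.
move=> df dt fa.
have -> : (fun n => dot t (f_ n)) = (fun n => t (covS mu (f_ n)) : R).
  by apply/funext => n; rewrite covS_dual.
exact: (cvg_comp _ _ fa (dt a)).
Qed.

(** C is the Hilbert norm of a. The last convergence says that f_n a / sd(f_n) tends to C when C >
    0, so the constant C of the bound is optimal. *)
Lemma represents_limit (f_ : nat -> {linear B -> R^o}) a : represents mu f_ a ->
  exists C, [/\ 0 <= C, sd (f_ n) @[n --> \oo] --> C, covariance_bounded C a
    & f_ n a @[n --> \oo] --> (C ^+ 2 : R)].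
Proof.
move=> [df fc fa].
have [C fC] : exists C : R^o, (sd (f_ n) : R^o) @[n --> \oo] --> C.
  apply: cauchy_seq_cvg => e e0; have [N hN] := fc e e0; exists N => m n Nm Nn.
  apply: (le_lt_trans (Hseminorm_dist (df m) (df n))).
  by rewrite -Hseminorm_subE; exact: hN.
have C0 : 0 <= C by apply: (cvgr_to_ge fC); apply: nearW => n; exact: Hseminorm_ge0.
exists C; split => //.
  move=> t dt; have h := Hdot_comb_cvg df dt fa.
  apply: (@ler_cvg_to _ \oo _ _ (fun n => `|dot t (f_ n)|) (fun n => sd (f_ n) * sd t)).
  - exact: (cvg_norm h).
  - by apply: cvgMl.
  - by apply: nearW => n; rewrite mulrC; exact: Hdot_cauchy_schwarz.
have fC2 : sd (f_ n) ^+ 2 @[n --> \oo] --> (C ^+ 2 : R) by exact: cvgM.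
suff h : (f_ n a : R) - sd (f_ n) ^+ 2 @[n --> \oo] --> (0 : R).
  have -> : (fun n => f_ n a : R) = (fun n => ((f_ n a : R) - sd (f_ n) ^+ 2) + sd (f_ n) ^+ 2).
    by apply/funext => n; rewrite subrK.
  by rewrite -[C ^+ 2]add0r; exact: (cvgD h fC2).
apply/cvgrPdist_le => e e0.
have K0 : 0 < C + 1 by rewrite ltr_wpDl.
have [N hN] := fc (e / (C + 1)) (divr_gt0 e0 K0).
have bC : \forall n \near \oo, sd (f_ n) <= C + 1 by apply: (cvgr_le C fC); rewrite ltrDl.
near=> n; rewrite sub0r normrN.
(* f_n a - sd(f_n)^2 is the limit over m of the product of f_m - f_n with f_n, which the Cauchy
   property makes small uniformly in m. *)
have l1 := Hdot_comb_cvg df (df n) fa.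
have l2 : `|dot (f_ n) (f_ m) - sd (f_ n) ^+ 2| @[m --> \oo] --> `|(f_ n a : R) - sd (f_ n) ^+ 2|.
  by apply: cvg_norm; apply: cvgB => //; exact: cvg_cst.
apply: (cvgr_to_le l2); exists N => // m /= Nm.
have -> : dot (f_ n) (f_ m) - sd (f_ n) ^+ 2 = dot (dual_comb (-1) (f_ m) (f_ n)) (f_ n).
  by rewrite Hdot_combl// Hseminorm_sqr (HdotC mu (f_ m)); ring.
apply: (le_trans (Hdot_cauchy_schwarz hG (dual_comb_dual (-1) (df m) (df n)) (df n))).
have Nn : (N <= n)%N by near: n; exact: nbhs_infty_ge.
have := hN m n Nm Nn; rewrite Hseminorm_subE => h1.
have h2 : sd (f_ n) <= C + 1 by near: n.
have -> : e = e / (C + 1) * (C + 1) by rewrite divfK// gt_eqF.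
by apply: ler_pM; rewrite ?Hseminorm_ge0// ltW.
Unshelve. all: by end_near. Qed.

Lemma Hspace_covariance_bounded a : Hspace mu a -> exists2 C, 0 <= C & covariance_bounded C a.
Proof. by move=> [f /represents_limit[C [C0 _ h _]]]; exists C. Qed.

(** A linear term dominated by a quadratic one near 0 vanishes. The test value has the sign of A and
    a denominator exceeding |D|. *)
Let quadratic_bound (A D : R) : (forall l : R, l * A <= l ^+ 2 * D) -> A = 0.
Proof.
move=> h; apply/eqP; apply/negPn/negP => A0.
have K0 : 0 < `|D| + 1 by rewrite ltr_wpDl.
have := h (A / (`|D| + 1)).
have -> : A / (`|D| + 1) * A = (A / (`|D| + 1)) ^+ 2 * (`|D| + 1).
  by field; rewrite gt_eqF.
have q0 : 0 < (A / (`|D| + 1)) ^+ 2.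
  rewrite exprn_even_gt0//=; apply: mulf_neq0 => //.
rewrite ler_pM2l//.
by have := ler_norm D; lra.
Qed.

Let sqr_lower_bound (y w : R) : 0 <= y -> 2 - y <= w -> 0 <= w -> 4 - 4 * y <= w ^+ 2.
Proof.
move=> y0 yw w0; have [h|h] := leP (2 - y) 0.
  by apply: le_trans (sqr_ge0 w); lra.
have h1 : (2 - y) ^+ 2 <= w ^+ 2 by rewrite lerXn2r// ?nnegrE// ltW.
by apply: le_trans h1; have := sqr_ge0 y; rewrite !expr2; lra.
Qed.

Let parallelogram_arith (x u v p w y : R) : w = u + 2 * p + v -> x = u - 2 * p + v ->
  u <= 1 -> v <= 1 -> 4 - 4 * y <= w -> x <= 4 * y.
Proof. by move=> -> -> *; lra. Qed.

(* Riesz representation of t |-> t a: a maximizing sequence over the unit ball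
   of the covariance seminorm is Cauchy by the parallelogram identity. *)
Lemma covariance_bounded_Hspace a C : covariance_bounded C a -> Hspace mu a.
Proof.
move=> aC.
have [t0 [dt0 _ _]] := norming_functional a.
have [z [dz zE]] : exists z : {linear B -> R^o}, dual z /\ forall x, z x = 0 :> R.
  exists (dual_scale 0 t0); split; first exact: dual_scale_dual.
  by move=> x; rewrite dual_scaleE mul0r.
have sz : sd z = 0.
  by rewrite /Hseminorm /Hdot; under eq_Rintegral do rewrite zE mul0r;
    rewrite Rintegral_prob_cst sqrtr0.
pose S := [set (t a : R) | t in [set t : {linear B -> R^o} | dual t /\ sd t <= 1]].
have S0 : S 0 by exists z; rewrite ?zE//=; split => //; rewrite sz.
have ubS : ubound S `|C|.
  move=> _ [t [dt t1] <-]; rewrite (le_trans (ler_norm _))//.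
  rewrite (le_trans (aC t dt))// (le_trans (ler_wpM2r (Hseminorm_ge0 _ _) (ler_norm C)))//.
  by rewrite -[leRHS]mulr1 ler_wpM2l.
have supS : has_sup S by split; [exists 0|exists `|C|].
pose M := sup S.
have M0 : 0 <= M by apply: ub_le_sup => //; case: supS.
have MS t : dual t -> `|t a| <= M * sd t.
  move=> dt; have := Hseminorm_ge0 mu t; rewrite le_eqVlt => /predU1P[t_eq0|tp].
    by have := aC t dt; rewrite -t_eq0 !mulr0.
  suff pos u : dual u -> 0 < sd u -> u a <= M * sd u :> R.
    rewrite ler_norml pos// andbT lerNl.
    have dn := dual_scale_dual (-1) dt.
    have sn : sd (dual_scale (-1) t) = sd t by rewrite Hseminorm_scale// normrN1 mul1r.
    by have := pos _ dn; rewrite sn dual_scaleE mulN1r; exact.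
  move=> du up; rewrite -ler_pdivrMr//; apply: ub_le_sup; first by case: supS.
  exists (dual_scale (sd u)^-1 u); last by rewrite dual_scaleE mulrC.
  split; first exact: dual_scale_dual.
  by rewrite Hseminorm_scale// gtr0_norm ?invr_gt0// mulVf ?gt_eqF.
have Madh (e : R) : 0 < e -> exists f, [/\ dual f, sd f <= 1 & M - e < f a :> R].
  by move=> e0; have [_ [f [df f1] <-] h] := sup_adherent e0 supS; exists f.
clearbody M.
(* If M = 0 all functionals vanish at a, so a = 0, which the zero functional represents. *)
have [M_eq0|M_neq0] := eqVneq M 0.
  have -> : a = 0.
    apply: dual_separates => t dt; rewrite linear0; apply/eqP; rewrite -normr_le0.
    by have := MS t dt; rewrite M_eq0 mul0r.
  exists (fun=> z); split => //.
    move=> e e0; exists 0%N => m n _ _.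
    rewrite /Hseminorm /Hdot; under eq_Rintegral do rewrite subrr mul0r.
    by rewrite Rintegral_prob_cst sqrtr0.
  have -> : covS mu z = 0.
    apply: dual_separates => t dt; rewrite linear0 covS_dual//.
    by rewrite /Hdot; under eq_Rintegral do rewrite zE mulr0; rewrite Rintegral_prob_cst.
  exact: cvg_cst.
have Mp : 0 < M by rewrite lt_neqAle eq_sym M_neq0.
have ex n : exists f, [/\ dual f, sd f <= 1 & M - n.+1%:R^-1 < f a :> R].
  by apply: Madh; rewrite invr_gt0.
have {ex} [f hf] := choice ex.
have df n : dual (f n) by case: (hf n).
have f1 n : sd (f n) <= 1 by case: (hf n).
have fM n : M - n.+1%:R^-1 < f n a :> R by case: (hf n).
(* Evaluating f_m + f_n at a gives sd(f_m + f_n) >= 2 - E / M, so little is left for the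
   difference. *)
have parallelogram m n : sd (dual_comb (-1) (f m) (f n)) ^+ 2 <=
    4 / M * (m.+1%:R^-1 + n.+1%:R^-1).
  have := MS _ (dual_comb_dual 1 (df m) (df n)); rewrite dual_combE mul1r.
  set E := m.+1%:R^-1 + n.+1%:R^-1 => h.
  have h1 : 2 * M - E <= M * sd (dual_comb 1 (f m) (f n)).
    apply: le_trans h; apply: le_trans (ler_norm _).
    move: (fM m) (fM n); rewrite /E; move: (f m a : R) (f n a : R) m.+1%:R^-1 n.+1%:R^-1.
    by move=> p q r s h1 h2; lra.
  have h2 := Hseminorm_comb_sqr hG 1 (df m) (df n).
  have h3 := Hseminorm_comb_sqr hG (-1) (df m) (df n).
  have E0 : 0 <= E by rewrite addr_ge0// invr_ge0.
  clearbody E.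
  have h4 : 2 - E / M <= sd (dual_comb 1 (f m) (f n)).
    rewrite -(ler_pM2l Mp) mulrBr mulrCA divff ?gt_eqF// mulr1 mulrC; exact: h1.
  have sm : sd (f m) ^+ 2 <= 1 by rewrite exprn_ile1// Hseminorm_ge0.
  have sn : sd (f n) ^+ 2 <= 1 by rewrite exprn_ile1// Hseminorm_ge0.
  have EM : 0 <= E / M by rewrite divr_ge0.
  have -> : 4 / M * E = 4 * (E / M) by rewrite mulrAC -mulrA.
  have := Hseminorm_ge0 mu (dual_comb 1 (f m) (f n)).
  set w := sd (dual_comb 1 _ _) in h2 h4 * => w0.
  have : 4 - 4 * (E / M) <= w ^+ 2.
    exact: sqr_lower_bound.
  have h2' : w ^+ 2 = sd (f m) ^+ 2 + 2 * dot (f m) (f n) + sd (f n) ^+ 2.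
    by rewrite /w h2 mulr1 expr1n mul1r.
  have h3' : sd (dual_comb (-1) (f m) (f n)) ^+ 2 =
      sd (f m) ^+ 2 - 2 * dot (f m) (f n) + sd (f n) ^+ 2.
    by rewrite h3 mulrN1 mulNr sqrrN expr1n mul1r.
  by move=> h6; exact: (parallelogram_arith h2' h3' sm sn h6).
(* The f_n are approximately unit vectors in the direction of a; a itself has norm M. *)
pose g n := dual_scale M (f n).
have dg n : dual (g n) by exact: dual_scale_dual.
have gB m n : sd (dual_comb (-1) (g m) (g n)) = M * sd (dual_comb (-1) (f m) (f n)).
  have := Hseminorm_scale hG M (dual_comb_dual (-1) (df m) (df n)).
  rewrite (gtr0_norm Mp) => <-.
  congr Hseminorm; apply/funext => x.
  by rewrite dual_combE !dual_scaleE dual_combE; ring.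
have gc e : 0 < e -> exists N : nat, forall m n : nat,
    (N <= m)%N -> (N <= n)%N -> Hseminorm mu (fun x => g m x - g n x) < e.
  move=> e0.
  have : \forall n \near \oo, n.+1%:R^-1 < e ^+ 2 / (8 * M).
    by apply: (cvgr_lt 0 (@cvg_natr_inv R)); rewrite divr_gt0// ?exprn_gt0// mulr_gt0.
  move=> [N _ hN]; exists N => m n Nm Nn; rewrite Hseminorm_subE gB.
  rewrite -(@ltr_pXn2r _ 2)// ?nnegrE ?mulr_ge0 ?Hseminorm_ge0 ?(ltW e0)//.
  rewrite exprMn; apply: (le_lt_trans (ler_wpM2l (sqr_ge0 _) (parallelogram m n))).
  have -> : M ^+ 2 * (4 / M * (m.+1%:R^-1 + n.+1%:R^-1)) = 4 * M * (m.+1%:R^-1 + n.+1%:R^-1).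
    by move: m.+1%:R^-1 n.+1%:R^-1 => p q; field.
  have -> : e ^+ 2 = 4 * M * (e ^+ 2 / (8 * M) + e ^+ 2 / (8 * M)) by field.
  by rewrite ltr_pM2l ?mulr_gt0// ltrD//; exact: hN.
have [K K0 hK] := covS_le hG hB.
have [b gb] : exists b : B, covS mu (g n) @[n --> \oo] --> b.
  apply: cauchy_seq_cvg => e e0.
  have K1 : 0 < K + 1 by rewrite ltr_wpDl.
  have [N hN] := gc (e / (K + 1)) (divr_gt0 e0 K1); exists N => m n Nm Nn.
  have -> : covS mu (g m) - covS mu (g n) = covS mu (dual_comb (-1) (g m) (g n)).
    by rewrite covS_comb// scaleN1r.
  apply: (le_lt_trans (hK _ (dual_comb_dual (-1) (dg m) (dg n)))).
  have := hN m n Nm Nn; rewrite Hseminorm_subE ltr_pdivlMr// => h.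
  apply: le_lt_trans h; rewrite mulrC ler_wpM2l ?Hseminorm_ge0//.
  by rewrite lerDl.
have rgb : represents mu g b by split.
suff -> : a = b by exists g.
have [Cb [Cb0 gCb _ _]] := represents_limit rgb.
have ga : (g n a : R) @[n --> \oo] --> M ^+ 2.
  apply: (@squeeze_cvgr _ _ _ _ (fun n => M * (M - n.+1%:R^-1)) (cst (M ^+ 2))).
  - apply: nearW => n; rewrite dual_scaleE expr2 !ler_pM2l// ltW//=.
    rewrite -[leRHS]mulr1 (le_trans (ler_norm _))// (le_trans (MS _ (df n)))//.
    by rewrite ler_pM2l.
  - have -> : M ^+ 2 = M * (M - 0) by rewrite subr0 expr2.
    apply: cvgM; first exact: cvg_cst.
    by apply: cvgB; [exact: cvg_cst|exact: cvg_natr_inv].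
  - exact: cvg_cst.
have CbM : Cb <= M.
  apply: (cvgr_to_le gCb); apply: nearW => n.
  by rewrite Hseminorm_scale// gtr0_norm// -[leRHS]mulr1 ler_pM2l.
apply: dual_separates => t dt.
(* First variation: [MS] at g_n + l t, in the limit over n. As Cb <= M, comparing the terms linear
   in l gives t a = t b. *)
have key l : (M ^+ 2 + l * t a) ^+ 2 <= M ^+ 2 * (Cb ^+ 2 + 2 * l * t b + l ^+ 2 * sd t ^+ 2) :> R.
  apply: (@ler_cvg_to _ \oo _ _ (fun n => ((g n a : R) + l * t a) ^+ 2)
     (fun n => M ^+ 2 * (sd (g n) ^+ 2 + 2 * l * dot t (g n) + l ^+ 2 * sd t ^+ 2))).
  - have h : (g n a : R) + l * t a @[n --> \oo] --> M ^+ 2 + l * (t a : R).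
      by apply: cvgD => //; exact: cvg_cst.
    exact: (cvgM h h).
  - apply: cvgM; first exact: cvg_cst.
    apply: cvgD; last exact: cvg_cst.
    apply: cvgD; first exact: (cvgM gCb gCb).
    by apply: cvgM; [exact: cvg_cst|exact: Hdot_comb_cvg].
  - apply: nearW => n; rewrite (HdotC mu t) -Hseminorm_comb_sqr// -exprMn.
    have := MS _ (dual_comb_dual l (dg n) dt); rewrite dual_combE => h.
    rewrite -real_normK ?num_real// lerXn2r// ?nnegrE//.
    by rewrite mulr_ge0// Hseminorm_ge0.
suff : (t a : R) - (t b : R) = 0 by move/eqP; rewrite subr_eq0 => /eqP.
apply: (@quadratic_bound _ (sd t ^+ 2 / 2)) => l.
have M2 : 0 < M ^+ 2 by rewrite exprn_gt0.
have Cb2 : Cb ^+ 2 <= M ^+ 2 by rewrite lerXn2r// nnegrE.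
have PQ : M ^+ 2 * Cb ^+ 2 <= M ^+ 2 * M ^+ 2 by rewrite ler_wpM2l ?(ltW M2).
rewrite -(ler_pM2l M2); move: (key l) PQ.
move: (t a : R) (t b : R) (M ^+ 2) (Cb ^+ 2) (sd t ^+ 2) => A D p q w h PQ.
have lA : 0 <= (l * A) ^+ 2 by exact: sqr_ge0.
have e1 : p * (l * (A - D)) =
  2^-1 * ((p + l * A) ^+ 2 - p * p - 2 * p * l * D - (l * A) ^+ 2) by field.
have e2 : p * (l ^+ 2 * (w / 2)) =
  2^-1 * (p * (q + 2 * l * D + l ^+ 2 * w) - p * q - 2 * p * l * D) by field.
rewrite e1 e2 ler_pM2l ?invr_gt0//.
lra.
Qed.

End generating_space.

(** * Half space depth *)

Section depth.
Context (R : realType) (B : completeNormedModType R) (mu : probability (borel B) R).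
Hypothesis hG : gaussian mu.
Hypothesis hB : @separable B.
Implicit Types (f g t : {linear B -> R^o}) (a : B) (C : R).
Local Notation sd := (Hseminorm mu).
Local Notation N := (@normal_prob R 0 1).

Lemma Hseminorm_eq0_gt0 t : sd t = 0 \/ 0 < sd t.
Proof.
by have := Hseminorm_ge0 mu t; rewrite le_eqVlt => /predU1P[<-|]; [left|right].
Qed.

Lemma HD_le a t : dual t -> (HD mu a <= mu [set x | ((t a : R) <= t x)%R])%E.
Proof. by move=> dt; apply: ereal_inf_lbound; exists t. Qed.

Lemma HD_ge a (y : \bar R) :
  (forall t, dual t -> (y <= mu [set x | ((t a : R) <= t x)%R])%E) -> (y <= HD mu a)%E.
Proof. by move=> h; apply: le_ereal_inf_tmp => _ [t dt <-]; exact: h. Qed.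

Lemma HD_ge0 (nu : {measure set (borel B) -> \bar R}) a : (0 <= HD nu a)%E.
Proof. by apply: le_ereal_inf_tmp => _ [t _ <-]; exact: measure_ge0. Qed.

Lemma HD_fin_num a : HD mu a \is a fin_num.
Proof.
rewrite ge0_fin_numE ?HD_ge0//.
have [t [dt _ _]] := norming_functional (0 : B).
apply: le_lt_trans (HD_le a dt) _.
have E : [set x | (t a : R) <= t x] = t @^-1` `[t a, +oo[.
  by apply/seteqP; split => x /=; rewrite in_itv/= andbT.
apply: (le_lt_trans (probability_le1 mu _)); last exact: ltry.
by rewrite E -[X in measurable X]setTI; exact: dual_measurable.
Qed.

Lemma degenerate_tail t (c : R) : dual t -> sd t = 0 ->
  mu [set x | c <= t x] = (if (c <= 0)%R then 1 else 0)%E.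
Proof.
move=> dt t0; have E : [set x | c <= t x] = t @^-1` `[c, +oo[.
  by apply/seteqP; split => x /=; rewrite in_itv /= andbT.
rewrite E dual_law_degenerate// diracE.
case: ifPn => c0; first by rewrite mem_set//= in_itv /= c0.
by rewrite memNset//= in_itv /= andbT; apply/negP.
Qed.

Lemma HD_ge_tail a C : covariance_bounded mu C a -> (N `[C, +oo[%classic <= HD mu a)%E.
Proof.
move=> aC; apply: HD_ge => t dt.
have [t0|t0] := Hseminorm_eq0_gt0 t.
  have := aC t dt; rewrite t0 mulr0 normr_le0 => /eqP ta.
  rewrite (degenerate_tail _ dt t0) ta lexx.
  exact: (probability_le1 (normal_prob 0 1)).
rewrite (dual_tail hG)//; apply: normal_tail_le.
by rewrite ler_pdivrMr// (le_trans (ler_norm _))// aC.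
Qed.

Lemma normal_tail_cvg0 : N `[n%:R, +oo[%classic @[n --> \oo] --> 0%E.
Proof.
rewrite -(measure0 (normal_prob (0 : R) 1)).
have -> : set0 = \bigcap_n `[n%:R, +oo[%classic :> set R.
  apply/esym/seteqP; split => // x /(_ (Num.truncn x).+1 I).
  by rewrite /= in_itv /= andbT leNgt truncnS_gt.
apply: nonincreasing_cvg_mu => //.
- by rewrite -ge0_fin_numE// fin_num_measure.
- by apply: bigcap_measurableType => k _.
- move=> m n mn; apply/subsetPset => x /=; rewrite !in_itv /= !andbT; apply: le_trans.
  by rewrite ler_nat.
Qed.

Lemma HD_outside a : ~ Hspace mu a -> HD mu a = 0%E.
Proof.
move=> nHa; apply/eqP; rewrite eq_le HD_ge0 andbT.
apply: (cvge_to_ge normal_tail_cvg0); apply: nearW => n.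
(* Otherwise a would be bounded with constant n, hence in H_mu. A change of sign removes the
   absolute value. *)
have [t [dt ta]] : exists t, dual t /\ n%:R * sd t < t a :> R.
  apply: contrapT => nt; apply: nHa; apply: (covariance_bounded_Hspace hG hB (C := n%:R)).
  move=> t dt; rewrite leNgt; apply/negP => h; apply: nt.
  have [ta|ta] := leP 0 (t a : R).
    by exists t; split => //; rewrite ger0_norm in h.
  exists (dual_scale (-1) t); split; first exact: dual_scale_dual.
  by rewrite Hseminorm_scale// normrN1 mul1r dual_scaleE mulN1r -ltr0_norm.
apply: (le_trans (HD_le _ dt)).
have [t0|t0] := Hseminorm_eq0_gt0 t.
  rewrite (degenerate_tail _ dt t0) ifF//.
  by apply/negbTE; rewrite -ltNge; move: ta; rewrite t0 mulr0.
rewrite (dual_tail hG)//; apply: normal_tail_le.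
by rewrite ler_pdivlMr// ltW.
Qed.

(** If all seminorms vanish, the countably many norming functionals vanish almost surely together,
    and mu is the Dirac mass at 0. *)
Lemma nondegenerate_functional : mu [set 0] != 1%E -> exists t, dual t /\ 0 < sd t.
Proof.
move=> mu0; apply: contrapT => nt; move/eqP: mu0; apply.
have [tau [dtau tle tex]] := norming_sequence hB.
have bE := norm_ballE tle tex.
have tau0 k : sd (tau k) = 0.
  apply/eqP; rewrite eq_le Hseminorm_ge0 andbT leNgt; apply/negP => h.
  by apply: nt; exists (tau k).
have m0 : measurable ([set 0] : set (borel B)).
  apply: borel_closed_measurable.
  by apply: accessible_closed_set1; apply: hausdorff_accessible; exact: norm_hausdorff.
have ae : {ae mu, forall x, forall k, tau k x = 0}.
  by apply: ae_foralln => k; exact: dual_ae0.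
have : mu (~` [set 0]) = 0%E.
  case: ae => A [mA A0 sub]; apply/eqP; rewrite eq_le measure_ge0 andbT -A0.
  apply: le_measure; rewrite ?inE//; first exact: measurableC.
  move=> x x0; apply: sub => /= h; apply: x0 => /=.
  apply/eqP; rewrite -normr_le0; apply/bE => k; by rewrite h.
move=> h; have := probability_setC mu m0; rewrite h => /esym/eqP.
by rewrite sube_eq ?fin_num_measure// add0e => /eqP.
Qed.

(** The lower bound is [HD_ge_tail]; the half spaces of a representing sequence attain it in the
    limit. Under the Dirac mass at 0 every half space through a = 0 has measure 1, while 1 - Phi 0 =
    1/2. *)
Lemma HD_inside a : mu [set 0] != 1%E -> Hspace mu a ->
  HD mu a = (1 - Phi (Hnorm mu a))%:E.
Proof.
move=> mu0 Ha; rewrite -normal_tailE.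
(* [Hnorm] is chosen by [xget] among limits along representing sequences; this recovers a sequence
   behind the chosen value. *)
have : exists r : R, exists2 f, represents mu f a & sd (f n) @[n --> \oo] --> r.
  by have [f rf] := Ha; have [C [_ h _ _]] := represents_limit hG hB rf; exists C, f.
move=> /(xgetPex (0 : R)); rewrite -/(Hnorm mu a); set r := Hnorm mu a.
move=> [f rf fr]; have [C [C0 fC aC faC]] := represents_limit hG hB rf.
have -> : r = C by exact: (cvg_unique _ fr fC).
have [df _ _] := rf.
apply/eqP; rewrite eq_le HD_ge_tail// andbT.
(* For C = 0 the quotients f_n a / sd(f_n) are meaningless; any nondegenerate functional vanishes at
   a and gives the tail at 0. *)
have [C_eq0|Cp] : C = 0 \/ 0 < C.
  by move: C0; rewrite le_eqVlt => /predU1P[<-|]; [left|right].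
  have [t [dt tp]] := nondegenerate_functional mu0.
  apply: (le_trans (HD_le _ dt)); rewrite (dual_tail hG)//.
  have := aC t dt; rewrite C_eq0 mul0r normr_le0 => /eqP ->.
  by rewrite mul0r.
(* The sequence is shifted by n0 so that all seminorms are positive. *)
have [n0 _ hn0] : \forall n \near \oo, 0 < sd (f n) by apply: (cvgr_gt C fC).
apply: (@normal_tail_lim _ (fun n => f (n + n0)%N a / sd (f (n + n0)%N))).
  have -> : C = C ^+ 2 / C by rewrite expr2 mulfK// gt_eqF.
  have : (f n a : R) / sd (f n) @[n --> \oo] --> C ^+ 2 / C.
    by apply: cvgM => //; apply: cvgV; rewrite ?gt_eqF.
  by rewrite -(cvg_shiftn n0).
move=> n; apply: (le_trans (HD_le _ (df (n + n0)%N))).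
by rewrite (dual_tail hG)//; apply: hn0; rewrite /= leq_addl.
Qed.

Lemma HD_inside_gt0 a : Hspace mu a -> (0 < HD mu a)%E.
Proof.
move=> /(Hspace_covariance_bounded hG hB)[C _ aC].
exact: lt_le_trans (normal_tail_gt0 C) (HD_ge_tail aC).
Qed.

Lemma HD_zero_set : [set a | HD mu a = 0%E] = ~` Hspace mu.
Proof.
apply/seteqP; split => a /=; last exact: HD_outside.
by move=> a0 /HD_inside_gt0; rewrite a0 ltxx.
Qed.

Lemma covariance_bounded_closed C : closed [set a | covariance_bounded mu C a].
Proof.
have -> : [set a | covariance_bounded mu C a] =
    \bigcap_(t in @dual R B) ((fun a => `|t a : R|) @^-1` [set y : R | y <= C * sd t]).
  by apply/seteqP; split => a /= h t dt; exact: h.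
apply: closed_bigI => t dt; apply: preimage_closed; last exact: closed_le.
by move=> x _; apply: cvg_norm; exact: dt.
Qed.

(** A countable union of closed sets: this makes H_mu Borel and lets its measure be studied one ball
    at a time. *)
Lemma HspaceE : Hspace mu = \bigcup_n [set a | covariance_bounded mu n%:R a].
Proof.
apply/seteqP; split => a.
  move=> /(Hspace_covariance_bounded hG hB)[C C0 aC].
  exists (Num.truncn C).+1 => // t dt; rewrite (le_trans (aC t dt))//.
  by rewrite ler_wpM2r ?Hseminorm_ge0// ltW// truncnS_gt.
by move=> [n _ /(covariance_bounded_Hspace hG hB)].
Qed.

Lemma measurable_Hspace : measurable (Hspace mu : set (borel B)).
Proof.
rewrite HspaceE; apply: bigcup_measurable => n _.
by apply: borel_closed_measurable; exact: covariance_bounded_closed.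
Qed.

End depth.

(** * Orthonormal functionals *)

Section dimension.
Context (R : realType) (B : completeNormedModType R) (mu : probability (borel B) R).
Hypothesis hG : gaussian mu.
Hypothesis hB : @separable B.
Implicit Types (f g t : {linear B -> R^o}) (a : B) (C : R).
Local Notation sd := (Hseminorm mu).
Local Notation dot := (Hdot mu).

Definition orthonormal K (e : nat -> {linear B -> R^o}) :=
  (forall i, (i < K)%N -> dual (e i)) /\
  forall i j, (i < K)%N -> (j < K)%N -> dot (e i) (e j) = (i == j)%:R.

(** One Gram-Schmidt step: t minus its projection on e 0, ..., e (K - 1). The coefficients are those
    of t and not of the running residual, which agree for orthonormal families. *)
Fixpoint residual (e : nat -> {linear B -> R^o}) t K : {linear B -> R^o} :=
  if K is k.+1 then dual_comb (- dot t (e k)) (residual e t k) (e k) else t.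

Lemma residualE e t K x :
  residual e t K x = t x - \sum_(i < K) dot t (e i) * e i x :> R.
Proof.
elim: K => [|K IH]; first by rewrite big_ord0 subr0.
by rewrite [residual _ _ _]/= dual_combE IH big_ord_recr /= opprD addrA mulNr.
Qed.

Lemma residual_dual e t K : (forall i, (i < K)%N -> dual (e i)) -> dual t ->
  dual (residual e t K).
Proof.
elim: K => // K IH de dt; apply: dual_comb_dual; last exact: de.
by apply: IH => // i iK; apply: de; exact: ltnW.
Qed.

Lemma residual_orthogonal e t K j : orthonormal K e -> dual t -> (j < K)%N ->
  dot (residual e t K) (e j) = 0.
Proof.
move=> [de oe] dt jK.
have main k : (k <= K)%N -> dot (residual e t k) (e j) = if (j < k)%N then 0 else dot t (e j).
  elim: k => [|k IH] kK; first by [].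
  rewrite [residual _ _ _]/= Hdot_combl//; first last.
  - exact: de.
  - exact: de.
  - by apply: residual_dual => // i ik; apply: de; exact: (ltn_trans ik).
  rewrite IH; last exact: ltnW.
  have -> : (j < k.+1)%N = (j == k) || (j < k)%N by rewrite ltnS leq_eqVlt.
  rewrite oe// [k == j]eq_sym.
  case: eqVneq => [<-|jk] /=; first by rewrite ltnn mulr1 subrr.
  by rewrite mulr0 addr0.
by rewrite main// jK.
Qed.

Lemma orthonormal_extend K e t : orthonormal K e -> dual t -> 0 < sd (residual e t K) ->
  exists e', orthonormal K.+1 e'.
Proof.
move=> oe dt rp; have [de ee] := oe.
have dr := residual_dual de dt.
have [du u1 _] := dual_standardize hG dr rp.
set u := dual_scale _ _ in du u1.
have ur j : (j < K)%N -> dot u (e j) = 0.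
  by move=> jK; rewrite (Hdot_scalel hG _ dr (de _ jK)) residual_orthogonal// mulr0.
exists (fun i => if (i < K)%N then e i else u); split.
  by move=> i _; case: ifPn => // iK; exact: de.
move=> i j; rewrite !ltnS => iK jK.
case: ltnP => [iK'|Ki]; case: ltnP => [jK'|Kj].
- exact: ee.
- rewrite HdotC ur// (_ : i == j = false)//.
  by apply/negbTE; rewrite neq_ltn (leq_trans iK' Kj).
- rewrite ur// (_ : i == j = false)//.
  by apply/negbTE; rewrite neq_ltn (leq_trans jK' Ki) orbT.
- have -> : i = K by apply/eqP; rewrite eqn_leq iK Ki.
  have -> : j = K by apply/eqP; rewrite eqn_leq jK Kj.
  by rewrite eqxx -Hseminorm_sqr u1 expr1n.
Qed.

(** A finite orthonormal basis of the functionals modulo those of seminorm 0. *)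
Definition complete_family K e := orthonormal K e /\ forall t, dual t -> sd (residual e t K) = 0.

(** Gram-Schmidt either extends every family or stops at a complete one. *)
Lemma orthonormal_or_complete :
  (forall K, exists e, orthonormal K e) \/ exists K e, complete_family K e.
Proof.
have [h|nh] := pselect (exists K e, complete_family K e); first by right.
left; elim => [|K [e oe]].
  by exists (fun=> \0); split.
have [[t [dt tp]]|nt] := pselect (exists t, dual t /\ 0 < sd (residual e t K)).
  exact: orthonormal_extend oe dt tp.
exfalso; apply: nh; exists K, e; split => // t dt.
have [//|h] := Hseminorm_eq0_gt0 mu (residual e t K).
by exfalso; apply: nt; exists t.
Qed.

Lemma covS_Hspace f : dual f -> covariance_bounded mu (sd f) (covS mu f).
Proof.
move=> df t dt; rewrite (covS_dual hG hB df dt) mulrC.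
exact: Hdot_cauchy_schwarz.
Qed.

Lemma sum_covS_dual K (e : nat -> {linear B -> R^o}) (c : nat -> R) t :
  (forall i, (i < K)%N -> dual (e i)) -> dual t ->
  t (\sum_(i < K) c i *: covS mu (e i)) = \sum_(i < K) c i * dot t (e i) :> R.
Proof.
move=> de dt; rewrite linear_sum; apply: eq_bigr => i _.
by rewrite linearZ /= (covS_dual hG hB (de _ (ltn_ord i)) dt).
Qed.

(** Functionals of seminorm 0 kill H_mu, so t a equals the value at a of the projection of t; this
    gives the coordinates e_i a. *)
Lemma complete_Hspace K e : complete_family K e ->
  Hspace mu = [set \sum_(i < K) c i *: covS mu (e i) | c in [set: 'I_K -> R]].
Proof.
move=> [[de oe] ce]; apply/seteqP; split => a.
  move=> /(Hspace_covariance_bounded hG hB)[C C0 aC].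
  exists (fun i => e i a) => //; apply: dual_separates => t dt.
  rewrite (sum_covS_dual (fun i => e i a : R) de dt).
  have := aC _ (residual_dual de dt); rewrite ce// mulr0 normr_le0 residualE.
  rewrite subr_eq0 => /eqP ->.
  by apply: eq_bigr => i _; rewrite mulrC.
move=> [c _ <-].
apply: (covariance_bounded_Hspace hG hB (C := \sum_(i < K) `|c i| * sd (e i))).
move=> t dt.
have -> : t (\sum_(i < K) c i *: covS mu (e i)) = \sum_(i < K) c i * dot t (e i) :> R.
  rewrite linear_sum; apply: eq_bigr => i _.
  by rewrite linearZ /= (covS_dual hG hB (de _ (ltn_ord i)) dt).
rewrite (le_trans (ler_norm_sum _ _ _))// mulr_suml; apply: ler_sum => i _.
rewrite normrM -mulrA ler_wpM2l// mulrC.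
exact: (Hdot_cauchy_schwarz hG dt (de _ (ltn_ord i))).
Qed.

Lemma complete_finite_dimensional K e : complete_family K e -> finite_dimensional (Hspace mu).
Proof. by move=> /complete_Hspace ->; exists K, (fun i => covS mu (e i)). Qed.

(** Almost surely the residuals of all norming functionals vanish at x, so x is the combination of
    the S e_i with coefficients e_i x. *)
Lemma complete_Hspace_full K e : complete_family K e -> mu (~` Hspace mu) = 0%E.
Proof.
move=> ceK; have [[de oe] ce] := ceK.
have [tau [dtau tle tex]] := norming_sequence hB.
have bE := norm_ballE tle tex.
have [A [mA A0 sub]] : {ae mu, forall x, forall k, residual e (tau k) K x = 0}.
  by apply: ae_foralln => k; apply: (dual_ae0 hG); [exact: residual_dual|exact: ce].
apply/eqP; rewrite eq_le measure_ge0 andbT -A0.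
apply: le_measure; rewrite ?inE//; first by apply: measurableC; exact: measurable_Hspace.
move=> x nHx; apply: sub => /= h; apply: nHx.
rewrite (complete_Hspace ceK); exists (fun i => e i x) => //.
apply/esym/eqP; rewrite -subr_eq0 -normr_le0; apply/bE => k.
have hk := h k; rewrite residualE in hk.
have -> : tau k (x - \sum_(i < K) e i x *: covS mu (e i)) =
    tau k x - \sum_(i < K) dot (tau k) (e i) * e i x :> R.
  rewrite linearB (sum_covS_dual (fun i => e i x : R) de (dtau k)).
  by congr (_ - _); apply: eq_bigr => i _; rewrite mulrC.
by rewrite hk.
Qed.

(** Otherwise there are n + 1 orthonormal e_i, with all S e_i in the span of n vectors; the identity
    matrix of the e_j (S e_i), of size n + 1, would then have rank at most n. *)
Lemma finite_dimensional_complete : finite_dimensional (Hspace mu) ->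
  exists K e, complete_family K e.
Proof.
move=> [n [v Hv]]; have [h|//] := orthonormal_or_complete; exfalso.
have [e [de oe]] := h n.+1.
have ex (i : 'I_n.+1) : exists c : 'I_n -> R, \sum_(k < n) c k *: v k = covS mu (e i).
  have : Hspace mu (covS mu (e i)).
    by apply: (covariance_bounded_Hspace hG hB); apply: covS_Hspace; exact: de.
  by rewrite Hv => -[c _ cE]; exists c.
have [c hc] := choice ex.
pose M1 : 'M[R]_(n.+1, n) := \matrix_(i, k) c i k.
pose M2 : 'M[R]_(n, n.+1) := \matrix_(k, j) (e j (v k) : R).
have M12 : M1 *m M2 = 1%:M.
  apply/matrixP => i j; rewrite !mxE.
  transitivity (e j (covS mu (e i)) : R).
    rewrite -hc linear_sum; apply: eq_bigr => k _.
    by rewrite !mxE linearZ.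
  rewrite (covS_dual hG hB (de _ (ltn_ord i)) (de _ (ltn_ord j))) oe//.
  by rewrite eq_sym.
have := mulmx_max_rank M1 M2; rewrite M12 mxrank1.
by rewrite ltnn.
Qed.

Lemma infinite_dimensional_orthonormal : ~ finite_dimensional (Hspace mu) ->
  forall K, exists e, orthonormal K e.
Proof.
move=> nf; have [//|[K [e /complete_finite_dimensional]]] := orthonormal_or_complete.
by move/nf.
Qed.

Lemma orthonormal_lower K e (c : R) : orthonormal K e ->
  [/\ forall k, (k < K)%N -> measurable ([set x | e k x <= c] : set (borel B)),
      forall k, (k < K)%N -> mu [set x | e k x <= c] = (Phi c)%:E &
      forall k l, (k < K)%N -> (l < K)%N -> k != l ->
        mu ([set x | e k x <= c] `&` [set x | e l x <= c]) = ((Phi c) ^+ 2)%:E].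
Proof.
move=> [de oe].
have e1 k : (k < K)%N -> sd (e k) = 1.
  by move=> kK; rewrite /Hseminorm oe// eqxx sqrtr1.
have E k : [set x | e k x <= c] = e k @^-1` `]-oo, c].
  by apply/seteqP; split => x /=; rewrite in_itv.
split.
- move=> k kK; rewrite E -[X in measurable X]setTI.
  exact: (dual_measurable (de _ kK)).
- move=> k kK; rewrite E (dual_law_standard hG (de _ kK) (e1 _ kK))// /Phi fineK//.
  exact: (fin_num_measure (normal_prob 0 1)).
- move=> k l kK lK kl; apply: (orthonormal_pair_law hG); rewrite ?e1//; try exact: de.
  by rewrite oe// (negbTE kl).
Qed.

Lemma Phi_gt0 (c : R) : 0 < Phi c.
Proof.
rewrite /Phi fine_gt0// normal_lower_gt0/=.
apply: (le_lt_trans (probability_le1 (normal_prob 0 1) _)) => //.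
exact: ltry.
Qed.

Lemma infinite_dimensional_Hspace_null : ~ finite_dimensional (Hspace mu) ->
  mu (Hspace mu) = 0%E.
Proof.
move=> nf; have on := infinite_dimensional_orthonormal nf.
have mH n : measurable ([set a | covariance_bounded mu n%:R a] : set (borel B)).
  by apply: borel_closed_measurable; exact: covariance_bounded_closed.
rewrite (HspaceE hG hB); apply/negligibleP; first exact: bigcupT_measurable.
apply: negligible_bigcup => n.
(* The level must lie below every value of e_k on the set, so each ball of radius n is shown null
   separately. *)
apply: (unavoidable_negligible (Phi_gt0 (- n%:R - 1))) => K.
have [e oe] := on K; have [me pe pee] := orthonormal_lower (- n%:R - 1) oe.
exists (fun k => [set x | e k x <= - n%:R - 1]); split => // a ha k kK /= ac.
have := ha _ (oe.1 _ kK).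
have -> : sd (e k) = 1 by rewrite /Hseminorm oe.2// eqxx sqrtr1.
rewrite mulr1 ler_norml => /andP[+ _]; rewrite leNgt => /negP; apply.
by apply: le_lt_trans ac _; rewrite gtrBl.
Qed.

End dimension.

(** * Empirical depth *)

Section empirical_depth.
Context (R : realType) (B : completeNormedModType R).

Lemma empirical_HD0 (T : Type) (X_ : nat -> T -> borel B) n w (a : B)
    (t : {linear B -> R^o}) : dual t ->
  (forall j, (j < n)%N -> (t (X_ j w) : R) < t a) -> HD (empirical X_ n w) a = 0%E.
Proof.
move=> dt h; apply/eqP; rewrite eq_le HD_ge0 andbT.
apply: ereal_inf_lbound; exists t => //.
rewrite /empirical /= /mscale /= /msum.
rewrite big1 ?mule0// => -[j jn] _ /=.
rewrite diracE memNset//= => /(lt_le_trans (h _ jn)).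
by rewrite ltxx.
Qed.

Lemma mutually_independent_iter (d d' : measure_display)
    (T : measurableType d) (T' : measurableType d') (P : probability T R)
    (X_ : nat -> T -> T') (n : nat) (A : set T') (p : R) :
  mutually_independent P X_ -> measurable A ->
  (forall j, P (X_ j @^-1` A) = p%:E) ->
  P (\bigcap_(j < n) (X_ j @^-1` A)) = (p ^+ n)%:E.
Proof.
move=> ind mA PA.
pose J := [fset j in iota 0 n]%fset.
have JE : [set` J] = `I_n.
  by apply/seteqP; split => j; rewrite /= !inE mem_iota.
have := ind J (fun=> A) (fun=> mA); rewrite JE => ->.
under eq_bigr do rewrite PA.
rewrite prodEFin /J big_imfset//= undup_id ?iota_uniq//.
have -> : iota 0 n = index_iota 0 n by rewrite /index_iota subn0.
by rewrite prodr_const_nat subn0.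
Qed.

Lemma empirical_HD_ae0 (mu : probability (borel B) R) (hG : gaussian mu)
    (hB : separable B) (d : measure_display) (T : measurableType d)
    (P : probability T R) (X_ : nat -> T -> borel B) n (a : B) :
  ~ finite_dimensional (Hspace mu) -> Hspace mu a ->
  (forall j, measurable_fun setT (X_ j)) ->
  mutually_independent P X_ ->
  (forall j (A : set (borel B)), measurable A -> P (X_ j @^-1` A) = mu A) ->
  {ae P, forall w, HD (empirical X_ n w) a = 0%E}.
Proof.
move=> nf Ha mX ind law.
have on := infinite_dimensional_orthonormal hG hB nf.
have [C _ aC] := Hspace_covariance_bounded hG hB Ha.
pose c := - C - 1.
have p0 : 0 < Phi c ^+ n by rewrite exprn_gt0// Phi_gt0.
apply: (unavoidable_negligible p0) => K.
have [e oe] := on K; have [me pe pee] := orthonormal_lower hG c oe.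
pose A k : set (borel B) := [set x | e k x <= c].
have joint (D : set (borel B)) q : measurable D -> mu D = q%:E ->
    P (\bigcap_(j < n) (X_ j @^-1` D)) = (q ^+ n)%:E.
  move=> mD muD; apply: mutually_independent_iter => // j.
  by rewrite law.
exists (fun k => \bigcap_(j < n) (X_ j @^-1` A k)); split.
- move=> k kK; apply: bigcap_measurableType => j _.
  by rewrite -[X in measurable X]setTI; apply: mX => //; exact: me.
- by move=> k kK; apply: joint; [exact: me|exact: pe].
- move=> k l kK lK kl.
  (* Both events together say that all n points lie in A k and A l: (p^2)^n = (p^n)^2, so pairwise
     independence passes from mu to the sample space. *)
  rewrite -exprM mulnC exprM -(joint (A k `&` A l)); first by rewrite -bigcapI.
    by apply: measurableI; exact: me.
  exact: pee.
(* On such an event e_k (X_j) <= c < - C <= e_k a for all j < n, so the half space of e_k through a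
   is empty of data. *)
- move=> w nw k kK hk; apply: nw; apply: (empirical_HD0 (oe.1 _ kK)) => j jn.
  have := hk j jn; rewrite /A/= => h; apply: le_lt_trans h _.
  have := aC _ (oe.1 _ kK).
  have -> : Hseminorm mu (e k) = 1 by rewrite /Hseminorm oe.2// eqxx sqrtr1.
  rewrite mulr1 ler_norml => /andP[+ _]; apply: lt_le_trans.
  by rewrite /c gtrBl.
Qed.

End empirical_depth.

Theorem proposition2 (R : realType) (B : completeNormedModType R)
    (d : measure_display) (T : measurableType d) (P : probability T R)
    (X : {RV P >-> borel B}) (hB : separable B)
    (hX : centered_gaussian P X) :
  let mu := distribution P X in
  let zero_depth : set (borel B) := [set a | HD mu a = 0%E] in
  [/\ (mu [set 0] != 1%E ->
         forall a, Hspace mu a -> HD mu a = (1 - Phi (Hnorm mu a))%:E),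
      (forall a, ~ Hspace mu a -> HD mu a = 0%E),
      [/\ measurable zero_depth,
          (finite_dimensional (Hspace mu) -> mu zero_depth = 0%E)
        & (~ finite_dimensional (Hspace mu) -> mu zero_depth = 1%E)]
    & (~ finite_dimensional (Hspace mu) ->
       forall X_ : nat -> {RV P >-> borel B}, iid_copies P X X_ ->
       forall a, Hspace mu a ->
       [/\ {ae P, forall w, forall n, (0 < n)%N -> HD (empirical X_ n w) a = 0%E},
           (exists2 e : R, 0 < e &
              {ae P, forall w, forall n, (0 < n)%N ->
                 (e%:E <= `|HD (empirical X_ n w) a - HD mu a|)%E})
         & {ae P, forall w,
              ~ (HD (empirical X_ n w) a @[n --> \oo] --> HD mu a)}])].
Proof.
move=> mu zero_depth.
have hG : gaussian mu by exact: hX.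
have z : zero_depth = ~` Hspace mu by exact: HD_zero_set.
have mH : measurable (Hspace mu : set (borel B)) by exact: measurable_Hspace.
split.
- by move=> mu0 a Ha; exact: HD_inside.
- by move=> a; exact: HD_outside.
- split; first by rewrite z; exact: measurableC.
  + move=> /(finite_dimensional_complete hG hB)[K [e ce]].
    by rewrite z; exact: complete_Hspace_full ce.
  + move=> nf; rewrite z; transitivity (1 - mu (Hspace mu))%E.
      exact: probability_setC.
    have -> : mu (Hspace mu) = 0%E by exact: infinite_dimensional_Hspace_null.
    by rewrite sube0.
move=> nf X_ [ind law] a Ha.
(* One null set serves all n, including n = 0, where the empirical measure is zero. *)
have ae0 : {ae P, forall w n, HD (empirical X_ n w) a = 0%E}.
  apply: ae_foralln => n; apply: (empirical_HD_ae0 hG hB) => //.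
have HD0 := HD_inside_gt0 hG hB Ha.
have HDfin := HD_fin_num mu a.
split.
- by move: ae0; apply: filterS => w h n _.
(* The empirical depth is 0, so the error is exactly the positive true depth. *)
- exists (fine (HD mu a)); first by rewrite fine_gt0// HD0/= ltey_eq HDfin.
  move: ae0; apply: filterS => w h n _.
  by rewrite h sub0e abseN fineK// gee0_abs// ltW.
- move: ae0; apply: filterS => w h; under eq_fun do rewrite h.
  move=> /cvg_lim; rewrite lim_cst// => E.
  by move: HD0; rewrite -E// ltxx.
Qed.
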